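(* For each $N\in\mathbb{N}$, let $h^N=(t_f-t_0)/N$, $t^N_i=t_0+ih^N$ for $i\in\{0,\dots,N\}$, and let the sets $\Omega^N_i\subseteq\mathbb{R}^n$ ($i\in\{0,\dots,N\}$) and $\Gamma^N_i\subseteq\mathbb{R}^n$ ($i\in\{1,\dots,N\}$) be defined by $\Omega^N_0=X_0$ and, for $i\in\{1,\dots,N\}$ and with $h=h^N$, $$\Omega^N_i=\widetilde{\phi}(t^N_i,t^N_{i-1})\,\Omega^N_{i-1}+h\,B(t^N_i)\,U+\big(\alpha(h)+\theta(h)\|\Omega^N_{i-1}\|\big)\mathbb{B},$$ $$\Gamma^N_i=\operatorname{conv}\Big(\Omega^N_{i-1}\cup\big(\Omega^N_i+(\beta(h)+\gamma(h)\|\Omega^N_{i-1}\|)\mathbb{B}\big)\Big).$$ Then $\mathcal{R}([t^N_{i-1},t^N_i])\subseteq\Gamma^N_i$ for all $N\in\mathbb{N}$ and all $i\in\{1,\dots,N\}$, and $$d_H\big(\mathcal{R}([t^N_{i-1},t^N_i]),\Gamma^N_i\big)\le O(1/N)\quad\text{as }N\to\infty,\text{ uniformly with respect to }i.$$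
   Context: Notation. $\mathbb{N}=\{1,2,\dots\}$, $\mathbb{R}_+=[0,\infty)$. Fix a norm $\|\cdot\|$ on $\mathbb{R}^n$ and a norm $\|\cdot\|$ on $\mathbb{R}^m$; matrices carry the induced operator norms. $\mathbb{B}\subseteq\mathbb{R}^n$ is the closed unit ball; $\|M\|=\sup_{x\in M}\|x\|$ for a nonempty set $M$; sums, scalar multiples and matrix images of sets are pointwise (Minkowski); $\operatorname{conv}$ is the convex hull. The Hausdorff distance of nonempty bounded sets is $d_H(\Omega,\Gamma)=\inf\{\varepsilon>0:\Omega\subseteq\Gamma+\varepsilon\mathbb{B},\ \Gamma\subseteq\Omega+\varepsilon\mathbb{B}\}$. ''$f(N,i)\le O(1/N)$ as $N\to\infty$, uniformly w.r.t. $i$'' means: there exist $C\ge 0$, $N_0\in\mathbb{N}$ with $f(N,i)\le C/N$ for all $N\ge N_0$ and all admissible $i$. System and standing assumptions. $n,m\in\mathbb{N}$, $t_0<t_f$ real. $X_0\subseteq\mathbb{R}^n$ and $U\subseteq\mathbb{R}^m$ are nonempty, compact and convex. $A:[t_0,t_f]\to\mathbb{R}^{n\times n}$ and $B:[t_0,t_f]\to\mathbb{R}^{n\times m}$ are of class $C^1$, and $\|A(t)\|\le M_A$, $\|\dot A(t)\|\le M_{\dot A}$, $\|B(t)\|\le M_B$, $\|\dot B(t)\|\le M_{\dot B}$ for all $t\in[t_0,t_f]$, with real constants and $M_A>0$. The system is $\dot x(t)=A(t)x(t)+B(t)u(t)$. For $s\in[t_0,t_f]$, $p\in\mathbb{R}^n$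 and integrable $u$, $\varphi(\cdot,s,p,u)$ is its unique absolutely continuous solution on $[t_0,t_f]$ (the equation holding for almost every $t$) with value $p$ at time $s$; $\phi(t,s)\in\mathbb{R}^{n\times n}$ is the transition matrix, $\phi(t,s)p=\varphi(t,s,p,0)$. Let $D=\{(t,s)\in[t_0,t_f]^2: t\ge s\}$. There are given a map $\widetilde\phi:D\to\mathbb{R}^{n\times n}$ and a monotonically increasing $\theta:\mathbb{R}_+\to\mathbb{R}_+$ with $\|\phi(t,s)-\widetilde\phi(t,s)\|\le\theta(t-s)$ for all $(t,s)\in D$ and $\theta(h)=O(h^2)$ as $h\to0$. Reachable sets and tubes. $\mathcal{R}(t)=\{\varphi(t,t_0,x_0,u): x_0\in X_0,\ u:[t_0,t]\to U\text{ measurable}\}$ and $\mathcal{R}([a,b])=\bigcup_{s\in[a,b]}\mathcal{R}(s)$ for $t_0\le a\le b\le t_f$. Auxiliary functions on $\mathbb{R}_+$: $r(s)=\exp(sM_A)-1-sM_A$, $\ \alpha(s)=r(s)\|U\|\dfrac{M_{\dot B}+M_AM_B}{M_A^2}$, $\ \beta(s)=s^2M_{\dot B}\|U\|$, $\ \gamma(s)=r(s)\Big(1+\dfrac{M_{\dot A}}{M_A^2}\Big)$. *)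

(* Defs.v *)
From HB Require Import structures.
From mathcomp Require Import all_boot all_order all_algebra.
From mathcomp Require Import all_classical all_reals all_analysis.
Import Order.TTheory GRing.Theory Num.Theory.
Import numFieldNormedType.Exports.

Set Implicit Arguments.
Unset Strict Implicit.
Unset Printing Implicit Defensive.

Local Open Scope classical_set_scope.
Local Open Scope ring_scope.

(* [R^n] is ['cV[R]_n].  Its canonical topology (and max norm) is used for the
   notions that do not depend on the choice of a norm: compactness, derivatives,
   absolute continuity.  All quantitative notions take the norm as argument. *)

Section Norms.
Context {R : realType}.

Definition is_norm (V : lmodType R) (N : V -> R) : Prop :=
  [/\ forall x, 0 <= N x,
      forall x, N x = 0 -> x = 0,
      forall (a : R) x, N (a *: x) = `|a| * N x &
      forall x y, N (x + y) <= N x + N y].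

Definition op_norm (n m : nat) (Nm : 'cV[R]_m -> R) (Nn : 'cV[R]_n -> R)
    (M : 'M[R]_(n, m)) : R :=
  sup [set Nn (M *m x) | x in [set x | Nm x <= 1]].

(* [sup] is real-valued: this is the supremum for nonempty bounded sets. *)
Definition set_norm (V : Type) (N : V -> R) (M : set V) : R :=
  sup [set N x | x in M].

End Norms.

Section Sets.
Context {R : realType}.

Definition set_add (V : lmodType R) (M M' : set V) : set V :=
  [set x + y | x in M & y in M'].

Definition set_scale (V : lmodType R) (c : R) (M : set V) : set V :=
  [set c *: x | x in M].

Definition set_mulmx (n m : nat) (Q : 'M[R]_(n, m)) (M : set 'cV[R]_m) :
    set 'cV[R]_n :=
  [set Q *m x | x in M].

Definition unit_ball (V : lmodType R) (N : V -> R) : set V :=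
  [set x | N x <= 1].

Definition conv_hull (V : lmodType R) (M : set V) : set V :=
  smallest (@convex_set R V) M.

(* Valued in the extended reals, so that the infimum of the empty set is [+oo];
   for nonempty bounded sets the value is finite. *)
Definition hausdorff_dist (V : lmodType R) (N : V -> R) (M M' : set V) : \bar R :=
  ereal_inf [set e%:E | e in [set e : R | [/\ 0 < e,
    M `<=` set_add M' (set_scale e (unit_ball N)) &
    M' `<=` set_add M (set_scale e (unit_ball N))]]].

End Sets.

Section Systems.
Context {R : realType}.

(* [f] is of class C^1 on [a, b] with derivative [df]; the difference quotients
   only involve points of [a, b], hence are one-sided at the endpoints. *)
Definition C1_on (V : normedModType R) (a b : R) (f df : R -> V) : Prop :=
  (forall t, t \in `[a, b] ->
    (fun s => (s - t)^-1 *: (f s - f t)) @ within `[a, b] t^' --> df t) /\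
  {within `[a, b], continuous df}.

Definition absolutely_continuous_on (V : normedModType R) (a b : R)
    (f : R -> V) : Prop :=
  forall e : R, 0 < e -> exists2 d : R, 0 < d &
    forall (k : nat) (l r : 'I_k -> R),
      (forall i, [/\ a <= l i, l i <= r i & r i <= b]) ->
      trivIset [set: 'I_k] (fun i => `]l i, r i[%classic) ->
      \sum_(i < k) (r i - l i) < d ->
      \sum_(i < k) `|f (r i) - f (l i)| < e.

(* Measurability is with respect to the sigma-algebra of Lebesgue measurable
   sets; the canonical one on [R] in the library is the Borel sigma-algebra. *)
Definition lebesgue_measurable_fun (m : nat) (D : set R) (u : R -> 'cV[R]_m) :
    Prop :=
  let T := caratheodory_type ((@wlength R idfun)^*)%mu in
  forall i, @measurable_fun _ _ T (measurableTypeR R) D (fun s => u s i 0).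

(* [x] is an absolutely continuous solution on [a, b] of x' = A x + B u with
   value [p] at time [s]. *)
Definition is_solution (n m : nat) (A : R -> 'M[R]_n) (B : R -> 'M[R]_(n, m))
    (a b s : R) (p : 'cV[R]_n) (u : R -> 'cV[R]_m) (x : R -> 'cV[R]_n) : Prop :=
  [/\ absolutely_continuous_on a b x,
      x s = p &
      {ae lebesgue_measure, forall t, t \in `[a, b] ->
        is_derive (t : R^o) 1 (x : R^o -> 'cV[R]_n) (A t *m x t + B t *m u t)}].

(* The transition matrix phi(t, s) of x' = A x on [a, b]: the matrix M such that
   M p is the value at time t of the solution with value p at time s. *)
Definition transition (n m : nat) (A : R -> 'M[R]_n) (B : R -> 'M[R]_(n, m))
    (a b t s : R) : 'M[R]_n :=
  xget 0 [set M | forall p, exists2 x,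
    is_solution A B a b s p (fun=> 0) x & M *m p = x t].

(* The control only matters on [t0, t], so the solution is taken there. *)
Definition reach (n m : nat) (A : R -> 'M[R]_n) (B : R -> 'M[R]_(n, m))
    (X0 : set 'cV[R]_n) (U : set 'cV[R]_m) (t0 t : R) : set 'cV[R]_n :=
  [set y | exists x0 u x, [/\ X0 x0,
    lebesgue_measurable_fun `[t0, t] u,
    forall s, s \in `[t0, t] -> U (u s),
    is_solution A B t0 t t0 x0 u x & y = x t]].

Definition reach_tube (n m : nat) (A : R -> 'M[R]_n) (B : R -> 'M[R]_(n, m))
    (X0 : set 'cV[R]_n) (U : set 'cV[R]_m) (t0 a b : R) : set 'cV[R]_n :=
  \bigcup_(s in `[a, b]) reach A B X0 U t0 s.

End Systems.

Section Scheme.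
Context {R : realType}.

Definition step (t0 tf : R) (N : nat) : R := (tf - t0) / N%:R.

Definition node (t0 tf : R) (N i : nat) : R := t0 + i%:R * step t0 tf N.

Definition rfun (MA s : R) : R := expR (s * MA) - 1 - s * MA.

(* [nU] stands for the norm of the control set. *)
Definition alpha (MA MB MdB nU s : R) : R :=
  rfun MA s * nU * ((MdB + MA * MB) / MA ^+ 2).

Definition beta (MdB nU s : R) : R := s ^+ 2 * MdB * nU.

Definition gamma (MA MdA s : R) : R := rfun MA s * (1 + MdA / MA ^+ 2).

End Scheme.

(* Main.v *)
Require Import Defs.
From mathcomp Require Import all_boot all_order all_algebra.
From mathcomp Require Import all_classical all_reals all_analysis.
From mathcomp Require Import measurable_realfun ring lra.
Import Order.TTheory GRing.Theory Num.Theory.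
Import numFieldNormedType.Exports.

(** Along a trajectory, variation of constants gives
    x(t) = phi(t,s) x(s) + int_s^t phi(t,r) B(r) u(r) dr.
    The integral of B(t) u lies in (t - s) B(t) U because U is compact and
    convex, and replacing phi(t,r) B(r) by B(t) under the integral costs at most
    alpha(t - s).  Hence every Omega_i contains the reachable set at the node
    t_i.  Between two nodes, gamma bounds the deviation of phi(.,t_i) from its
    chord, beta the variation of B, and alpha(l h) <= l alpha(h) for l in [0,1];
    so the trajectory stays in the hull Gamma_i ([tube_Gamma]).  Conversely, one
    step of the scheme enlarges the sets by O(h^2) only, so that after N steps,
    by a discrete Gronwall argument, Omega_i is within O(h) of the reachable set
    ([Omega_reach]); and Gamma_{i+1} is within O(h) of the convex set Omega_i ([Gamma_reach]).

    No integral along a control is formed.  Its role is played by Cousin's lemma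
    ([cousin]) through the mean value inclusion [ac_mean_value]: if almost
    everywhere the derivative of an absolutely continuous w is within rho' of
    K U, with U compact and convex, then w(b) - w(a) is within rho(b) - rho(a)
    of (b - a) K U.  One sums over a partition that is fine for a gauge adapted
    to the derivatives, and [ac_null_gauge] makes the intervals around
    exceptional points negligible.  Applied to r |-> phi(t,r) x(r), this gives
    [local_reach].  The transition matrix is X(t) Y(s), where X is a matrix
    solution obtained by Picard iteration ([linear_ode]) and Y is its inverse
    ([fundamental], [transition_eq]); its estimates come from the same mean value
    principle ([gronwall], [kernel_bound], [second_difference]).  Reachable
    points near a given point of Omega_i are produced by controls that are
    constant on each step ([reach_step]). *)

Set Implicit Arguments.
Unset Strict Implicit.
Unset Printing Implicit Defensive.
Local Open Scope classical_set_scope.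
Local Open Scope ring_scope.

(** * Norms on column vectors *)

Section NormFacts.
Context {R : realType}.

Section Abstract.
Context {V : lmodType R} (N : V -> R) (hN : is_norm N).

Lemma nrm_ge0 x : 0 <= N x. Proof. by case: hN. Qed.
Lemma nrm_eq0 x : N x = 0 -> x = 0. Proof. by case: hN => _ h _ _; exact: h. Qed.
Lemma nrmZ a x : N (a *: x) = `|a| * N x. Proof. by case: hN. Qed.
Lemma nrmD x y : N (x + y) <= N x + N y. Proof. by case: hN. Qed.
Lemma nrm0 : N 0 = 0. Proof. by rewrite -(scale0r 0) nrmZ normr0 mul0r. Qed.
Lemma nrmN x : N (- x) = N x.
Proof. by rewrite -scaleN1r nrmZ normrN1 mul1r. Qed.
Lemma nrmB x y : N (x - y) <= N x + N y.
Proof. by rewrite (le_trans (nrmD _ _))// nrmN. Qed.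
Lemma nrmBC x y : N (x - y) = N (y - x).
Proof. by rewrite -nrmN opprB. Qed.
Lemma nrmZp a x : 0 <= a -> N (a *: x) = a * N x.
Proof. by move=> a0; rewrite nrmZ ger0_norm. Qed.
Lemma norm_dist_triangle z x y : N (x - y) <= N (x - z) + N (z - y).
Proof. by rewrite (le_trans _ (nrmD _ _))// addrA subrK. Qed.
Lemma norm_le_dist x y : N x <= N y + N (x - y).
Proof. by rewrite (le_trans _ (nrmD _ _))// addrCA subrr addr0. Qed.
Lemma nrm_sum n (F : 'I_n -> V) : N (\sum_i F i) <= \sum_i N (F i).
Proof.
elim/big_ind2 : _ => [|x a y b ha hb|//]; first by rewrite nrm0.
by rewrite (le_trans (nrmD _ _))// lerD.
Qed.

End Abstract.

Lemma mx_entry_le m n (M : 'M[R]_(m, n)) i j : `|M i j| <= `|M|.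
Proof.
rewrite [leRHS]/Num.norm /= mx_normrE.
exact: (le_bigmax _ (fun ij : 'I_m * 'I_n => `|M ij.1 ij.2|) (i, j)).
Qed.

Lemma mx_norm_le m n (M : 'M[R]_(m, n)) c :
  0 <= c -> (forall i j, `|M i j| <= c) -> `|M| <= c.
Proof.
move=> c0 h; rewrite [leLHS]/Num.norm /= mx_normrE.
by apply/bigmax_leP; split => // -[i j] _; exact: h.
Qed.

Lemma mulmx_norm_le m n p (M : 'M[R]_(m, n)) (M' : 'M[R]_(n, p)) :
  `|M *m M'| <= n%:R * `|M| * `|M'|.
Proof.
apply: mx_norm_le => [|i j]; first by rewrite !mulr_ge0.
rewrite mxE (le_trans (ler_norm_sum _ _ _))//.
apply: (@le_trans _ _ (\sum_(k < n) `|M| * `|M'|)).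
  by apply: ler_sum => k _; rewrite normrM ler_pM// mx_entry_le.
by rewrite sumr_const card_ord -[leLHS]mulr_natl mulrA.
Qed.

Lemma trmx_norm m n (M : 'M[R]_(m, n)) : `|M^T| = `|M|.
Proof.
apply/eqP; rewrite eq_le; apply/andP; split; apply: mx_norm_le => // i j.
  by rewrite mxE mx_entry_le.
by have := mx_entry_le M^T j i; rewrite mxE.
Qed.

Section OnColumns.
Context {n : nat} (N : 'cV[R]_n -> R) (hN : is_norm N).

Lemma col_decomp (x : 'cV[R]_n) : x = \sum_i x i 0 *: delta_mx i 0.
Proof.
apply/colP => i; rewrite summxE (bigD1 i)//= big1 ?addr0.
  by rewrite !mxE !eqxx mulr1.
by move=> j ji; rewrite !mxE eq_sym (negPf ji) mulr0.
Qed.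

Lemma norm_le_mx_norm : exists2 C, 0 < C & forall x, N x <= C * `|x|.
Proof.
exists (1 + \sum_(i < n) N (delta_mx i 0)).
  by rewrite ltr_wpDr// sumr_ge0// => i _; exact: nrm_ge0.
move=> x; rewrite [x in N x]col_decomp (le_trans (nrm_sum hN _))// mulrDl mul1r.
apply: ler_wpDl => //; rewrite mulr_suml ler_sum// => i _.
by rewrite (nrmZ hN) mulrC ler_wpM2l ?nrm_ge0 ?mx_entry_le.
Qed.

Lemma nrm_continuous : continuous N.
Proof.
have [C C0 hC] := norm_le_mx_norm.
move=> x; apply/(@cvgrPdist_le _ R^o _ (nbhs x) (nbhs_filter x)) => e e0.
apply/nbhs_ballP; exists (e / C); first by rewrite /= divr_gt0.
move=> y; rewrite -ball_normE /= => /ltW xy.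
have NC : N (x - y) <= e.
  by rewrite (le_trans (hC _))// mulrC -ler_pdivlMr.
rewrite ler_norml; apply/andP; split.
  by rewrite lerNl opprB lerBlDl (le_trans (norm_le_dist hN y x))// lerD2l nrmBC.
by rewrite lerBlDl (le_trans (norm_le_dist hN x y))// lerD2l.
Qed.

(** With [norm_le_mx_norm], this is the equivalence of N with the max norm: N
    has a positive minimum on the compact unit sphere, which is taken among row
    vectors, where [bounded_closed_compact] applies. *)
Lemma mx_norm_le_norm : exists2 C, 0 < C & forall x, `|x| <= C * N x.
Proof.
pose S := [set x : 'rV[R]_n | `|x| = 1].
have Sc : compact S.
  apply: bounded_closed_compact.
    by exists 1; split => // M M1 x /= ->; exact: ltW.
  rewrite (_ : S = (fun x : 'rV[R]_n => `|x|) @^-1` [set 1])//.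
  by apply: closed_comp => // x _; exact: norm_continuous.
have [S0|S0] := eqVneq S set0.
  exists 1 => // x; have [->|x0] := eqVneq x 0.
    by rewrite normr0 mulr_ge0// nrm_ge0.
  have : S (`|x|^-1 *: x^T) by rewrite /S /= normrZ trmx_norm normfV normr_id mulVf ?normr_eq0.
  by rewrite S0.
have Tc : {within S, continuous (fun x : 'rV[R]_n => N x^T)}.
  apply: continuous_subspaceT => x.
  apply: continuous_comp; last exact: nrm_continuous.
  apply/(@cvgrPdist_le _ _ _ (nbhs x) (nbhs_filter x)) => e e0; apply/nbhs_ballP; exists e => //.
  by move=> y; rewrite -ball_normE /= -linearB/= trmx_norm => /ltW.
have /set0P S1 := S0.
have [c + cmin] := compact_EVT_min S1 Sc Tc.
rewrite inE /S/= => c1.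
have Nc : 0 < N c^T.
  rewrite lt_neqAle nrm_ge0// andbT eq_sym; apply/negP => /eqP /(nrm_eq0 hN) c0.
  by move: c1; rewrite -trmx_norm c0 normr0 => /esym/eqP; rewrite oner_eq0.
exists (N c^T)^-1; first by rewrite invr_gt0.
move=> x; rewrite ler_pdivlMl//.
have [->|x0] := eqVneq x 0; first by rewrite normr0 mulr0 nrm_ge0.
have : N c^T <= N (`|x|^-1 *: x^T)^T.
  apply: cmin; rewrite inE /S /= normrZ trmx_norm normfV normr_id mulVf//.
  by rewrite normr_eq0.
rewrite linearZ/= trmxK (nrmZp hN) ?invr_ge0// mulrC.
by rewrite ler_pdivlMr ?normr_gt0.
Qed.

End OnColumns.

(** The supremum defining [op_norm] is over a bounded set, by equivalence of the
    norms with the max norms. *)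
Lemma op_norm_le n m (Nm : 'cV[R]_m -> R) (Nn : 'cV[R]_n -> R)
    (hm : is_norm Nm) (hn : is_norm Nn) (M : 'M[R]_(n, m)) x :
  Nn (M *m x) <= op_norm Nm Nn M * Nm x.
Proof.
have [C C0 hC] := norm_le_mx_norm hn.
have [D D0 hD] := mx_norm_le_norm hm.
have ub : has_ubound [set Nn (M *m x) | x in [set x | Nm x <= 1]].
  exists (C * (m%:R * `|M| * D)) => _ [y /= y1 <-].
  rewrite (le_trans (hC _))// ler_wpM2l// ?(ltW C0)//.
  rewrite (le_trans (mulmx_norm_le _ _))// ler_wpM2l// ?mulr_ge0//.
  by rewrite (le_trans (hD _))// ger_pMr.
have [->|x0] := eqVneq x 0; first by rewrite mulmx0 (nrm0 hm) (nrm0 hn) mulr0.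
have Nx : 0 < Nm x.
  rewrite lt_neqAle nrm_ge0// andbT eq_sym; apply/negP => /eqP /(nrm_eq0 hm) c0.
  by rewrite c0 eqxx in x0.
have : Nn (M *m ((Nm x)^-1 *: x)) <= op_norm Nm Nn M.
  apply: ub_le_sup => //; exists ((Nm x)^-1 *: x) => //=.
  by rewrite (nrmZp hm) ?invr_ge0 ?(ltW Nx)// mulVf ?gt_eqF.
rewrite -scalemxAr (nrmZp hn) ?invr_ge0 ?(ltW Nx)// mulrC.
by rewrite ler_pdivrMr.
Qed.

Lemma op_norm_ge0 n m (Nm : 'cV[R]_m -> R) (Nn : 'cV[R]_n -> R)
    (hm : is_norm Nm) (hn : is_norm Nn) (M : 'M[R]_(n, m)) :
  (0 < m)%N -> 0 <= op_norm Nm Nn M.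
Proof.
case: m Nm hm M => // m Nm hm M _.
have N1 : 0 < Nm (const_mx 1).
  rewrite lt_neqAle nrm_ge0// andbT eq_sym; apply/negP => /eqP /(nrm_eq0 hm).
  by move=> /colP/(_ 0); rewrite !mxE => /eqP; rewrite oner_eq0.
rewrite -(pmulr_lge0 _ N1); apply: le_trans (op_norm_le hm hn M _).
exact: nrm_ge0.
Qed.

Lemma set_norm_ge (V : Type) (N : V -> R) (M : set V) C x :
  (forall y, M y -> N y <= C) -> M x -> N x <= set_norm N M.
Proof.
move=> h Mx; apply: ub_le_sup; last by exists x.
by exists C => _ [y My <-]; exact: h.
Qed.

Lemma set_norm_le (V : Type) (N : V -> R) (M : set V) C :
  M !=set0 -> (forall y, M y -> N y <= C) -> set_norm N M <= C.
Proof.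
move=> [x Mx] h; apply: ge_sup; first by exists (N x); exists x.
by move=> _ [y My <-]; exact: h.
Qed.

End NormFacts.

(** * Cousin's lemma and a mean value inclusion *)

Section Cousin.
Context {R : realType}.

(** The supremum of the right endpoints c with [P a c] is such an endpoint itself
    and cannot be smaller than b.  In the sequel, this induction over gauge-fine
    partitions takes the place of integration. *)
Lemma cousin (a b : R) (P : R -> R -> Prop) : a <= b ->
  (forall l m r, a <= l -> l <= m -> m <= r -> r <= b ->
     P l m -> P m r -> P l r) ->
  (forall t, a <= t <= b -> exists2 d, 0 < d & forall l r,
     a <= l -> l <= t -> t <= r -> r <= b -> t - d < l -> r < t + d -> P l r) ->
  P a b.
Proof.
move=> ab Padd Ploc.
pose S := [set c | a <= c <= b /\ P a c].
have Sa : S a.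
  rewrite /S /= lexx ab; split=> //.
  have [|d d0 h] := Ploc a; first by rewrite lexx ab.
  by apply: h => //; [rewrite ltrBlDr ltrDl | rewrite ltrDl].
have Sb : has_ubound S by exists b => x [/andP[]].
have hS : has_sup S by split => //; exists a.
have ac : a <= sup S by exact: ub_le_sup.
have cb : sup S <= b by apply: ge_sup => [|x [/andP[]]]//; exists a.
have [|d d0 h] := Ploc (sup S); first by rewrite ac cb.
have [s [/andP[as_ sb] Ps] sc] := sup_adherent d0 hS.
have sS : s <= sup S by apply: ub_le_sup => //; split => //; rewrite as_ sb.
have ext r : sup S <= r -> r <= b -> r < sup S + d -> P a r.
  by move=> cr rb rd; apply: (Padd a s r) => //; [exact: le_trans cr|exact: h].
have [cb'|bc] := ltP (sup S) b; last first.
  by apply: ext => //; rewrite (le_lt_trans bc)// ltrDl.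
have : S (Num.min b (sup S + d / 2)).
  split.
    rewrite le_min ab ge_min lexx/= andbT (le_trans ac)// lerDl divr_ge0// ltW//.
  apply: ext.
  - by rewrite le_min cb lerDl divr_ge0// ltW.
  - by rewrite ge_min lexx.
  - by rewrite gt_min ltrD2l [X in _ || X](_ : _ = true) ?orbT//; apply/idP; lra.
move/(ub_le_sup Sb); rewrite leNgt => /negP; case.
by rewrite lt_min cb' ltrDl divr_gt0.
Qed.

Lemma locally_bounded_bounded (V : normedModType R) (f : R -> V) a b : a <= b ->
  (forall t, a <= t <= b -> exists d B, [/\ 0 < d, 0 <= B &
     forall s, a <= s <= b -> `|s - t| < d -> `|f s| <= B]) ->
  exists2 B, 0 <= B & forall t, a <= t <= b -> `|f t| <= B.
Proof.
move=> ab loc.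
apply: (@cousin a b (fun l r => exists2 B, 0 <= B & forall t, l <= t <= r -> `|f t| <= B)) => //.
  move=> l m r _ lm mr _ [B1 B10 h1] [B2 B20 h2].
  exists (B1 + B2); first exact: addr_ge0.
  move=> t /andP[lt tr]; have [tm|/ltW mt] := leP t m.
    by rewrite (le_trans (h1 _ _)) ?lt ?lerDl.
  by rewrite (le_trans (h2 _ _)) ?mt ?lerDr.
move=> t /loc[d [B [d0 B0 hB]]]; exists d => // l r al lt tr rb ld rd.
exists B => // s /andP[ls sr]; apply: hB; last by rewrite ltr_norml; apply/andP; split; lra.
by rewrite (le_trans al)// (le_trans sr).
Qed.

Lemma convex_setP (V : lmodType R) (A : set V) :
  (@convex_set R V A) <->
  (forall x y (l : R), 0 <= l <= 1 -> A x -> A y -> A (l *: x + (1 - l) *: y)).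
Proof.
split=> [cA x y l /andP[l0 l1] Ax Ay|cA x y l].
  pose l' : {i01 R} := Itv01 l0 l1.
  have := cA x y l'; rewrite !inE => /(_ Ax Ay).
  by [].
rewrite !inE => Ax Ay; apply: (cA x y l%:num) => //.
by apply/andP; split.
Qed.

(** An increment close to (r - l) K U is an additive property of the interval,
    because a weighted mean of two points of U is again in U. *)
Lemma convex_mean_value (E V : lmodType R) (N : V -> R) (hN : is_norm N)
    (U : set E) (K : {linear E -> V}) (w : R -> V) (g : R -> R) (a b : R) :
  a <= b -> @convex_set R E U ->
  (forall t, a <= t <= b -> exists2 d, 0 < d & forall l r,
     a <= l -> l <= t -> t <= r -> r <= b -> t - d < l -> r < t + d ->
     exists2 v, U v & N (w r - w l - (r - l) *: K v) <= g r - g l) ->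
  exists2 v, U v & N (w b - w a - (b - a) *: K v) <= g b - g a.
Proof.
move=> ab /convex_setP cU loc.
apply: (@cousin a b (fun l r =>
  exists2 v, U v & N (w r - w l - (r - l) *: K v) <= g r - g l)) => //.
move=> l m r _ lm mr _ [v1 U1 h1] [v2 U2 h2].
have [lr|lr] := eqVneq l r.
  have -> : r = m by apply/eqP; rewrite eq_le -{1}lr lm mr.
  by exists v1.
have rl0 : 0 < r - l by rewrite subr_gt0 lt_neqAle lr (le_trans lm).
exists (((m - l) / (r - l)) *: v1 + (1 - (m - l) / (r - l)) *: v2).
  apply: cU => //; rewrite divr_ge0 ?subr_ge0 ?(ltW rl0)//=.
    by rewrite ler_pdivrMr// mul1r lerD2r.
  by rewrite -subr_ge0 ltW.
have -> : w r - w l - (r - l) *: K (((m - l) / (r - l)) *: v1 +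
    (1 - (m - l) / (r - l)) *: v2) =
  (w m - w l - (m - l) *: K v1) + (w r - w m - (r - m) *: K v2).
  rewrite [K (_ + _)]linearD ![K (_ *: _)]linearZ/= scalerDr !scalerA.
  have -> : (r - l) * ((m - l) / (r - l)) = m - l by field; rewrite gt_eqF.
  have -> : (r - l) * (1 - (m - l) / (r - l)) = r - m by field; rewrite gt_eqF.
  have -> : w r - w l = (w m - w l) + (w r - w m) by rewrite [RHS]addrC addrA subrK.
  by rewrite opprD addrACA.
apply: (le_trans (nrmD hN _ _)).
have -> : g r - g l = (g m - g l) + (g r - g m) by ring.
exact: lerD.
Qed.

End Cousin.

(** * Absolutely continuous functions near null sets *)

Section AbsolutelyContinuous.
Context {R : realType}.
Local Notation mu := (@lebesgue_measure R).

Lemma null_open_cover (Z : set R) (e : R) : 0 < e -> mu.-negligible Z ->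
  exists G : set R, [/\ open G, Z `<=` G & (mu G < e%:E)%E].
Proof.
move=> e0 [M [mM M0 ZM]].
have [|G [Go MG GM]] := lebesgue_regularity_outer mM _ e0.
  by rewrite [ltLHS]M0.
exists G; split => //; first exact: subset_trans MG.
apply: le_lt_trans GM.
have mG : measurable G by exact: open_measurable.
have mGM : measurable (G `\` M) by exact: measurableD.
apply: (@le_trans _ _ (mu ((G `\` M) `|` M))).
  apply: le_measure; rewrite ?inE//; first exact: measurableU.
  by move=> z Gz; have [Mz|Mz] := pselect (M z); [right|left].
have := measureU2 (mu : {content set _ -> \bar R}) mGM mM.
by rewrite [X in (_ <= _ + X)%E]M0 adde0.
Qed.

Lemma sum_lengths_le (k : nat) (l r : 'I_k -> R) (G : set R) (e : R) :
  open G -> (mu G < e%:E)%E -> (forall i, l i <= r i) ->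
  trivIset [set: 'I_k] (fun i => `]l i, r i[%classic) ->
  (forall i, `]l i, r i[%classic `<=` G) -> \sum_(i < k) (r i - l i) < e.
Proof.
move=> Go Ge lr tI sub; rewrite -lte_fin; apply: le_lt_trans Ge.
rewrite -sumEFin.
rewrite (_ : (\sum_(i < k) _)%E = (\sum_(i < k) mu `]l i, r i[%classic)%E); last first.
  apply: eq_bigr => i _; rewrite lebesgue_measure_itv /= lte_fin.
  case: ltP => [//|rl].
  have -> : r i = l i by apply/eqP; rewrite eq_le rl lr.
  by rewrite subrr.
have mI i : measurable `]l i, r i[%classic by exact: measurable_itv.
rewrite -(measure_bigsetU_ord (mu : {content set _ -> \bar R}) predT mI tI).
apply: le_measure; rewrite ?inE.
- apply: bigsetU_measurable => i _; exact: mI.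
- exact: open_measurable.
- by rewrite -bigcup_seq; apply: bigcup_sub => i _; exact: sub.
Qed.

(** Cover Z by an open set G of small measure, and let [g c] be the supremum of
    the sums of |x r - x l| + (r - l) over finite families of disjoint intervals
    ]l, r[ contained in G and in [a, c].  Absolute continuity bounds these sums by
    e, and an interval around a point of Z can be appended to any family that lies
    on its left. *)
Lemma ac_null_gauge (V : normedModType R) (a b : R) (x : R -> V) (Z : set R)
    (e : R) : 0 < e ->
  absolutely_continuous_on a b x -> mu.-negligible Z ->
  exists g : R -> R, [/\ g b - g a <= e,
    forall c c', a <= c -> c <= c' -> c' <= b -> g c <= g c' &
    forall t, Z t -> exists2 d, 0 < d & forall l r,
      a <= l -> l <= t -> t <= r -> r <= b -> t - d < l -> r < t + d ->
      `|x r - x l| + (r - l) <= g r - g l].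
Proof.
move=> e0 ac Zn; have e20 : 0 < e / 2 by rewrite divr_gt0.
have [d d0 hd] := ac _ e20.
have m0 : 0 < Num.min d (e / 2) by rewrite lt_min d0 e20.
have [G [Go ZG Gm]] := null_open_cover m0 Zn.
(* families of k intervals, ordered from left to right, and their sums *)
pose fam (k : nat) (l r : nat -> R) (c : R) :=
  [/\ forall i, (i < k)%N -> [/\ a <= l i, l i <= r i & r i <= c],
      forall i, (i < k)%N -> `]l i, r i[%classic `<=` G &
      forall i j, (i < j)%N -> (j < k)%N -> r i <= l j].
pose val (k : nat) (l r : nat -> R) :=
  \sum_(i < k) (`|x (r i) - x (l i)| + (r i - l i)).
pose S c := [set s | exists k l r, fam k l r c /\ s = val k l r].
have S0 c : S c 0.
  by exists 0%N, (fun=> 0), (fun=> 0); split => //; rewrite /val big_ord0.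
have bnd c s : c <= b -> S c s -> s <= e.
  move=> cb [k [l [r [[f1 f2 f3] ->]]]].
  have tI : trivIset [set: 'I_k] (fun i => `]l i, r i[%classic).
    move=> i j _ _ [z [/=]]; rewrite !in_itv/= => /andP[zi1 zi2] /andP[zj1 zj2].
    apply/val_inj => /=; have [ij|ji|//] := ltngtP i j.
      have := f3 _ _ ij (ltn_ord j); rewrite leNgt => /negP; case.
      exact: lt_trans zi2.
    have := f3 _ _ ji (ltn_ord i); rewrite leNgt => /negP; case.
    exact: lt_trans zj2.
  have lr (i : 'I_k) : l i <= r i by have [] := f1 i (ltn_ord i).
  have := @sum_lengths_le k _ _ G _ Go Gm lr tI (fun i => f2 i (ltn_ord i)).
  rewrite lt_min => /andP[s1 s2].
  rewrite /val big_split/= (splitr e) lerD// ltW//.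
  by apply: hd => // i; have [h1 h2 h3] := f1 i (ltn_ord i); split => //; exact: le_trans cb.
have ub c : c <= b -> has_ubound (S c) by move=> cb; exists e => s; exact: bnd.
exists (fun c => sup (S c)); split.
- rewrite lerBlDr (@le_trans _ _ e)//.
    by apply: ge_sup => [|s]; [exists 0|exact: bnd].
  have [ab|ba] := leP a b; first by rewrite lerDl; apply: ub_le_sup => //; exact: ub.
  rewrite lerDl; have [hs|hs] := pselect (has_sup (S a)).
    by apply: sup_upper_bound.
  by rewrite sup_out.
- move=> c c' ac' cc' c'b; apply: ge_sup; first by exists 0.
  move=> s [k [l [r [[f1 f2 f3] ->]]]]; apply: ub_le_sup; first exact: ub.
  exists k, l, r; split => //; split => // i ik.
    by have [h1 h2 h3] := f1 i ik; split => //; exact: le_trans cc'.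
- move=> t /ZG Gt.
  have [d' /= d'0 hd'] : \forall z \near t, G z by exact: open_nbhs_nbhs.
  exists d' => // l r al lt tr rb dl rd.
  have lb : l <= b by rewrite (le_trans lt)// (le_trans tr).
  rewrite lerBrDr addrC -lerBrDr.
  apply: ge_sup => [|_ [k [l' [r' [[f1 f2 f3] ->]]]]]; first by exists 0.
  rewrite lerBrDr; apply: ub_le_sup; first exact: ub.
  exists k.+1, (fun i => if (i < k)%N then l' i else l),
    (fun i => if (i < k)%N then r' i else r); split.
    split.
    + move=> i; rewrite ltnS => ik; case: ifPn => [/f1[h1 h2 h3]|_]; last first.
        by split => //; exact: le_trans tr.
      by split => //; rewrite (le_trans h3)// (le_trans lt).
    + move=> i ik; case: ifPn => [|_ z]; first exact: f2.
      rewrite /= in_itv/= => /andP[lz zr]; apply: hd'.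
      rewrite /ball_ /= ltr_norml; apply/andP; split; lra.
    + move=> i j ij jk; have ik : (i < k)%N by rewrite (leq_trans ij)// -ltnS.
      by rewrite ik; case: ifPn => [jk'|_]; [exact: f3|have [] := f1 _ ik].
  rewrite /val big_ord_recr/= ltnn; congr (_ + _).
  by apply: eq_bigr => i _; rewrite ltn_ord.
Qed.

End AbsolutelyContinuous.

(** * Derivatives relative to an interval *)

Section Derivatives.
Context {R : realType}.

(** Only points of [a, b] enter the difference quotients, as in [C1_on]; at interior
    points this is [is_derive]. *)
Definition deriv_in (V : normedModType R) (a b : R) (f : R -> V) (t : R)
    (q : V) : Prop :=
  forall e : R, 0 < e -> exists2 d : R, 0 < d & forall y, a <= y <= b ->
    `|y - t| < d -> `|f y - f t - (y - t) *: q| <= e * `|y - t|.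

Section General.
Context {V : normedModType R}.
Implicit Types (f g w : R -> V).

Lemma deriv_in_sub a b a' b' f t q : a <= a' -> b' <= b ->
  deriv_in a b f t q -> deriv_in a' b' f t q.
Proof.
move=> aa bb h e /h[d d0 hd]; exists d => // y /andP[ay yb]; apply: hd.
by rewrite (le_trans aa)// (le_trans yb).
Qed.

Lemma is_derive_deriv_in a b f t q :
  is_derive (t : R^o) 1 (f : R^o -> V) q -> deriv_in a b f t q.
Proof.
case=> df fq e e0.
have : (fun h : R => h^-1 *: (f (h + t) - f t)) @ 0^' --> q.
  have := df; rewrite /derivable => /cvg_ex[l] /=.
  have -> : (fun h : R => h^-1 *: ((f (h%:A + t)) - f t)) =
      (fun h : R => h^-1 *: (f (h + t) - f t)).
    by apply/funext => h; rewrite [_%:A]mulr1.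
  move=> hl; suff -> : q = l by [].
  rewrite -fq; apply: cvg_lim => //=.
  suff -> : (fun h : R => h^-1 *: ((f \o shift (t : R^o)) (h *: (1 : R^o)) - f t)) =
      (fun h : R => h^-1 *: (f (h + t) - f t)) by [].
  by apply/funext => h /=; rewrite [_%:A]mulr1.
move/cvgrPdist_le => /(_ _ e0)[d /= d0 hd].
exists d => // y _ yt; have [->|yt0] := eqVneq y t.
  by rewrite !subrr scale0r subr0 !normr0 mulr0.
have h0 : y - t != 0 by rewrite subr_eq0.
have := hd (y - t); rewrite /= sub0r normrN => /(_ yt h0).
rewrite subrK => h.
rewrite -[f y - f t](scalerKV h0) -scalerBr normrZ mulrC ler_wpM2r//.
by rewrite distrC.
Qed.

Lemma deriv_in_is_derive a b f t q : a < t < b ->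
  deriv_in a b f t q -> is_derive (t : R^o) 1 (f : R^o -> V) q.
Proof.
move=> /andP[at_ tb] h.
have H : (fun h : R => h^-1 *: ((f \o shift (t : R^o)) (h *: (1 : R^o)) - f t)) @ 0^' --> q.
  apply/cvgrPdist_le => e e0; have [d d0 hd] := h _ e0.
  exists (Num.min d (Num.min (t - a) (b - t))).
    by rewrite /= !lt_min d0 !subr_gt0 at_ tb.
  move=> y /=; rewrite sub0r normrN !lt_min => /and3P[yd].
  rewrite !ltr_norml => /andP[y1 y2] /andP[y3 y4] y0; rewrite [_%:A]mulr1.
  have ytab : a <= y + t <= b by apply/andP; split; lra.
  have := hd _ ytab; rewrite addrK => /(_ yd) hy.
  rewrite distrC -[q](scalerK y0) -scalerBr normrZ normfV mulrC.
  by rewrite ler_pdivrMr ?normr_gt0.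
split; first by apply: cvgP; exact: H.
by apply: cvg_lim => //; exact: H.
Qed.

Lemma C1_deriv_in a b f df t : C1_on a b f df -> a <= t <= b ->
  deriv_in a b f t (df t).
Proof.
move=> [h _] tab e e0; have := h t; rewrite in_itv/= => /(_ tab).
move/cvgrPdist_le => /(_ _ e0)[d /= d0 hd].
exists d => // y yab yt; have [->|yt0] := eqVneq y t.
  by rewrite !subrr scale0r subr0 !normr0 mulr0.
have h0 : y - t != 0 by rewrite subr_eq0.
have := hd y; rewrite /= distrC in_itv/= => /(_ yt yt0 yab) hy.
rewrite -[f y - f t](scalerKV h0) -scalerBr normrZ mulrC ler_wpM2r//.
by rewrite distrC.
Qed.

(** The form in which a derivative enters Cousin's lemma: t lies between l and r,
    and the error is measured by the length of the interval. *)
Lemma deriv_in_straddle a b f t q e : deriv_in a b f t q -> 0 < e ->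
  exists2 d, 0 < d & forall l r, a <= l -> l <= t -> t <= r -> r <= b ->
    t - d < l -> r < t + d -> `|f r - f l - (r - l) *: q| <= e * (r - l).
Proof.
move=> h /h[d d0 hd]; exists d => // l r al lt tr rb dl rd.
have -> : f r - f l - (r - l) *: q =
    (f r - f t - (r - t) *: q) - (f l - f t - (l - t) *: q).
  rewrite [RHS]addrAC [in RHS]opprD opprK !opprB addrA.
  rewrite (_ : r - l = (r - t) - (l - t)); last by rewrite opprB addrA subrK.
  rewrite [in LHS]scalerBl opprB.
  rewrite [RHS]addrAC -[RHS]addrA; congr (_ + _); last by rewrite addrC.
  by rewrite addrA subrK.
rewrite (le_trans (ler_normB _ _))//.
have -> : e * (r - l) = e * `|r - t| + e * `|l - t|.
  by rewrite ger0_norm ?subr_ge0// distrC ger0_norm ?subr_ge0//; ring.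
apply: lerD; apply: hd.
- by rewrite rb (le_trans al)// (le_trans lt).
- by rewrite ger0_norm ?subr_ge0//; lra.
- by rewrite al (le_trans lt)// (le_trans tr).
- by rewrite distrC ger0_norm ?subr_ge0//; lra.
Qed.

Lemma deriv_in_local_lipschitz a b f t q : deriv_in a b f t q ->
  exists2 d, 0 < d & forall y, a <= y <= b -> `|y - t| < d ->
    `|f y - f t| <= (`|q| + 1) * `|y - t|.
Proof.
move=> /(_ 1 ltr01)[d d0 hd]; exists d => // y yab /(hd _ yab) h.
rewrite -[f y - f t](subrK ((y - t) *: q)) (le_trans (ler_normD _ _))//.
by rewrite mulrDl addrC lerD// normrZ mulrC.
Qed.

Lemma normr_is_norm : is_norm (fun x : V => `|x|).
Proof.
split => [//|x /eqP|a x|x y]; first by rewrite normr_eq0 => /eqP.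
  by rewrite normrZ.
exact: ler_normD.
Qed.

Lemma convex_set1 (E : lmodType R) (v : E) : @convex_set R E [set v].
Proof. by apply/convex_setP => x y l _ -> ->; rewrite -scalerDl addrC subrK scale1r. Qed.

Lemma deriv_in_congr a b f g t q :
  (forall y, a <= y <= b -> f y = g y) -> a <= t <= b ->
  deriv_in a b f t q -> deriv_in a b g t q.
Proof.
move=> fg tab h e /h[d d0 hd]; exists d => // y yab /(hd _ yab).
by rewrite !fg.
Qed.

Lemma deriv_in_cst a b (c : V) t : deriv_in a b (fun=> c) t 0.
Proof.
by move=> e e0; exists 1 => // y _ _; rewrite subrr scaler0 subr0 normr0 mulr_ge0// ltW.
Qed.

Lemma deriv_inD a b f g t p q : deriv_in a b f t p -> deriv_in a b g t q ->
  deriv_in a b (fun s => f s + g s) t (p + q).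
Proof.
move=> hf hg e e0; have e20 : 0 < e / 2 by rewrite divr_gt0.
have [d d0 hd] := hf _ e20; have [d' d'0 hd'] := hg _ e20.
exists (Num.min d d'); first by rewrite lt_min d0.
move=> y yab; rewrite lt_min => /andP[/(hd _ yab) h1 /(hd' _ yab) h2].
have -> : f y + g y - (f t + g t) - (y - t) *: (p + q) =
   (f y - f t - (y - t) *: p) + (g y - g t - (y - t) *: q).
  by rewrite scalerDr !opprD [RHS]addrACA [X in X + _]addrACA.
by rewrite (le_trans (ler_normD _ _))// (splitr e) mulrDl lerD.
Qed.

Lemma deriv_in_affine a b (c l : R) f t q a' b' :
  (forall y, a <= y <= b -> a' <= c + l * y <= b') ->
  deriv_in a' b' f (c + l * t) q ->
  deriv_in a b (fun s => f (c + l * s)) t (l *: q).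
Proof.
move=> sub h e e0; have e'0 : 0 < e / (`|l| + 1) by rewrite divr_gt0// ltr_wpDl.
have [d d0 hd] := h _ e'0; exists (d / (`|l| + 1)).
  by rewrite divr_gt0// ltr_wpDl.
move=> y yab; rewrite ltr_pdivlMr ?ltr_wpDl// => yt.
have E : c + l * y - (c + l * t) = l * (y - t) by ring.
have := hd (c + l * y) (sub _ yab); rewrite E normrM.
have hlt : `|l| * `|y - t| < d.
  by rewrite (le_lt_trans _ yt)// mulrC ler_wpM2l// lerDl//.
move=> /(_ hlt); rewrite scalerA [(y - t) * l]mulrC => /le_trans; apply.
rewrite mulrA ler_wpM2r// mulrAC ler_pdivrMr ?ltr_wpDl//.
by rewrite ler_wpM2l ?(ltW e0)// lerDl.
Qed.

End General.

Lemma deriv_in_linear (C t : R) a b :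
  deriv_in a b ((fun s => C * s) : R -> R^o) t C.
Proof.
move=> e e0; exists 1 => // y _ _.
rewrite (_ : _ - _ = 0) ?normr0 ?mulr_ge0 ?(ltW e0)//.
by rewrite /GRing.scale/=; ring.
Qed.

Section MeanValue.
Context {V : normedModType R}.
Implicit Types (f g w : R -> V).

(** Instance of [convex_mean_value] with U reduced to the origin and the increment
    bound rho + e1 s, where e1 is arbitrarily small. *)
Lemma deriv_norm_mean_value (N : V -> R) (C : R) a b w (rho drho : R -> R) :
  is_norm N -> 0 < C -> (forall x, N x <= C * `|x|) -> a <= b ->
  (forall t, a <= t <= b -> deriv_in a b (rho : R -> R^o) t (drho t)) ->
  (forall t, a <= t <= b -> exists2 q, deriv_in a b w t q & N q <= drho t) ->
  N (w b - w a) <= rho b - rho a.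
Proof.
move=> hN C0 hC ab rhoP wP; apply/ler_addgt0Pr => e e0.
have e10 : 0 < e / (b - a + 1) by rewrite divr_gt0// ltr_wpDl// subr_ge0.
set e1 := e / (b - a + 1) in e10.
have e120 : 0 < e1 / 2 by rewrite divr_gt0.
have e12C : 0 < e1 / 2 / C by rewrite divr_gt0.
have [|v -> /=] := @convex_mean_value R V V _ hN [set 0] idfun w
  (fun s => rho s + e1 * s) a b ab (@convex_set1 _ _).
  move=> t tab; have [q hq qC] := wP t tab.
  have [d1 d10 h1] := deriv_in_straddle (rhoP _ tab) e120.
  have [d2 d20 h2] := deriv_in_straddle hq e12C.
  exists (Num.min d1 d2); first by rewrite lt_min d10.
  move=> l r al lt tr rb; rewrite ltrBlDl -ltrBlDr lt_min => /andP[l1 l2].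
  rewrite -ltrBlDl lt_min => /andP[r1 r2].
  have rl : 0 <= r - l by rewrite subr_ge0 (le_trans lt).
  exists 0 => //=; rewrite scaler0 subr0.
  have := h1 _ _ al lt tr rb ltac:(lra) ltac:(lra).
  rewrite ler_norml => /andP[+ _]; rewrite /GRing.scale/= => H1.
  have H2 : N (w r - w l - (r - l) *: q) <= e1 / 2 * (r - l).
    rewrite (le_trans (hC _))//.
    have := h2 _ _ al lt tr rb ltac:(lra) ltac:(lra).
    move/(ler_wpM2l (ltW C0)) => /le_trans; apply.
    by rewrite mulrCA mulrA divfK ?gt_eqF.
  have H3 : (r - l) * N q <= (r - l) * drho t by rewrite ler_wpM2l.
  have H4 : N (w r - w l) <= N (w r - w l - (r - l) *: q) + (r - l) * N q.
    rewrite -(nrmZp hN)// -{1}[w r - w l](subrK ((r - l) *: q)).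
    exact: nrmD.
  lra.
rewrite scaler0 subr0 => /le_trans; apply.
have : e1 * (b - a) <= e.
  rewrite /e1 mulrAC ler_pdivrMr ?ltr_wpDl ?subr_ge0//.
  by rewrite ler_wpM2l ?(ltW e0)// lerDl.
by rewrite mulrBr => ?; lra.
Qed.

Lemma deriv_mean_value a b w (rho drho : R -> R) : a <= b ->
  (forall t, a <= t <= b -> deriv_in a b (rho : R -> R^o) t (drho t)) ->
  (forall t, a <= t <= b -> exists2 q, deriv_in a b w t q & `|q| <= drho t) ->
  `|w b - w a| <= rho b - rho a.
Proof.
apply: (@deriv_norm_mean_value (fun x => `|x|) 1) => //.
- exact: normr_is_norm.
- by move=> x; rewrite mul1r.
Qed.

Lemma deriv_in_lipschitz a b w C :
  (forall t, a <= t <= b -> exists2 q, deriv_in a b w t q & `|q| <= C) ->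
  forall l r, a <= l -> l <= r -> r <= b -> `|w r - w l| <= C * (r - l).
Proof.
move=> h l r al lr rb; rewrite mulrBr.
apply: (@deriv_mean_value l r w (fun s => C * s) (fun=> C)) => //.
  by move=> t _; exact: deriv_in_linear.
move=> t /andP[lt tr]; have [|q hq qC] := h t.
  by rewrite (le_trans al)// (le_trans tr).
by exists q => //; exact: deriv_in_sub hq.
Qed.

End MeanValue.

Lemma deriv_in_expR a b (c l t : R) :
  deriv_in a b ((fun s => expR (c + l * s)) : R -> R^o) t (l * expR (c + l * t)).
Proof.
apply: (@deriv_in_affine R^o a b c l expR t _ (Num.min (c + l * a) (c + l * b))
  (Num.max (c + l * a) (c + l * b))).
  move=> y /andP[ay yb]; rewrite ge_min le_max.
  have [l0|/ltW l0] := leP 0 l; apply/andP; split; apply/orP.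
  - by left; rewrite lerD2l ler_wpM2l.
  - by right; rewrite lerD2l ler_wpM2l.
  - by right; rewrite lerD2l ler_wnM2l.
  - by left; rewrite lerD2l ler_wnM2l.
by apply: is_derive_deriv_in; exact: is_derive_expR.
Qed.

Lemma deriv_inZ (V : normedModType R) a b (c : R) (f : R -> V) t p :
  deriv_in a b f t p -> deriv_in a b (fun s => c *: f s) t (c *: p).
Proof.
move=> hf e e0; have e'0 : 0 < e / (`|c| + 1) by rewrite divr_gt0// ltr_wpDl.
have [d d0 hd] := hf _ e'0; exists d => // y yab /(hd _ yab) h.
rewrite -scalerBr scalerA mulrC -scalerA -scalerBr normrZ.
rewrite (le_trans (ler_wpM2l _ h))// mulrA ler_wpM2r// mulrC mulrAC.
by rewrite ler_pdivrMr ?ltr_wpDl// ler_wpM2l ?(ltW e0)// lerDl.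
Qed.

Lemma deriv_inB (V : normedModType R) a b (f g : R -> V) t p q :
  deriv_in a b f t p -> deriv_in a b g t q ->
  deriv_in a b (fun s => f s - g s) t (p - q).
Proof.
move=> hf hg; rewrite -scaleN1r.
have -> : (fun s => f s - g s) = (fun s => f s + (-1) *: g s).
  by apply/funext => s; rewrite scaleN1r.
by apply: deriv_inD => //; exact: deriv_inZ.
Qed.

Lemma deriv_in_mulmx m n p a b (f : R -> 'M[R]_(m, n)) (g : R -> 'M[R]_(n, p))
    t df dg : deriv_in a b f t df -> deriv_in a b g t dg ->
  deriv_in a b (fun s => f s *m g s) t (df *m g t + f t *m dg).
Proof.
move=> hf hg e e0.
(* bounds the sum of the three error terms below, whence the radius e / C *)
pose C := n%:R * (`|g t| + 1) + n%:R * `|df| * (`|dg| + 1) + n%:R * `|f t| + 1.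
have C0 : 0 < C by rewrite /C ltr_wpDl// !addr_ge0// !mulr_ge0// addr_ge0.
have e'0 : 0 < e / C by rewrite divr_gt0.
have [d1 d10 h1] := hf _ e'0; have [d2 d20 h2] := hg _ e'0.
have [d3 d30 h3] := deriv_in_local_lipschitz hg.
have d40 : 0 < (`|dg| + 1)^-1 by rewrite invr_gt0 ltr_wpDl.
exists (Num.min d1 (Num.min d2 (Num.min d3 (Num.min (`|dg| + 1)^-1 (e / C))))).
  by rewrite !lt_min d10 d20 d30 d40.
move=> y yab; rewrite !lt_min => /and5P[/(h1 _ yab) {}h1 /(h2 _ yab) {}h2 /(h3 _ yab) {}h3 y4 y5].
set k := y - t in h1 h2 h3 y4 y5 *.
have gy1 : `|g y| <= `|g t| + 1.
  rewrite -[g y](subrK (g t)) addrC (le_trans (ler_normD _ _))// lerD2l.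
  rewrite (le_trans h3)// mulrC -ler_pdivlMr ?ltr_wpDl// mul1r.
  exact: ltW.
have -> : f y *m g y - f t *m g t - k *: (df *m g t + f t *m dg) =
  (f y - f t - k *: df) *m g y + (k *: df) *m (g y - g t) +
  f t *m (g y - g t - k *: dg).
  rewrite !mulmxBl !mulmxBr scalerDr -!scalemxAl -!scalemxAr.
  move: (f y *m g y) (f t *m g y) (k *: (df *m g y)) (k *: (df *m g t))
    (f t *m g t) (k *: (f t *m dg)) => x1 x2 x3 x4 x5 x6.
  by apply/matrixP => i j; rewrite !mxE; ring.
have k0 : 0 <= `|k| by [].
have hA : `|(f y - f t - k *: df) *m g y| <= e / C * `|k| * (n%:R * (`|g t| + 1)).
  rewrite (le_trans (mulmx_norm_le _ _))//.
  have -> : e / C * `|k| * (n%:R * (`|g t| + 1)) =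
    (n%:R * (e / C * `|k|)) * (`|g t| + 1) by ring.
  by apply: ler_pM; rewrite ?mulr_ge0 ?ler_wpM2l.
have hB : `|(k *: df) *m (g y - g t)| <= e / C * `|k| * (n%:R * `|df| * (`|dg| + 1)).
  rewrite (le_trans (mulmx_norm_le _ _))// normrZ.
  have -> : e / C * `|k| * (n%:R * `|df| * (`|dg| + 1)) =
    n%:R * (`|k| * `|df|) * ((`|dg| + 1) * (e / C)) by ring.
  rewrite ler_wpM2l ?mulr_ge0// (le_trans h3)// ler_wpM2l ?addr_ge0//.
  exact: ltW.
have hC : `|f t *m (g y - g t - k *: dg)| <= e / C * `|k| * (n%:R * `|f t|).
  rewrite (le_trans (mulmx_norm_le _ _))// mulrC.
  by rewrite ler_wpM2r ?mulr_ge0.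
rewrite (le_trans (ler_normD _ _))//.
rewrite (le_trans (lerD (le_trans (ler_normD _ _) (lerD hA hB)) hC))//.
rewrite -!mulrDr mulrAC ler_wpM2r// mulrAC ler_pdivrMr//.
by rewrite ler_wpM2l ?(ltW e0)// lerDl.
Qed.

Lemma deriv_in_mulmxr m n p a b (f : R -> 'M[R]_(m, n)) (q : 'M[R]_(n, p)) t df :
  deriv_in a b f t df -> deriv_in a b (fun s => f s *m q) t (df *m q).
Proof.
move=> h; have := deriv_in_mulmx h (deriv_in_cst a b q t).
by rewrite mulmx0 addr0.
Qed.

Lemma deriv_in_mulmxl m n p a b (M : 'M[R]_(m, n)) (g : R -> 'M[R]_(n, p)) t dg :
  deriv_in a b g t dg -> deriv_in a b (fun s => M *m g s) t (M *m dg).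
Proof.
move=> h; have := deriv_in_mulmx (deriv_in_cst a b M t) h.
by rewrite mul0mx add0r.
Qed.

End Derivatives.

(** * The mean value inclusion for absolutely continuous functions *)

Section ACMeanValue.
Context {R : realType}.
Local Notation mu := (@lebesgue_measure R).

(** Serves for products of an absolutely continuous function with Lipschitz
    matrices. *)
Lemma ac_dominated (V W : normedModType R) a b (x : R -> V) (w : R -> W) C :
  0 <= C ->
  (forall l r, a <= l -> l <= r -> r <= b ->
    `|w r - w l| <= C * (`|x r - x l| + (r - l))) ->
  absolutely_continuous_on a b x -> absolutely_continuous_on a b w.
Proof.
move=> C0 dom ac e e0; have C1 : 0 < C + 1 by rewrite ltr_wpDl.
have e'0 : 0 < e / (C + 1) / 2 by rewrite !divr_gt0.
have [d d0 hd] := ac _ e'0.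
exists (Num.min d (e / (C + 1) / 2)); first by rewrite lt_min d0.
move=> k l r lr tI; rewrite lt_min => /andP[/(hd _ _ _ lr tI) s1 s2].
apply: (@le_lt_trans _ _ (\sum_(i < k) C * (`|x (r i) - x (l i)| + (r i - l i)))).
  by apply: ler_sum => i _; have [] := lr i; exact: dom.
rewrite -mulr_sumr big_split/=; set s := (X in C * X).
have s0 : 0 <= s.
  by rewrite addr_ge0// sumr_ge0// => i _; rewrite subr_ge0; have [] := lr i.
apply: (@le_lt_trans _ _ ((C + 1) * s)); first by rewrite ler_wpM2r// lerDl.
by rewrite mulrC -ltr_pdivlMr// [ltRHS]splitr ltrD.
Qed.

Lemma lipschitz_ac (W : normedModType R) a b (w : R -> W) C :
  (forall l r, a <= l -> l <= r -> r <= b -> `|w r - w l| <= C * (r - l)) ->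
  absolutely_continuous_on a b w.
Proof.
move=> h; apply: (@ac_dominated R^o W a b (fun=> 0) _ `|C|) => //.
  move=> l r al lr rb; rewrite subrr normr0 add0r (le_trans (h _ _ al lr rb))//.
  by rewrite ler_wpM2r ?subr_ge0// ler_norm.
move=> e e0; exists 1 => // k l r _ _ _.
by rewrite big1// => i _; rewrite subrr normr0.
Qed.

Lemma ac_sub (W : normedModType R) a b a' b' (w : R -> W) :
  a <= a' -> b' <= b ->
  absolutely_continuous_on a b w -> absolutely_continuous_on a' b' w.
Proof.
move=> aa bb ac e /ac[d d0 hd]; exists d => // k l r lr.
by apply: hd => i; have [h1 h2 h3] := lr i; split => //;
  [exact: le_trans h1|exact: le_trans bb].
Qed.

Lemma ac_bounded (V : normedModType R) c d (x : R -> V) : c <= d ->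
  absolutely_continuous_on c d x ->
  exists2 M, 0 <= M & forall t, c <= t <= d -> `|x t| <= M.
Proof.
move=> cd /(_ 1 ltr01)[e e0 he].
have one l r : c <= l -> l <= r -> r <= d -> r - l < e -> `|x r - x l| <= 1.
  move=> cl lr rd rle; have := he 1%N (fun=> l) (fun=> r).
  rewrite !big_ord1 => h; apply/ltW/h => //.
  by move=> i j _ _ _; rewrite !ord1.
apply: locally_bounded_bounded => // t /andP[ct td].
exists e, (`|x t| + 1); split => //.
move=> s /andP[cs sd]; rewrite ltr_norml => /andP[st1 st2].
rewrite -[x s](subrK (x t)) addrC (le_trans (ler_normD _ _))// lerD2l.
have [st|/ltW ts] := leP s t; last by apply: one => //; lra.
by rewrite distrC one//; lra.
Qed.

Lemma ae_interior (P : R -> Prop) a b : (forall t, a < t < b -> P t) ->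
  {ae mu, forall t, t \in `[a, b] -> P t}.
Proof.
move=> h; exists [set a; b]; split.
- by apply: measurableU; exact: measurable_set1.
- by apply: countable_lebesgue_measure0; apply: finite_set_countable; exact: finite_set2.
- move=> t /=; rewrite in_itv/= => /not_implyP[/andP[at_ tb] nP].
  have [->|ta] := eqVneq t a; first by left.
  have [->|tb'] := eqVneq t b; first by right.
  by exfalso; apply/nP/h; rewrite !lt_neqAle eq_sym ta tb' at_ tb.
Qed.

(** At a point where w has a derivative close to K U, straddling increments are
    close to (r - l) K U up to a small multiple of r - l.  At the other points they
    are absorbed by the function of [ac_null_gauge].  Cousin's lemma then gives the
    conclusion up to an arbitrary error, which compactness of U removes. *)
Lemma ac_mean_value n m (N : 'cV[R]_n -> R) (hN : is_norm N)
    (U : set 'cV[R]_m) (K : 'M[R]_(n, m)) (w : R -> 'cV[R]_n)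
    (rho drho : R -> R) a b :
  compact U -> @convex_set R _ U -> U !=set0 -> a <= b ->
  absolutely_continuous_on a b w ->
  (forall t, a <= t <= b -> deriv_in a b (rho : R -> R^o) t (drho t)) ->
  (forall t, a <= t <= b -> 0 <= drho t) ->
  {ae mu, forall t, a <= t <= b ->
    exists2 q, deriv_in a b w t q & exists2 v, U v & N (q - K *m v) <= drho t} ->
  exists2 v, U v & N (w b - w a - (b - a) *: (K *m v)) <= rho b - rho a.
Proof.
move=> Uc Ucv [u0 U0] ab ac drhoP drho0 wae.
have [C1 C10 hC1] := norm_le_mx_norm hN.
pose C := C1 + N (K *m u0).
have C0 : 0 < C by rewrite ltr_pwDl// nrm_ge0.
have C0' := ltW C0.
have approx e : 0 < e ->
    exists2 v, U v & N (w b - w a - (b - a) *: (K *m v)) <= rho b - rho a + e.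
  move=> e0.
  have e10 : 0 < e / 2 / (b - a + 1).
    by rewrite !divr_gt0// ltr_wpDl// subr_ge0.
  set e1 := e / 2 / (b - a + 1) in e10.
  have e20 : 0 < e / 2 / C by rewrite !divr_gt0.
  have [g [gb gm gZ]] := ac_null_gauge e20 ac wae.
  have e120 : 0 < e1 / 2 by rewrite divr_gt0.
  have e12C : 0 < e1 / 2 / C1 by rewrite divr_gt0.
  have [|v Uv hv] := @convex_mean_value R 'cV[R]_m 'cV[R]_n N hN U (mulmx K) w
    (fun s => rho s + e1 * s + C * g s) a b ab Ucv.
    move=> t tab.
    have [d1 d10 h1] := deriv_in_straddle (drhoP _ tab) e120.
    have rho_lo l r : a <= l -> l <= t -> t <= r -> r <= b ->
        t - d1 < l -> r < t + d1 ->
        (r - l) * drho t - e1 / 2 * (r - l) <= rho r - rho l.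
      move=> al lt tr rb ld rd; have := h1 _ _ al lt tr rb ld rd.
      by rewrite ler_norml => /andP[+ _]; rewrite /GRing.scale/= => ?; lra.
    have [good|bad] := pselect (exists2 q, deriv_in a b w t q &
        exists2 v, U v & N (q - K *m v) <= drho t).
      have [q qd [v Uv qv]] := good.
      have [d2 d20 h2] := deriv_in_straddle qd e12C.
      exists (Num.min d1 d2); first by rewrite lt_min d10.
      move=> l r al lt tr rb; rewrite ltrBlDl -ltrBlDr lt_min => /andP[l1 l2].
      rewrite -ltrBlDl lt_min => /andP[r1 r2].
      have rl : 0 <= r - l by rewrite subr_ge0 (le_trans lt).
      exists v => //=.
      have -> : w r - w l - (r - l) *: (K *m v) =
        (w r - w l - (r - l) *: q) + (r - l) *: (q - K *m v).
        by rewrite scalerBr addrA subrK.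
      rewrite (le_trans (nrmD hN _ _))// (nrmZp hN)//.
      have H1 : N (w r - w l - (r - l) *: q) <= e1 / 2 * (r - l).
        rewrite (le_trans (hC1 _))//.
        have : `|w r - w l - (r - l) *: q| <= e1 / 2 / C1 * (r - l).
          by apply: h2 => //; lra.
        move/(ler_wpM2l (ltW C10)) => /le_trans; apply.
        by rewrite mulrCA mulrA divfK ?gt_eqF.
      have H2 : (r - l) * N (q - K *m v) <= (r - l) * drho t by rewrite ler_wpM2l.
      have H3 := rho_lo l r al lt tr rb ltac:(lra) ltac:(lra).
      have H4 : 0 <= C * (g r - g l).
        by rewrite mulr_ge0// subr_ge0 gm// (le_trans lt).
      by rewrite mulrBr in H4; lra.
    have [|d2 d20 h2] := gZ t; first by move=> /(_ tab).
    exists (Num.min d1 d2); first by rewrite lt_min d10.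
    move=> l r al lt tr rb; rewrite ltrBlDl -ltrBlDr lt_min => /andP[l1 l2].
    rewrite -ltrBlDl lt_min => /andP[r1 r2].
    have rl : 0 <= r - l by rewrite subr_ge0 (le_trans lt).
    exists u0 => //=; rewrite (le_trans (nrmB hN _ _))// (nrmZp hN)//.
    have H1 := hC1 (w r - w l).
    have H3 := rho_lo l r al lt tr rb ltac:(lra) ltac:(lra).
    have H4 : `|w r - w l| + (r - l) <= g r - g l by apply: h2 => //; lra.
    have H5 : C * (`|w r - w l| + (r - l)) <= C * (g r - g l) by rewrite ler_wpM2l.
    have H6 : 0 <= (r - l) * drho t by rewrite mulr_ge0// drho0.
    have H7 : 0 <= e1 / 2 * (r - l) by rewrite mulr_ge0// ltW.
    have H8 : 0 <= C1 * (r - l) by rewrite mulr_ge0// ltW.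
    have H9 : 0 <= N (K *m u0) * `|w r - w l| by rewrite mulr_ge0// nrm_ge0.
    have : C * (`|w r - w l| + (r - l)) = C1 * `|w r - w l| + (r - l) * N (K *m u0)
      + C1 * (r - l) + N (K *m u0) * `|w r - w l| by rewrite /C; ring.
    by rewrite mulrBr in H5; lra.
  exists v => //; rewrite (le_trans hv)//.
  have H1 : e1 * (b - a) <= e / 2.
    rewrite /e1 mulrAC ler_pdivrMr ?ltr_wpDl ?subr_ge0//.
    by rewrite ler_wpM2l ?divr_ge0 ?(ltW e0)// lerDl.
  have H2 : C * (g b - g a) <= e / 2.
    by rewrite mulrC -ler_pdivlMr.
  by rewrite mulrBr in H1; rewrite mulrBr in H2; lra.
have cN : {within U, continuous (fun v => N (w b - w a - (b - a) *: (K *m v)))}.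
  apply: continuous_subspaceT => v.
  apply: continuous_comp; last exact: nrm_continuous.
  apply/(@cvgrPdist_le _ _ _ (nbhs v) (nbhs_filter v)) => e e0.
  have D0 : 0 < `|b - a| * (m%:R * `|K|) + 1 by rewrite ltr_wpDl// !mulr_ge0.
  apply/nbhs_ballP; exists (e / (`|b - a| * (m%:R * `|K|) + 1)) => /=.
    by rewrite divr_gt0.
  move=> y; rewrite -ball_normE /= => /ltW vy.
  have -> : w b - w a - (b - a) *: (K *m v) - (w b - w a - (b - a) *: (K *m y)) =
      (b - a) *: (K *m (y - v)).
    by rewrite mulmxBr scalerBr opprB addrC addrA subrK.
  rewrite normrZ (le_trans (ler_wpM2l (normr_ge0 _) (mulmx_norm_le _ _)))//.
  rewrite mulrA; move: vy; rewrite distrC ler_pdivlMr// mulrC; apply: le_trans.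
  by rewrite ler_wpM2r// lerDl.
have [v + vmin] := compact_EVT_min (ex_intro _ _ U0) Uc cN.
rewrite inE => Uv; exists v => //; apply/ler_addgt0Pr => e /approx[v' Uv' hv'].
by rewrite (le_trans _ hv')// vmin// inE.
Qed.

Lemma ac_norm_mean_value n (N : 'cV[R]_n -> R) (hN : is_norm N)
    (w : R -> 'cV[R]_n) (rho drho : R -> R) a b : a <= b ->
  absolutely_continuous_on a b w ->
  (forall t, a <= t <= b -> deriv_in a b (rho : R -> R^o) t (drho t)) ->
  {ae mu, forall t, a <= t <= b ->
    exists2 q, deriv_in a b w t q & N q <= drho t} ->
  (forall t, a <= t <= b -> 0 <= drho t) ->
  N (w b - w a) <= rho b - rho a.
Proof.
move=> ab ac rhoP wae drho0.
have [||||v -> ] := @ac_mean_value n n N hN [set 0] 0 w rho drho a b _ _ _ ab ac rhoP drho0.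
- exact: compact_set1.
- exact: convex_set1.
- by exists 0.
- apply: filterS wae; first exact: (ae_filter_ringOfSetsType mu).
  move=> t h /h[q qd qN]; exists q => //; exists 0 => //.
  by rewrite mulmx0 subr0.
by rewrite mulmx0 scaler0 subr0.
Qed.

End ACMeanValue.

(** * Lipschitz functions and primitives *)

Section LinearODE.
Context {R : realType}.

Definition lip_in (V : normedModType R) (a b : R) (f : R -> V) : Prop :=
  exists2 C, 0 <= C & forall l r, a <= l -> l <= r -> r <= b ->
    `|f r - f l| <= C * (r - l).

Lemma lip_in_sub (V : normedModType R) a b a' b' (f : R -> V) :
  a <= a' -> b' <= b -> lip_in a b f -> lip_in a' b' f.
Proof.
move=> aa bb [C C0 h]; exists C => // l r al lr rb.
by apply: h => //; [exact: le_trans al|exact: le_trans bb].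
Qed.

Lemma lip_in_cst (V : normedModType R) a b (c : V) : lip_in a b (fun=> c).
Proof. by exists 0 => // l r _ _ _; rewrite subrr normr0 mul0r. Qed.

Lemma lip_in_bounded (V : normedModType R) a b (f : R -> V) : a <= b ->
  lip_in a b f -> exists2 M, 0 <= M & forall t, a <= t <= b -> `|f t| <= M.
Proof.
move=> ab [C C0 h]; exists (`|f a| + C * (b - a)).
  by rewrite addr_ge0// mulr_ge0// subr_ge0.
move=> t /andP[at_ tb]; rewrite -[f t](subrK (f a)) addrC (le_trans (ler_normD _ _))//.
rewrite lerD2l (le_trans (h _ _ _ at_ tb))// ler_wpM2l// lerD2r//.
Qed.

Lemma lip_in_mulmx m n p a b (f : R -> 'M[R]_(m, n)) (g : R -> 'M[R]_(n, p)) :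
  a <= b -> lip_in a b f -> lip_in a b g -> lip_in a b (fun t => f t *m g t).
Proof.
move=> ab hf hg; have [F F0 bf] := lip_in_bounded ab hf.
have [G G0 bg] := lip_in_bounded ab hg.
have [[Cf Cf0 lf] [Cg Cg0 lg]] := (hf, hg).
exists (n%:R * Cf * G + n%:R * F * Cg) => [|l r al lr rb].
  by rewrite addr_ge0// !mulr_ge0.
have -> : f r *m g r - f l *m g l = (f r - f l) *m g r + f l *m (g r - g l).
  by rewrite mulmxBl mulmxBr addrA subrK.
rewrite (le_trans (ler_normD _ _))// mulrDl lerD//.
  rewrite (le_trans (mulmx_norm_le _ _))//.
  have -> : n%:R * Cf * G * (r - l) = n%:R * (Cf * (r - l)) * G by ring.
  apply: ler_pM; [by rewrite mulr_ge0|by []|by apply: ler_wpM2l => //; apply: lf|].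
  by apply: bg; rewrite rb (le_trans al).
rewrite (le_trans (mulmx_norm_le _ _))// -[leRHS]mulrA.
apply: ler_pM; [by rewrite mulr_ge0|by []| |exact: lg].
apply: ler_wpM2l => //; by apply: bf; rewrite al (le_trans lr).
Qed.

(** Composing with the projection onto [a, b] extends f to a continuous function
    on the line, as needed to take a primitive. *)
Lemma lip_in_continuous_clamp (V : normedModType R) a b (f : R -> V) :
  a <= b -> lip_in a b f ->
  continuous (fun t => f (Num.max a (Num.min b t))).
Proof.
move=> ab [C C0 h] t.
pose cl t := Num.max a (Num.min b t).
have clP s s' : s <= s' -> [/\ a <= cl s, cl s <= cl s', cl s' <= b & cl s' - cl s <= s' - s].
  move=> ss; rewrite /cl.
  by case: (leP b s) => h1; case: (leP b s') => h2;
    [case: (leP a b)|lra|case: (leP a b); case: (leP a s)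
    |case: (leP a s); case: (leP a s')] => *; split; lra.
have L s s' : `|f (cl s) - f (cl s')| <= C * `|s - s'|.
  have [ss|/ltW ss] := leP s s'.
    have [h1 h2 h3 h4] := clP _ _ ss.
    rewrite distrC [in leRHS]distrC (le_trans (h _ _ h1 h2 h3))//.
    by rewrite ler_wpM2l// ger0_norm// subr_ge0.
  have [h1 h2 h3 h4] := clP _ _ ss.
  rewrite (le_trans (h _ _ h1 h2 h3))//.
  by rewrite ler_wpM2l// ger0_norm// subr_ge0.
apply/cvgrPdist_le => e e0; have e'0 : 0 < e / (C + 1) by rewrite divr_gt0// ltr_wpDl.
exists (e / (C + 1)) => // s /=; rewrite ltr_pdivlMr ?ltr_wpDl// => ts.
rewrite (le_trans (L _ _))// (le_trans _ (ltW ts))// mulrC ler_wpM2l// lerDl//.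
Qed.

(** The integral starts at a - 1, so that a is interior to its domain and F is
    differentiable there. *)
Lemma primitive_real a b (f : R -> R) : a <= b -> continuous f ->
  exists2 F : R -> R, F a = 0 &
    forall t, a <= t <= b -> deriv_in a b (F : R -> R^o) t (f t).
Proof.
move=> ab cf.
pose F y := (\int[lebesgue_measure]_(t in [set` Interval (BLeft (a - 1)) (BRight y)]) f t)%R.
exists (fun y => F y - F a); first by rewrite subrr.
move=> t /andP[at_ tb].
have tb1 : t < b + 1 by lra.
have intf : (@lebesgue_measure R).-integrable
    [set` Interval (BLeft (a - 1)) (BRight (b + 1))] (EFin \o f).
  apply: continuous_compact_integrable; first exact: segment_compact.
  by apply: continuous_subspaceT => x; exact: cf.
have [|dF F't] := continuous_FTC1 tb1 intf _ (cf t).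
  by rewrite /= lte_fin; lra.
have dFt : deriv_in a b (F : R -> R^o) t (f t).
  apply: is_derive_deriv_in; apply: DeriveDef; first exact: dF.
  by rewrite -derive1E.
by move=> e /dFt[d d0 hd]; exists d => // y yab /(hd _ yab); rewrite opprB addrA subrK.
Qed.

Lemma deriv_in_matrix m n a b (f : R -> 'M[R]_(m, n)) t (q : 'M[R]_(m, n)) :
  (forall i j, deriv_in a b ((fun s => f s i j) : R -> R^o) t (q i j)) ->
  deriv_in a b f t q.
Proof.
move=> h e e0.
have [d hd] := choice (fun ij : 'I_m * 'I_n =>
  let: ex_intro2 d d0 hd := h ij.1 ij.2 e e0 in ex_intro _ d (conj d0 hd)).
have s0 : 0 <= \sum_ij (d ij)^-1.
  by apply: sumr_ge0 => ij _; rewrite invr_ge0 ltW//; have [] := hd ij.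
(* positive and at most every [d ij] *)
exists (1 + \sum_ij (d ij)^-1)^-1; first by rewrite invr_gt0 ltr_pwDl.
move=> y yab yt; apply: mx_norm_le => [|i j]; first by rewrite mulr_ge0// ltW.
have [dij0 hij] := hd (i, j).
have := hij y yab; rewrite !mxE; apply.
apply: (lt_le_trans yt); rewrite -[leRHS]invrK lef_pV2 ?posrE ?invr_gt0 ?ltr_pwDl//.
rewrite (bigD1 (i, j))//= addrCA lerDl addr_ge0// sumr_ge0// => k _.
by rewrite invr_ge0 ltW//; have [] := hd k.
Qed.

Lemma primitive_mx m n a b (f : R -> 'M[R]_(m, n)) : a <= b -> lip_in a b f ->
  exists2 F : R -> 'M[R]_(m, n), F a = 0 &
    forall t, a <= t <= b -> deriv_in a b F t (f t).
Proof.
move=> ab lf; have cf := lip_in_continuous_clamp ab lf.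
have cfij (ij : 'I_m * 'I_n) : continuous (fun t => f (Num.max a (Num.min b t)) ij.1 ij.2).
  move=> t; apply: (@continuous_comp _ _ _ (fun t => f (Num.max a (Num.min b t)))
    (fun M : 'M[R]_(m, n) => M ij.1 ij.2)); first exact: cf.
  exact: coord_continuous.
have [F hF] := choice (fun ij : 'I_m * 'I_n =>
  let: ex_intro2 F F0 hF := primitive_real ab (cfij ij) in ex_intro _ F (conj F0 hF)).
exists (fun t => \matrix_(i, j) F (i, j) t).
  by apply/matrixP => i j; rewrite !mxE; have [] := hF (i, j).
move=> t tab; apply: deriv_in_matrix => i j.
have [_ /(_ t tab)/=] := hF (i, j).
have -> : Num.max a (Num.min b t) = t.
  by move/andP: tab => [at_ tb]; rewrite min_r// max_r.
by rewrite (_ : (fun s => (\matrix_(i0, j0) F (i0, j0) s) i j) = F (i, j))//;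
  apply/funext => s; rewrite mxE.
Qed.

(** Nested intervals: u_k - 2 C / 2^k increases, u_k + 2 C / 2^k decreases, and l is
    the supremum of the former. *)
Lemma geometric_limit (u : nat -> R) (C : R) : 0 <= C ->
  (forall k, `|u k.+1 - u k| <= C * 2^-1 ^+ k) ->
  exists l, forall k, `|l - u k| <= 2 * C * 2^-1 ^+ k.
Proof.
move=> C0 h; pose p k := 2 * C * 2^-1 ^+ k.
have p0 k : 0 <= p k by rewrite /p !mulr_ge0// exprn_ge0// invr_ge0.
have step k : u k - p k <= u k.+1 - p k.+1 /\ u k.+1 + p k.+1 <= u k + p k.
  have := h k; rewrite ler_norml => /andP[h1 h2].
  have -> : p k.+1 = p k / 2 by rewrite /p exprS; ring.
  have pk : p k = 2 * (C * 2^-1 ^+ k) by rewrite /p mulrA.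
  by rewrite pk; split; lra.
have lo : {homo (fun k => u k - p k) : i j / (i <= j)%N >-> i <= j}.
  by apply: homo_leq => [//|x y z xy yz|k]; [exact: le_trans xy yz|have [] := step k].
have hi i j : (i <= j)%N -> u j + p j <= u i + p i.
  elim: j => [|j IH]; first by rewrite leqn0 => /eqP->.
  by rewrite leq_eqVlt => /predU1P[->//|/IH]; apply: le_trans; have [] := step j.
have lohi i j : u i - p i <= u j + p j.
  have [ij|/ltnW ji] := leqP i j.
    by rewrite (le_trans (lo _ _ ij))// lerD2l ge0_cp.
  by rewrite (le_trans _ (hi _ _ ji))// lerD2l ge0_cp.
pose S := [set u k - p k | k in [set: nat]].
have Su : has_ubound S by exists (u 0%N + p 0%N) => _ [k _ <-].
exists (sup S) => k; rewrite -/(p k) ler_distl; apply/andP; split.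
  by apply: ub_le_sup => //; exists k.
by apply: ge_sup; [exists (u k - p k); exists k|move=> _ [j _ <-]].
Qed.

End LinearODE.

(** * Linear differential equations *)

Section Picard.
Context {R : realType}.

Lemma le_geometric_limit (x y C : R) : (forall k, x <= y + C * 2^-1 ^+ k) -> x <= y.
Proof.
move=> h; rewrite leNgt; apply/negP; rewrite -subr_gt0 => xp.
have cv : (fun k => C * 2^-1 ^+ k) @ \oo --> C * 0.
  by apply: cvgMr; apply: cvg_expr; rewrite ger0_norm ?invr_ge0// invf_lt1// ltr1n.
rewrite mulr0 in cv.
have [k _ hk] := (@cvgrPdist_lt _ R^o _ _ _ _ _).1 cv _ xp.
have := hk k (leqnn k); rewrite /= sub0r normrN ltNge => /negP; apply.
by rewrite lerBlDl (le_trans (h k))// lerD2l ler_norm.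
Qed.

(** Picard iteration.  With K a Lipschitz constant of z |-> A z, each iteration
    halves the distance weighted by exp(- 2 K (t - a)).  So the iterates converge
    uniformly, at a geometric rate, to a Lipschitz function, which is a fixed point. *)
Lemma linear_ode n a b (A : R -> 'M[R]_n) : a <= b -> lip_in a b A ->
  exists2 X : R -> 'M[R]_n, X a = 1%:M &
    forall t, a <= t <= b -> deriv_in a b X t (A t *m X t).
Proof.
move=> ab lA.
have [P hP] : exists P : (R -> 'M[R]_n) -> (R -> 'M[R]_n), forall g, lip_in a b g ->
    P g a = 0 /\ forall t, a <= t <= b -> deriv_in a b (P g) t (g t).
  have /choice[P hP] : forall g : R -> 'M[R]_n, exists F, lip_in a b g ->
      F a = 0 /\ forall t, a <= t <= b -> deriv_in a b F t (g t).
    move=> g; have [lg|nlg] := pselect (lip_in a b g); last by exists g.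
    by have [F F0 FP] := primitive_mx ab lg; exists F.
  by exists P.
pose T z t := 1%:M + P (fun s => A s *m z s) t.
have TP z : lip_in a b z -> [/\ T z a = 1%:M,
    forall t, a <= t <= b -> deriv_in a b (T z) t (A t *m z t) & lip_in a b (T z)].
  move=> lz; have lAz := lip_in_mulmx ab lA lz.
  have [P0 Pd] := hP _ lAz.
  have Td t : a <= t <= b -> deriv_in a b (T z) t (A t *m z t).
    move=> tab; rewrite -[_ *m _]add0r; apply: deriv_inD; last exact: Pd.
    exact: deriv_in_cst.
  split => //; first by rewrite /T P0 addr0.
  have [B B0 hB] := lip_in_bounded ab lAz.
  exists B => //; apply: deriv_in_lipschitz => t tab.
  by exists (A t *m z t); [exact: Td|exact: hB].
pose Z k := iter k T (fun=> 1%:M).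
have lipZ k : lip_in a b (Z k).
  elim: k => [|k IH]; last by have [] := TP _ IH.
  by exists 0 => // l r _ _ _; rewrite subrr normr0 mul0r.
have Za k : Z k a = 1%:M by case: k => [//|k]; have [] := TP _ (lipZ k).
have Zd k t : a <= t <= b -> deriv_in a b (Z k.+1) t (A t *m Z k t).
  by move=> tab; have [_ + _] := TP _ (lipZ k); apply.
have [M M0 hM] := lip_in_bounded ab lA.
pose K := n%:R * M + 1.
have K0 : 0 < K by rewrite ltr_wpDl// mulr_ge0.
have AK t z : a <= t <= b -> `|A t *m z : 'M[R]_n| <= K * `|z|.
  move=> tab; rewrite (le_trans (mulmx_norm_le _ _))// ler_wpM2r//.
  by rewrite /K (le_trans (ler_wpM2l _ (hM _ tab)))// lerDl.
(* the weight for which an iteration contracts by 1/2 *)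
pose e s := expR (- (2 * K * a) + 2 * K * s).
have [c c0 hc] : exists2 c, 0 <= c & forall t, a <= t <= b -> `|Z 1%N t - Z 0%N t| <= c.
  have [C C0 hC] := lipZ 1%N; exists (C * (b - a)).
    by rewrite mulr_ge0// subr_ge0.
  move=> t /andP[at_ tb]; have := hC _ _ (lexx a) at_ tb; rewrite Za => /le_trans; apply.
  by rewrite ler_wpM2l// lerD2r.
have diff k t : a <= t <= b -> `|Z k.+1 t - Z k t| <= c * 2^-1 ^+ k * e t.
  elim: k t => [|k IH] t /andP[at_ tb].
    rewrite expr0 mulr1 (le_trans (hc _ _))// ?at_ ?tb//.
    rewrite ler_peMr// -expR0 ler_expR; have : 0 <= 2 * K * (t - a).
      by rewrite mulr_ge0 ?subr_ge0// mulr_ge0// ltW.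
    by rewrite mulrBr; lra.
  have sub s : a <= s <= t -> a <= s <= b.
    by move=> /andP[-> st]; rewrite (le_trans st).
  have := @deriv_mean_value R _ a t (fun s => Z k.+2 s - Z k.+1 s)
    (fun s => (c * 2^-1 ^+ k.+1) *: (e s : R^o)) (fun s => (c * 2^-1 ^+ k) * K * e s) at_.
  rewrite !Za subrr subr0.
  have H1 : forall s, a <= s <= t -> deriv_in a t
      ((fun s => (c * 2^-1 ^+ k.+1) *: (e s : R^o)) : R -> R^o) s (c * 2^-1 ^+ k * K * e s).
    move=> s _; have -> : c * 2^-1 ^+ k * K * e s = (c * 2^-1 ^+ k.+1) *: (2 * K * e s : R^o).
      rewrite /GRing.scale /= exprS.
      by field.
    by apply: deriv_inZ; exact: deriv_in_expR.
  move=> /(_ H1) H2; apply: (le_trans (H2 _)) => [s sat|].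
    exists (A s *m Z k.+1 s - A s *m Z k s).
      by apply: deriv_inB; apply: (deriv_in_sub (lexx a) tb); apply: Zd; exact: sub.
    rewrite -mulmxBr (le_trans (AK _ _ (sub _ sat)))//.
    rewrite [c * _ * K]mulrC -mulrA ler_wpM2l ?(ltW K0)//.
    exact/IH/sub.
  rewrite /GRing.scale/= lerBlDr lerDl.
  by rewrite !mulr_ge0 ?exprn_ge0 ?invr_ge0// expR_ge0.
pose C := c * e b.
have C0 : 0 <= C by rewrite mulr_ge0// expR_ge0.
have diffC k t : a <= t <= b -> `|Z k.+1 t - Z k t| <= C * 2^-1 ^+ k.
  move=> tab; rewrite (le_trans (diff k _ tab))// /C -!mulrA ler_wpM2l// mulrC.
  rewrite ler_wpM2r ?exprn_ge0 ?invr_ge0// ler_expR lerD2l ler_wpM2l//.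
    by rewrite mulr_ge0// ltW.
  by case/andP: tab.
have /choice[X hX] : forall t, exists X : 'M[R]_n, a <= t <= b ->
    forall k, `|X - Z k t| <= 2 * C * 2^-1 ^+ k.
  move=> t; have [tab|ntab] := pselect (a <= t <= b); last by exists 0.
  have /choice[f hf] : forall ij : 'I_n * 'I_n, exists l, forall k,
      `|l - Z k t ij.1 ij.2| <= 2 * C * 2^-1 ^+ k.
    move=> [i j]; apply: geometric_limit => // k /=.
    rewrite (le_trans _ (diffC k t tab))//.
    by have := mx_entry_le (Z k.+1 t - Z k t) i j; rewrite !mxE.
  exists (\matrix_(i, j) f (i, j)) => _ k; apply: mx_norm_le => [|i j].
    by apply: mulr_ge0; [exact: mulr_ge0|rewrite exprn_ge0 ?invr_ge0].
  by rewrite !mxE; exact: (hf (i, j)).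
have X0 t : a <= t <= b -> `|X t| <= 1 + `|1%:M : 'M[R]_n| + 2 * C.
  move=> tab; have := hX t tab 0%N; rewrite expr0 mulr1 => h.
  rewrite -[X t](subrK (Z 0%N t)) (le_trans (ler_normD _ _))//= addrC.
  by rewrite lerD// lerDr.
pose B := K * (1 + `|1%:M : 'M[R]_n| + 2 * C + 2 * C).
have B0 : 0 <= B by rewrite mulr_ge0// ?(ltW K0)// !addr_ge0// mulr_ge0.
have geo1 k : (2^-1 : R) ^+ k <= 1.
  by rewrite exprn_ile1// ?invr_ge0// invf_le1// ler1n.
have geoS k : 2 * C * 2^-1 ^+ k.+1 <= 2 * C * 2^-1 ^+ k :> R.
  apply: ler_wpM2l; first exact: mulr_ge0.
  by rewrite exprS ler_piMl ?exprn_ge0 ?invr_ge0// invf_le1// ler1n.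
have Zlip k l r : a <= l -> l <= r -> r <= b -> `|Z k.+1 r - Z k.+1 l| <= B * (r - l).
  apply: deriv_in_lipschitz => t tab; exists (A t *m Z k t); first exact: Zd.
  rewrite (le_trans (AK _ _ tab))// ler_wpM2l ?(ltW K0)//.
  rewrite -[Z k t](subrK (X t)) (le_trans (ler_normD _ _))// addrC lerD ?X0//.
  rewrite distrC (le_trans (hX t tab k))//.
  by apply: ler_piMr; [exact: mulr_ge0|exact: geo1].
have lX : lip_in a b X.
  exists B => // l r al lr rb; apply: (@le_geometric_limit _ _ (2 * (2 * C))) => k.
  have rab : a <= r <= b by rewrite rb (le_trans al).
  have lab : a <= l <= b by rewrite al (le_trans lr).
  have h1 := Zlip k l r al lr rb.
  have h2 := hX r rab k.+1; have h3 := hX l lab k.+1.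
  have h4 : `|X r - X l| <= `|X r - Z k.+1 r| + `|Z k.+1 r - Z k.+1 l| + `|X l - Z k.+1 l|.
    rewrite (le_trans (ler_distD (Z k.+1 l) _ _))// [in X in _ <= _ + X]distrC lerD2r.
    exact: ler_distD.
  have h5 := geoS k.
  lra.
have [Qa Qd _] := TP _ lX.
have QX t : a <= t <= b -> T X t = X t.
  move=> /andP[at_ tb]; have tab : a <= t <= b by rewrite at_ tb.
  apply/eqP; rewrite -subr_eq0 -normr_le0.
  apply: (@le_geometric_limit _ _ (K * (2 * C) * (b - a) + 2 * C)) => k.
  rewrite add0r.
  have h1 : `|X t - Z k.+1 t| <= 2 * C * 2^-1 ^+ k.
    by rewrite (le_trans (hX t tab k.+1)).
  have h2 : `|T X t - Z k.+1 t| <= K * (2 * C * 2^-1 ^+ k) * (t - a).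
    have := @deriv_in_lipschitz R _ a b (fun s => T X s - Z k.+1 s)
      (K * (2 * C * 2^-1 ^+ k)) _ a t (lexx a) at_ tb.
    rewrite Qa Za subrr subr0; apply => s sab.
    exists (A s *m X s - A s *m Z k s); first by apply: deriv_inB; [exact: Qd|exact: Zd].
    by rewrite -mulmxBr (le_trans (AK _ _ sab))// ler_wpM2l ?(ltW K0)// hX.
  rewrite (le_trans (ler_distD (Z k.+1 t) _ _))// mulrDl lerD//; last by rewrite distrC.
  rewrite (le_trans h2)//.
  have -> : K * (2 * C) * (b - a) * 2^-1 ^+ k = K * (2 * C * 2^-1 ^+ k) * (b - a) by ring.
  rewrite ler_wpM2l ?lerD2r// mulr_ge0 ?(ltW K0)//.
  by apply: mulr_ge0; [exact: mulr_ge0|rewrite exprn_ge0 ?invr_ge0].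
exists (T X) => // t tab; rewrite QX//; exact: Qd.
Qed.

End Picard.

(** * Fundamental matrices *)

Section Fundamental.
Context {R : realType}.
Local Notation mu := (@lebesgue_measure R).

(** The entries of M are the coordinates of the images of the basis vectors. *)
Lemma mx_norm_le_op_norm n m (Nm : 'cV[R]_m -> R) (Nn : 'cV[R]_n -> R)
    (hm : is_norm Nm) (hn : is_norm Nn) :
  exists2 C, 0 <= C & forall (M : 'M[R]_(n, m)) B, 0 <= B ->
    (forall x, Nn (M *m x) <= B * Nm x) -> `|M| <= C * B.
Proof.
have [D D0 hD] := mx_norm_le_norm hn.
have S0 : 0 <= \sum_(j < m) Nm (delta_mx j 0).
  by apply: sumr_ge0 => j _; exact: nrm_ge0.
exists (D * \sum_(j < m) Nm (delta_mx j 0)); first by rewrite mulr_ge0// ltW.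
move=> M B B0 h; apply: mx_norm_le => [|i j].
  by apply: mulr_ge0 => //; apply: mulr_ge0 => //; exact: ltW.
have -> : M i j = (M *m delta_mx j (0 : 'I_1)) i 0 by rewrite -colE mxE.
rewrite (le_trans (mx_entry_le _ _ _))// (le_trans (hD _))// -mulrA.
apply: ler_wpM2l; first exact: ltW.
rewrite (le_trans (h _))// mulrC ler_wpM2r//.
by rewrite (bigD1 j)//= lerDl sumr_ge0// => k _; exact: nrm_ge0.
Qed.

Lemma C1_lip_in n m (Nm : 'cV[R]_m -> R) (Nn : 'cV[R]_n -> R)
    (hm : is_norm Nm) (hn : is_norm Nn) a b (f df : R -> 'M[R]_(n, m)) M :
  C1_on a b f df -> (forall t, a <= t <= b -> op_norm Nm Nn (df t) <= M) ->
  lip_in a b f.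
Proof.
move=> fC1 dfM; have [C C0 hC] := mx_norm_le_op_norm hm hn.
exists (C * `|M|); first by rewrite mulr_ge0.
apply: deriv_in_lipschitz => t tab; exists (df t); first exact: C1_deriv_in.
apply: hC => // x; rewrite (le_trans (op_norm_le hm hn _ _))//.
rewrite ler_wpM2r ?nrm_ge0// (le_trans (dfM t tab))// ler_norm//.
Qed.

Lemma deriv_in_trmx m n a b (f : R -> 'M[R]_(m, n)) t q :
  deriv_in a b f t q -> deriv_in a b (fun s => (f s)^T) t q^T.
Proof.
move=> h e /h[d d0 hd]; exists d => // y yab /(hd _ yab).
by rewrite -!linearZ -!linearB/= trmx_norm.
Qed.

(** Y is the inverse of the matrix solution X; it solves the adjoint equation.  The
    transition matrix is then X(t) Y(s). *)
Definition fundamental n (a b : R) (A X Y : R -> 'M[R]_n) : Prop :=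
  [/\ forall t, a <= t <= b -> deriv_in a b X t (A t *m X t),
      forall t, a <= t <= b -> deriv_in a b Y t (- (Y t *m A t)),
      forall t, a <= t <= b -> Y t *m X t = 1%:M &
      forall t, a <= t <= b -> X t *m Y t = 1%:M].

(** The transpose of Y solves the linear equation of matrix - A^T.  Then
    (Y X)' = - Y A X + Y A X = 0, so Y X remains equal to its initial value. *)
Lemma fundamental_exists n a b (A : R -> 'M[R]_n) : a <= b -> lip_in a b A ->
  exists X Y, fundamental a b A X Y.
Proof.
move=> ab lA; have [X Xa dX] := linear_ode ab lA.
have lA' : lip_in a b (fun t => - (A t)^T).
  have [C C0 h] := lA; exists C => // l r al lr rb.
  by rewrite -opprD normrN -linearB trmx_norm h.
have [W Wa dW] := linear_ode ab lA'.
have dY t : a <= t <= b -> deriv_in a b (fun s => (W s)^T) t (- ((W t)^T *m A t)).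
  move=> tab; have := deriv_in_trmx (dW t tab).
  by rewrite trmx_mul linearN/= trmxK mulmxN.
have YX t : a <= t <= b -> (W t)^T *m X t = 1%:M.
  move=> /andP[at_ tb]; have -> : 1%:M = (W a)^T *m X a by rewrite Wa Xa trmx1 mulmx1.
  apply/eqP; rewrite -subr_eq0 -normr_le0 -[leRHS](mul0r (t - a)).
  apply: (@deriv_in_lipschitz R _ a b (fun s => (W s)^T *m X s)) => // s sab.
  exists 0; last by rewrite normr0.
  have := deriv_in_mulmx (dY s sab) (dX s sab).
  by rewrite mulNmx mulmxA addNr.
by exists X, (fun s => (W s)^T); split => // t tab; apply: mulmx1C; exact: YX.
Qed.

(** The function is x(min(r, s)) + z(max(r, s)) - z(s), and intervals that are
    disjoint remain so when their endpoints are cut at s. *)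
Lemma ac_concat (V : normedModType R) a s b (x z : R -> V) :
  a <= s -> s <= b -> x s = z s -> absolutely_continuous_on a s x ->
  lip_in s b z ->
  absolutely_continuous_on a b (fun r => if r <= s then x r else z r).
Proof.
move=> as_ sb xz acx [L L0 lz] e e0; have e20 : 0 < e / 2 by rewrite divr_gt0.
have [d d0 hd] := acx _ e20.
have L1 : 0 < L + 1 by rewrite ltr_wpDl.
exists (Num.min d (e / 2 / (L + 1))); first by rewrite lt_min d0 !divr_gt0.
move=> k l r lr tI; rewrite lt_min => /andP[s1 s2].
have E q : (if q <= s then x q else z q) = x (Num.min q s) + z (Num.max q s) - z s.
  by have [qs|sq] := leP q s; rewrite ?addrK// xz addrAC subrr add0r.
pose l' i := Num.min (l i) s; pose r' i := Num.min (r i) s.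
have lr' i : [/\ a <= l' i, l' i <= r' i & r' i <= s].
  have [h1 h2 h3] := lr i; rewrite /l' /r'; split.
  - by rewrite le_min h1.
  - by rewrite le_min !ge_min h2 lexx orbT.
  - by rewrite ge_min lexx orbT.
have tI' : trivIset [set: 'I_k] (fun i => `]l' i, r' i[%classic).
  move=> i j _ _ [q [/=]]; rewrite !in_itv/= => qi qj.
  apply: tI => //; exists q; split; rewrite /= in_itv/=.
    move: qi; rewrite /l' /r' gt_min lt_min => /andP[/orP[h1|h1] /andP[h2 h3]].
      by rewrite h1 h2.
    by move: (lt_trans h1 h3); rewrite ltxx.
  move: qj; rewrite /l' /r' gt_min lt_min => /andP[/orP[h1|h1] /andP[h2 h3]].
    by rewrite h1 h2.
  by move: (lt_trans h1 h3); rewrite ltxx.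
have mm i : r' i - l' i <= r i - l i /\
    Num.max (r i) s - Num.max (l i) s <= r i - l i.
  have [h1 h2 h3] := lr i; rewrite /l' /r'.
  by case: (leP (l i) s) => h4; case: (leP (r i) s) => h5; split; lra.
have S1 : \sum_(i < k) `|x (r' i) - x (l' i)| < e / 2.
  apply: hd => //; apply: le_lt_trans s1; apply: ler_sum => i _.
  by have [] := mm i.
have S2 : \sum_(i < k) `|z (Num.max (r i) s) - z (Num.max (l i) s)| < e / 2.
  apply: (@le_lt_trans _ _ (\sum_(i < k) L * (r i - l i))).
    apply: ler_sum => i _; have [h1 h2 h3] := lr i.
    apply: (@le_trans _ _ (L * (Num.max (r i) s - Num.max (l i) s))).
      apply: lz.
      - by rewrite le_max lexx orbT.
      - by rewrite ge_max !le_max h2 lexx orbT.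
      - by rewrite ge_max h3.
    by rewrite ler_wpM2l//; have [] := mm i.
  rewrite -mulr_sumr; move: s2; rewrite ltr_pdivlMr// mulrC; apply: le_lt_trans.
  rewrite ler_wpM2r ?lerDl// sumr_ge0// => i _.
  by rewrite subr_ge0; have [] := lr i.
apply: (@le_lt_trans _ _ (\sum_(i < k) (`|x (r' i) - x (l' i)| +
    `|z (Num.max (r i) s) - z (Num.max (l i) s)|))).
  apply: ler_sum => i _; rewrite !E.
  have -> : x (Num.min (r i) s) + z (Num.max (r i) s) - z s -
      (x (Num.min (l i) s) + z (Num.max (l i) s) - z s) =
    (x (r' i) - x (l' i)) + (z (Num.max (r i) s) - z (Num.max (l i) s)).
    by rewrite opprB addrA subrK opprD addrACA.
  exact: ler_normD.
by rewrite big_split/= (splitr e) ltrD.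
Qed.

Section WithFundamental.
Context {n : nat} {a b : R} {A X Y : R -> 'M[R]_n} (ab : a <= b)
  (lA : lip_in a b A) (F : fundamental a b A X Y).

Lemma fund_lip : lip_in a b X /\ lip_in a b Y.
Proof.
have [M M0 hM] := lip_in_bounded ab lA.
have bnd (Z : R -> 'M[R]_n) : (forall t, a <= t <= b -> exists q, deriv_in a b Z t q) ->
    exists2 B, 0 <= B & forall t, a <= t <= b -> `|Z t| <= B.
  move=> dZ; apply: locally_bounded_bounded => // t tab.
  have [q /deriv_in_local_lipschitz[d d0 hd]] := dZ t tab.
  exists d, (`|Z t| + (`|q| + 1) * d); split => //.
    by rewrite addr_ge0// mulr_ge0 ?addr_ge0// ltW.
  move=> s sab sd; rewrite -[Z s](subrK (Z t)) addrC (le_trans (ler_normD _ _))// lerD2l.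
  rewrite (le_trans (hd s sab sd))//.
  by apply: ler_wpM2l; [exact: addr_ge0|exact: ltW].
have [dX dY _ _] := F.
have [|BX BX0 hX] := bnd X; first by move=> t /dX; exists (A t *m X t).
have [|BY BY0 hY] := bnd Y; first by move=> t /dY; exists (- (Y t *m A t)).
split.
  exists (n%:R * M * BX); first by rewrite !mulr_ge0.
  apply: deriv_in_lipschitz => t tab; exists (A t *m X t); first exact: dX.
  rewrite (le_trans (mulmx_norm_le _ _))//.
  by apply: ler_pM; [exact: mulr_ge0|by []|apply: ler_wpM2l => //; exact: hM|exact: hX].
exists (n%:R * BY * M); first by rewrite !mulr_ge0.
apply: deriv_in_lipschitz => t tab; exists (- (Y t *m A t)); first exact: dY.
rewrite normrN (le_trans (mulmx_norm_le _ _))//.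
by apply: ler_pM; [exact: mulr_ge0|by []|apply: ler_wpM2l => //; exact: hY|exact: hM].
Qed.

(** Multiplying by Y turns x' = A x + B u into (Y x)' = Y B u. *)
Lemma fund_conj m (B : R -> 'M[R]_(n, m)) c d s p u x :
  a <= c -> c <= d -> d <= b -> is_solution A B c d s p u x ->
  absolutely_continuous_on c d (fun t => Y t *m x t) /\
  {ae mu, forall t, c <= t <= d ->
    deriv_in c d (fun t => Y t *m x t) t (Y t *m (B t *m u t))}.
Proof.
move=> ac cd db [acx _ xae].
have [_ dY _ _] := F; have [_ lY] := fund_lip; split.
  have [M M0 hM] := lip_in_bounded ab lY; have [L L0 hL] := lY.
  have [Mx Mx0 hMx] := ac_bounded cd acx.
  apply: (@ac_dominated _ _ _ _ _ x _ (n%:R * M + n%:R * L * Mx)) acx.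
    by rewrite addr_ge0// !mulr_ge0.
  move=> l r cl lr rd.
  have -> : Y r *m x r - Y l *m x l = Y r *m (x r - x l) + (Y r - Y l) *m x l.
    by rewrite mulmxBr mulmxBl addrA subrK.
  have h1 : `|Y r *m (x r - x l)| <= n%:R * M * `|x r - x l|.
    rewrite (le_trans (mulmx_norm_le _ _))// ler_wpM2r// ler_wpM2l// hM//.
    by rewrite (le_trans ac)//= ?(le_trans rd)// (le_trans cl).
  have h2 : `|(Y r - Y l) *m x l| <= n%:R * L * Mx * (r - l).
    rewrite (le_trans (mulmx_norm_le _ _))//.
    have -> : n%:R * L * Mx * (r - l) = n%:R * (L * (r - l)) * Mx by ring.
    apply: ler_pM; [exact: mulr_ge0|by []| |].
      by apply: ler_wpM2l => //; apply: hL => //; [exact: le_trans cl|exact: le_trans db].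
    by apply: hMx; rewrite cl (le_trans lr).
  have h3 : 0 <= n%:R * M * (r - l) by rewrite mulr_ge0 ?mulr_ge0// subr_ge0.
  have h4 : 0 <= n%:R * L * Mx * `|x r - x l| by rewrite !mulr_ge0.
  by rewrite (le_trans (ler_normD _ _))//; rewrite mulrDr !mulrDl; lra.
apply: filterS xae; first exact: (ae_filter_ringOfSetsType mu).
move=> t h tcd; have := h; rewrite in_itv/= => /(_ tcd) /(is_derive_deriv_in c d) dx.
have tab : a <= t <= b.
  by case/andP: tcd => ct td; rewrite (le_trans ac)// (le_trans td).
have := deriv_in_mulmx (deriv_in_sub ac db (dY t tab)) dx.
by rewrite mulNmx mulmxDr [Y t *m (A t *m _)]mulmxA addKr.
Qed.

End WithFundamental.

End Fundamental.

(** * Estimates on the transition matrix *)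

Section Estimates.
Context {R : realType}.
Local Notation mu := (@lebesgue_measure R).

(** If C B bounds N z, then integrating the differential inequality k times gives
    N (z t) <= e^(M (t - a)) N (z a) + C B 2^-k e^(2 M (t - a)); let k tend to
    infinity. *)
Lemma gronwall n (N : 'cV[R]_n -> R) (hN : is_norm N) (M : R) a b
    (z q : R -> 'cV[R]_n) : 0 < M -> a <= b -> lip_in a b z ->
  (forall t, a <= t <= b -> deriv_in a b z t (q t)) ->
  (forall t, a <= t <= b -> N (q t) <= M * N (z t)) ->
  N (z b) <= expR (M * (b - a)) * N (z a).
Proof.
move=> M0 ab lz dz qz.
have [C C0 hC] := norm_le_mx_norm hN.
have [B B0 hB] := lip_in_bounded ab lz.
have CB0 : 0 <= C * B by rewrite mulr_ge0// ltW.
pose e (l s : R) := expR (- (l * a) + l * s).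
have e_ge1 l t : 0 <= l -> a <= t -> 1 <= e l t.
  move=> l0 at_; rewrite -expR0 ler_expR; have : 0 <= l * (t - a).
    by rewrite mulr_ge0// subr_ge0.
  by rewrite mulrBr; lra.
have key k t : a <= t <= b ->
    N (z t) <= N (z a) * e M t + C * B * 2^-1 ^+ k * e (2 * M) t.
  elim: k t => [|k IH] t tab; have /andP[at_ tb] := tab.
    rewrite expr0 mulr1; apply: ler_wpDl.
      by apply: mulr_ge0; [exact: nrm_ge0|exact: expR_ge0].
    rewrite (le_trans (hC _))//.
    have : C * `|z t| <= C * B by rewrite ler_wpM2l ?(ltW C0)// hB.
    move=> /le_trans; apply; rewrite ler_peMr//.
    by apply: e_ge1 => //; rewrite mulr_ge0// ltW.
  pose drho s := M * (N (z a) * e M s + C * B * 2^-1 ^+ k * e (2 * M) s).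
  pose rho s := N (z a) * e M s + C * B * 2^-1 ^+ k.+1 * e (2 * M) s.
  have H1 s : a <= s <= t -> deriv_in a t (rho : R -> R^o) s (drho s).
    move=> _; have -> : drho s = N (z a) *: (M * e M s : R^o) +
        (C * B * 2^-1 ^+ k.+1) *: (2 * M * e (2 * M) s : R^o).
      by rewrite /drho /GRing.scale /= exprS; field.
    by apply: deriv_inD; apply: deriv_inZ; exact: deriv_in_expR.
  have sub s : a <= s <= t -> a <= s <= b.
    by move=> /andP[-> st]; rewrite (le_trans st).
  have H2 := @deriv_norm_mean_value R _ N C a t z rho drho hN C0 hC at_ H1.
  have H3 : N (z t - z a) <= rho t - rho a.
    apply: H2 => s sat; exists (q s).
      by apply: (deriv_in_sub (lexx a) tb); apply: dz; exact: sub.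
    by rewrite (le_trans (qz _ (sub _ sat)))// ler_wpM2l ?(ltW M0)// IH// sub.
  have H4 : N (z a) <= rho a.
    rewrite /rho /e !addNr expR0 !mulr1 lerDl.
    by apply: mulr_ge0; rewrite // exprn_ge0 ?invr_ge0.
  by have H5 := norm_le_dist hN (z t) (z a); rewrite -/(rho t); lra.
have -> : expR (M * (b - a)) = e M b by rewrite /e mulrBr addrC.
rewrite mulrC; apply: (@le_geometric_limit _ _ _ (C * B * e (2 * M) b)) => k.
have -> : C * B * e (2 * M) b * 2^-1 ^+ k = C * B * 2^-1 ^+ k * e (2 * M) b by ring.
by apply: key; rewrite ab lexx.
Qed.

Lemma mulmx_ext n p (M M' : 'M[R]_(n, p)) :
  (forall x : 'cV[R]_p, M *m x = M' *m x) -> M = M'.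
Proof.
by move=> h; apply/matrixP => i j; have /colP/(_ i) := h (delta_mx j 0); rewrite -!colE !mxE.
Qed.

Section System.
Context {n m : nat} {normX : 'cV[R]_n -> R} {normU : 'cV[R]_m -> R}
  (hX : is_norm normX) (hU : is_norm normU) {t0 tf : R} (t0f : t0 < tf)
  {A dA : R -> 'M[R]_n} {B dB : R -> 'M[R]_(n, m)}
  (A_C1 : C1_on t0 tf A dA) (B_C1 : C1_on t0 tf B dB)
  {MA MdA MB MdB : R} (MA0 : 0 < MA)
  (A_le : forall t, t0 <= t <= tf -> op_norm normX normX (A t) <= MA)
  (dA_le : forall t, t0 <= t <= tf -> op_norm normX normX (dA t) <= MdA)
  (B_le : forall t, t0 <= t <= tf -> op_norm normU normX (B t) <= MB)
  (dB_le : forall t, t0 <= t <= tf -> op_norm normU normX (dB t) <= MdB)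
  {X Y : R -> 'M[R]_n} (F : fundamental t0 tf A X Y).

Let lA : lip_in t0 tf A := C1_lip_in hX hX A_C1 dA_le.
Let lX : lip_in t0 tf X := (fund_lip (ltW t0f) lA F).1.
Let lY : lip_in t0 tf Y := (fund_lip (ltW t0f) lA F).2.

Lemma A_bound t x : t0 <= t <= tf -> normX (A t *m x) <= MA * normX x.
Proof.
move=> tt; rewrite (le_trans (op_norm_le hX hX _ _))// ler_wpM2r ?nrm_ge0//.
exact: A_le.
Qed.
Lemma dA_bound t x : t0 <= t <= tf -> normX (dA t *m x) <= MdA * normX x.
Proof.
move=> tt; rewrite (le_trans (op_norm_le hX hX _ _))// ler_wpM2r ?nrm_ge0//.
exact: dA_le.
Qed.
Lemma B_bound t x : t0 <= t <= tf -> normX (B t *m x) <= MB * normU x.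
Proof.
move=> tt; rewrite (le_trans (op_norm_le hU hX _ _))// ler_wpM2r ?nrm_ge0//.
exact: B_le.
Qed.
Lemma dB_bound t x : t0 <= t <= tf -> normX (dB t *m x) <= MdB * normU x.
Proof.
move=> tt; rewrite (le_trans (op_norm_le hU hX _ _))// ler_wpM2r ?nrm_ge0//.
exact: dB_le.
Qed.

Lemma flow_bound s t x : t0 <= s -> s <= t -> t <= tf ->
  normX (X t *m (Y s *m x)) <= expR (MA * (t - s)) * normX x.
Proof.
move=> ts st tt; have [dX dY YX XY] := F.
have := @gronwall n normX hX MA s t (fun r => X r *m (Y s *m x))
  (fun r => A r *m (X r *m (Y s *m x))) MA0 st.
have ss : t0 <= s <= tf by rewrite ts (le_trans st).
have -> : X s *m (Y s *m x) = x by rewrite mulmxA XY// mul1mx.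
apply.
- apply: lip_in_mulmx => //; last exact: lip_in_cst.
  exact: lip_in_sub lX.
- move=> r /andP[sr rt]; rewrite mulmxA; apply: deriv_in_mulmxr.
  apply: (deriv_in_sub ts tt); apply: dX.
  by rewrite (le_trans ts)// (le_trans rt).
- move=> r /andP[sr rt]; apply: A_bound.
  by rewrite (le_trans ts)// (le_trans rt).
Qed.

(** X(t) Y(s) has the defining property of the transition matrix.  It is the only
    matrix with this property, since Y x has zero derivative almost everywhere along
    a solution x and is therefore constant. *)
Lemma transition_eq s t : t0 <= s -> s <= t -> t <= tf ->
  transition A B t0 tf t s = X t *m Y s.
Proof.
move=> ts st tt; have [dX dY YX XY] := F.
have ss : t0 <= s <= tf by rewrite ts (le_trans st).
have tt' : t0 <= t <= tf by rewrite tt (le_trans ts).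
rewrite /transition; set S := (X in xget 0 X).
have XS : S (X t *m Y s).
  move=> p; exists (fun r => X r *m (Y s *m p)); last by rewrite mulmxA.
  split.
  - have [C C0 hC] : lip_in t0 tf (fun r => X r *m (Y s *m p)).
      by apply: lip_in_mulmx (ltW t0f) lX _; exact: lip_in_cst.
    exact: lipschitz_ac hC.
  - by rewrite mulmxA XY// mul1mx.
  - apply: ae_interior => r /andP[tr rt]; rewrite mulmx0 addr0.
    apply: (@deriv_in_is_derive _ _ t0 tf); first by rewrite tr rt.
    by rewrite mulmxA; apply: deriv_in_mulmxr; apply: dX; rewrite !ltW.
apply: (xget_subset1 0 XS) => M1 M2.
suff uniq M : S M -> M = X t *m Y s by move=> /uniq-> /uniq->.
move=> SM; apply: mulmx_ext => p; have [x xsol ->] := SM p.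
have [acw wae] := fund_conj (ltW t0f) lA F (lexx t0) (ltW t0f) (lexx tf) xsol.
have [_ xs _] := xsol.
suff : Y t *m x t = Y s *m p.
  by move=> E; rewrite -[LHS]mul1mx -(XY _ tt') -!mulmxA E.
apply/eqP; rewrite -subr_eq0; apply/eqP/(nrm_eq0 hX)/eqP.
rewrite eq_le nrm_ge0// andbT -{1}xs.
have := @ac_norm_mean_value R n normX hX (fun r => Y r *m x r) (fun=> 0) (fun=> 0) s t st.
rewrite subrr; apply.
- exact: ac_sub acw.
- by move=> r _; exact: deriv_in_cst.
- apply: filterS wae; first exact: (ae_filter_ringOfSetsType mu).
  move=> r h /andP[sr rt]; exists 0; last by rewrite nrm0.
  have {}h : deriv_in t0 tf (fun t => Y t *m x t) r 0.
    rewrite -[0](mulmx0 _ (Y r)) -(mulmx0 _ (B r)); apply: h.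
    by rewrite (le_trans ts)// (le_trans rt).
  exact: deriv_in_sub h.
- by [].
Qed.

(** The derivative of r |-> phi(t,r) B(r) v is phi(t,r) (dB(r) - A(r) B(r)) v. *)
Lemma kernel_bound s t v : t0 <= s -> s <= t -> t <= tf ->
  normX (X t *m (Y s *m (B s *m v)) - B t *m v) <=
  (MdB + MA * MB) * normU v / MA * (expR (MA * (t - s)) - 1).
Proof.
move=> ts st tt; have [dX dY YX XY] := F.
have tt' : t0 <= t <= tf by rewrite tt (le_trans ts).
have [C C0 hC] := norm_le_mx_norm hX.
pose D := (MdB + MA * MB) * normU v.
pose rho r := (- (D / MA)) *: (expR (MA * t + (- MA) * r) : R^o).
pose drho r := D * expR (MA * t + (- MA) * r).
have H := @deriv_norm_mean_value R _ normX C s t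
  (fun r => X t *m (Y r *m (B r *m v))) rho drho hX C0 hC st.
have E : rho t - rho s = D / MA * (expR (MA * (t - s)) - 1).
  rewrite /rho /GRing.scale /=.
  have -> : MA * t + - MA * t = 0 by ring.
  have -> : MA * t + - MA * s = MA * (t - s) by ring.
  by rewrite expR0; ring.
rewrite E in H; rewrite nrmBC//.
have -> : B t *m v = X t *m (Y t *m (B t *m v)).
  by rewrite mulmxA XY// mul1mx.
apply: H => r /andP[sr rt].
  have -> : drho r = (- (D / MA)) *: (- MA * expR (MA * t + - MA * r) : R^o).
    by rewrite /drho /GRing.scale /=; field; rewrite gt_eqF.
  by apply: deriv_inZ; exact: deriv_in_expR.
have rr : t0 <= r <= tf by rewrite (le_trans ts)// (le_trans rt).
exists (X t *m (Y r *m (dB r *m v - A r *m (B r *m v)))).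
  have := deriv_in_mulmxl (X t) (deriv_in_sub ts tt (deriv_in_mulmx (dY r rr)
    (deriv_in_mulmxr v (C1_deriv_in B_C1 rr)))).
  by rewrite mulNmx -mulmxA addrC -mulmxBr.
rewrite (le_trans (flow_bound _ _ rt tt))//; first by case/andP: rr.
rewrite /drho mulrC; have -> : MA * (t - r) = MA * t + - MA * r by ring.
rewrite ler_wpM2r ?expR_ge0// (le_trans (nrmB hX _ _))// /D mulrDl lerD//.
  exact: dB_bound.
rewrite (le_trans (A_bound _ rr))// -mulrA ler_wpM2l ?(ltW MA0)//.
exact: B_bound.
Qed.

Lemma flow_sub1_bound s t x : t0 <= s -> s <= t -> t <= tf ->
  normX (X t *m (Y s *m x) - x) <= (expR (MA * (t - s)) - 1) * normX x.
Proof.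
move=> ts st tt; have [dX dY YX XY] := F.
have ss : t0 <= s <= tf by rewrite ts (le_trans st).
have [C C0 hC] := norm_le_mx_norm hX.
pose rho r := normX x *: (expR (- (MA * s) + MA * r) : R^o).
have := @deriv_norm_mean_value R _ normX C s t (fun r => X r *m (Y s *m x)) rho
  (fun r => normX x *: (MA * expR (- (MA * s) + MA * r) : R^o)) hX C0 hC st.
have -> : X s *m (Y s *m x) = x by rewrite mulmxA XY// mul1mx.
have -> : rho t - rho s = (expR (MA * (t - s)) - 1) * normX x.
  by rewrite /rho /GRing.scale /= addNr expR0 mulrBr [MA * t - _]addrC; ring.
apply=> r /andP[sr rt]; first by apply: deriv_inZ; exact: deriv_in_expR.
have rr : t0 <= r <= tf by rewrite (le_trans ts)// (le_trans rt).
exists (A r *m (X r *m (Y s *m x))).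
  rewrite mulmxA; apply: deriv_in_mulmxr.
  exact: deriv_in_sub (dX r rr).
rewrite (le_trans (A_bound _ rr))// /GRing.scale /= mulrCA ler_wpM2l ?(ltW MA0)//.
have -> : - (MA * s) + MA * r = MA * (r - s) by ring.
by rewrite mulrC flow_bound//; case/andP: rr.
Qed.

Lemma B_lip_norm s t v : t0 <= s -> s <= t -> t <= tf ->
  normX (B t *m v - B s *m v) <= MdB * normU v * (t - s).
Proof.
move=> ts st tt; have [C C0 hC] := norm_le_mx_norm hX.
rewrite mulrBr.
apply: (@deriv_norm_mean_value R _ normX C s t (fun r => B r *m v)
  (fun r => MdB * normU v * r) (fun=> MdB * normU v)) => //.
  by move=> r _; exact: deriv_in_linear.
move=> r /andP[sr rt]; have rr : t0 <= r <= tf by rewrite (le_trans ts)// (le_trans rt).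
exists (dB r *m v); last exact: dB_bound.
by apply: deriv_in_mulmxr; apply: deriv_in_sub (C1_deriv_in B_C1 rr).
Qed.

End System.

End Estimates.

(** * Restriction and extension of trajectories *)

Section Reach.
Context {R : realType}.
Local Notation mu := (@lebesgue_measure R).

Lemma itv_cara_measurable (i : interval R) :
  @measurable _ (caratheodory_type ((@wlength R idfun)^*)%mu) [set` i].
Proof.
by apply: sub_caratheodory; exact: (measurable_itv i).
Qed.

Lemma lebesgue_measurable_fun_sub m a b a' b' (u : R -> 'cV[R]_m) :
  a <= a' -> b' <= b ->
  lebesgue_measurable_fun `[a, b] u -> lebesgue_measurable_fun `[a', b'] u.
Proof.
move=> aa bb mu_ T i mD S mS.
have -> : `[a', b'] `&` (fun r => u r i 0) @^-1` S =
    `[a', b'] `&` (`[a, b] `&` (fun r => u r i 0) @^-1` S).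
  apply/seteqP; split=> [r /= []|r /= [? []]//].
  by rewrite !in_itv/= => /andP[ar rb] Sr; rewrite ar rb (le_trans aa)// (le_trans rb).
apply: measurableI; first exact: itv_cara_measurable.
by apply: mu_ => //; exact: itv_cara_measurable.
Qed.

Lemma lebesgue_measurable_fun_concat m a s b (u : R -> 'cV[R]_m) v :
  a <= s -> s <= b -> lebesgue_measurable_fun `[a, s] u ->
  lebesgue_measurable_fun `[a, b] (fun r => if r <= s then u r else v).
Proof.
move=> as_ sb mu_ T i mD S mS.
have -> : `[a, b] `&` (fun r => (if r <= s then u r else v) i 0) @^-1` S =
    (`[a, s] `&` (fun r => u r i 0) @^-1` S) `|`
    (`]s, b] `&` (fun r => v i 0) @^-1` S).
  apply/seteqP; split=> [r /= []|r /= [|]].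
  - rewrite !in_itv/= => /andP[ar rb]; case: ifPn => [rs|]; first by left; rewrite ar.
    by rewrite -ltNge => sr; right; rewrite sr rb.
  - by rewrite !in_itv/= => -[/andP[ar rs] Sr]; rewrite rs ar (le_trans rs).
  - rewrite !in_itv/= => -[/andP[sr rb] Sr].
    by rewrite [r <= s]leNgt sr/= rb (le_trans as_ (ltW sr)).
apply: measurableU; first by apply: mu_ => //; exact: itv_cara_measurable.
have [vS|vS] := pselect (S (v i 0)).
  rewrite (_ : _ `&` _ = `]s, b]%classic); first exact: itv_cara_measurable.
  by apply/seteqP; split=> r /= => [[]|].
rewrite (_ : _ `&` _ = set0); first exact: measurable0.
by apply/seteqP; split=> r /= => [[]|].
Qed.

Lemma is_solution_sub n m (A : R -> 'M[R]_n) (B : R -> 'M[R]_(n, m)) a b b' p u x :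
  b' <= b -> is_solution A B a b a p u x -> is_solution A B a b' a p u x.
Proof.
move=> bb [acx xa xae]; split => //; first exact: ac_sub acx.
apply: filterS xae; first exact: (ae_filter_ringOfSetsType mu).
move=> t h; rewrite in_itv/= => /andP[at_ tb]; apply: h.
by rewrite in_itv/= at_ (le_trans tb).
Qed.

Lemma reach_restrict n m (A : R -> 'M[R]_n) (B : R -> 'M[R]_(n, m)) X0 U t0 s t p u x :
  s <= t -> X0 p -> lebesgue_measurable_fun `[t0, t] u ->
  (forall r, r \in `[t0, t] -> U (u r)) ->
  is_solution A B t0 t t0 p u x -> reach A B X0 U t0 s (x s).
Proof.
move=> st Xp mu_ uU sol; exists p, u, x; apply: And5; [exact: Xp| | | |reflexivity].
- exact: lebesgue_measurable_fun_sub (lexx t0) st mu_.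
- move=> r; rewrite in_itv/= => /andP[tr rs]; apply: uU.
  by rewrite in_itv/= tr (le_trans rs).
- exact: is_solution_sub st sol.
Qed.

End Reach.

(** * Reachable sets over one step *)

Section LocalEstimates.
Context {R : realType}.
Local Notation mu := (@lebesgue_measure R).
Context {n m : nat} {normX : 'cV[R]_n -> R} {normU : 'cV[R]_m -> R}
  (hX : is_norm normX) (hU : is_norm normU) {t0 tf : R} (t0f : t0 < tf)
  {A dA : R -> 'M[R]_n} {B dB : R -> 'M[R]_(n, m)}
  (A_C1 : C1_on t0 tf A dA) (B_C1 : C1_on t0 tf B dB)
  {MA MdA MB MdB : R} (MA0 : 0 < MA) (MB0 : 0 <= MB) (MdB0 : 0 <= MdB)
  (MdA0 : 0 <= MdA)
  (A_le : forall t, t0 <= t <= tf -> op_norm normX normX (A t) <= MA)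
  (dA_le : forall t, t0 <= t <= tf -> op_norm normX normX (dA t) <= MdA)
  (B_le : forall t, t0 <= t <= tf -> op_norm normU normX (B t) <= MB)
  (dB_le : forall t, t0 <= t <= tf -> op_norm normU normX (dB t) <= MdB)
  {X Y : R -> 'M[R]_n} (F : fundamental t0 tf A X Y).

Let lA : lip_in t0 tf A := C1_lip_in hX hX A_C1 dA_le.
Let lB : lip_in t0 tf B := C1_lip_in hU hX B_C1 dB_le.
Let lX : lip_in t0 tf X := (fund_lip (ltW t0f) lA F).1.
Let lY : lip_in t0 tf Y := (fund_lip (ltW t0f) lA F).2.

(** Mean value inclusion for r |-> phi(t,r) x(r), whose derivative is
    phi(t,r) B(r) u(r).  By [kernel_bound] it is close to B(t) u(r), and alpha(t - s)
    is the integral of that bound over [s, t]. *)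
Lemma local_reach (U : set 'cV[R]_m) (nU : R) c d s t q p u x :
  compact U -> @convex_set R _ U -> U !=set0 ->
  (forall v, U v -> normU v <= nU) ->
  t0 <= c -> c <= s -> s <= t -> t <= d -> d <= tf ->
  is_solution A B c d q p u x -> (forall r, s < r <= t -> U (u r)) ->
  exists2 v, U v & normX (x t - X t *m (Y s *m x s) - (t - s) *: (B t *m v)) <=
    alpha MA MB MdB nU (t - s).
Proof.
move=> Uc Ucv U0 UnU tc cs st td dtf sol uU; have [dX dY YX XY] := F.
have cd : c <= d by rewrite (le_trans cs)// (le_trans st).
have tt' : t0 <= t <= tf by rewrite (le_trans tc)//= ?(le_trans td)// (le_trans cs).
have nU0 : 0 <= nU by have [v Uv] := U0; rewrite (le_trans _ (UnU v Uv))// nrm_ge0.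
have [acw wae] := fund_conj (ltW t0f) lA F tc cd dtf sol.
pose D := (MdB + MA * MB) * nU.
have D0 : 0 <= D by rewrite mulr_ge0// addr_ge0// mulr_ge0// ltW.
(* a primitive of the bound of [kernel_bound], with increment alpha(t - s) *)
pose rho r := (- (D / MA ^+ 2)) *: (expR (MA * t + (- MA) * r) : R^o) + (- (D / MA)) * r.
pose drho r := D / MA * (expR (MA * (t - r)) - 1).
have H := @ac_mean_value R n m normX hX U (B t) (fun r => X t *m (Y r *m x r))
  rho drho s t Uc Ucv U0 st.
have E : rho t - rho s = alpha MA MB MdB nU (t - s).
  rewrite /rho /GRing.scale /= /alpha /rfun.
  have -> : MA * t + - MA * t = 0 by ring.
  have -> : MA * t + - MA * s = (t - s) * MA by ring.
  by rewrite expR0 /D; field; rewrite gt_eqF.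
rewrite E in H; have [] := H.
- have lw : absolutely_continuous_on s t (fun r => Y r *m x r).
    exact: ac_sub acw.
  apply: (@ac_dominated _ _ _ _ _ _ _ (n%:R * `|X t|)) lw; first by rewrite mulr_ge0.
  move=> l r sl lr rt; rewrite -mulmxBr (le_trans (mulmx_norm_le _ _))//.
  by rewrite ler_wpM2l ?mulr_ge0// lerDl subr_ge0.
- move=> r rst; have -> : drho r = (- (D / MA ^+ 2)) *: (- MA * expR (MA * t + - MA * r) : R^o)
      + (- (D / MA)).
    rewrite /drho /GRing.scale /=.
    have -> : MA * (t - r) = MA * t + - MA * r by ring.
    by field; rewrite gt_eqF.
  by apply: deriv_inD; [apply: deriv_inZ; exact: deriv_in_expR|exact: deriv_in_linear].
- move=> r /andP[sr rt]; rewrite /drho mulr_ge0 ?divr_ge0 ?(ltW MA0)// subr_ge0.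
  by rewrite -expR0 ler_expR mulr_ge0 ?subr_ge0// ltW.
  (* the control is known to be in U only after s, a single point being null *)
- have wi : {ae mu, forall r, r \in `[s, tf] -> r != s}.
    by apply: ae_interior => r /andP[sr _]; rewrite gt_eqF.
  apply: (@filterS2 _ _ (ae_filter_ringOfSetsType mu) _ _ _ _ wae wi).
  move=> r h1 h2 /andP[sr rt].
  have rs : s < r.
    by rewrite lt_neqAle sr andbT eq_sym h2// in_itv/= sr (le_trans rt)// (le_trans td).
  exists (X t *m (Y r *m (B r *m u r))).
    apply: deriv_in_mulmxl; apply: (deriv_in_sub cs td); apply: h1.
    by rewrite (le_trans cs)// (le_trans rt).
  have Ur : U (u r) by apply: uU; rewrite rs rt.
  exists (u r) => //.
  have tr : t0 <= r by rewrite (le_trans tc)// (le_trans cs).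
  have := kernel_bound hX hU t0f A_C1 B_C1 MA0 A_le dA_le B_le dB_le F (u r) tr rt.
  case/andP: tt' => _ tt'; move=> /(_ tt') /le_trans; apply.
  rewrite /drho ler_wpM2r//.
    by rewrite subr_ge0 -expR0 ler_expR mulr_ge0 ?subr_ge0// ltW.
  rewrite ler_wpM2r ?invr_ge0 ?(ltW MA0)// /D ler_wpM2l ?UnU//.
  by rewrite addr_ge0// mulr_ge0// ltW.
- move=> v Uv; exists v => //.
  by have <- : X t *m (Y t *m x t) = x t by rewrite mulmxA XY// mul1mx.
Qed.

(** The function f = phi(.,s) q satisfies N (f'') <= (MdA + MA^2) e^(MA (r - s)) N q.
    One mean value inequality bounds the increments of f'; a second one, applied to
    r |-> f(s + l r) - l f(s + r) on [0, h], bounds the deviation from the chord.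
    Finally 1 + x <= e^x at x = MA l h makes l a factor of the bound. *)
Lemma second_difference s h l q : t0 <= s -> 0 <= h -> s + h <= tf ->
  0 <= l <= 1 ->
  normX (X (s + l * h) *m (Y s *m q) - (1 - l) *: q - l *: (X (s + h) *m (Y s *m q)))
    <= l * (gamma MA MdA h * normX q).
Proof.
move=> ts h0 sh /andP[l0 l1]; have [dX dY YX XY] := F.
have [C C0 hC] := norm_le_mx_norm hX.
have ss : t0 <= s <= tf by rewrite ts; lra.
pose f r := X r *m (Y s *m q).
have fs : f s = q by rewrite /f mulmxA XY// mul1mx.
pose D := (MdA + MA ^+ 2) * normX q.
have MAn0 : MA != 0 by rewrite gt_eqF.
have df r : t0 <= r <= tf -> deriv_in t0 tf f r (A r *m f r).
  by move=> rr; rewrite /f mulmxA; apply: deriv_in_mulmxr; exact: dX.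
have step1 si ta : s <= si -> si <= ta -> ta <= tf ->
    normX (A ta *m f ta - A si *m f si) <=
    D / MA * (expR (- (MA * s) + MA * ta) - expR (- (MA * s) + MA * si)).
  move=> ssi sita tatf.
  pose rho r := (D / MA) *: (expR (- (MA * s) + MA * r) : R^o).
  have := @deriv_norm_mean_value R _ normX C si ta (fun r => A r *m f r) rho
    (fun r => D * expR (- (MA * s) + MA * r)) hX C0 hC sita.
  rewrite /rho -scalerBr; apply=> r /andP[sir rta].
    have -> : D * expR (- (MA * s) + MA * r) =
        (D / MA) *: (MA * expR (- (MA * s) + MA * r) : R^o).
      by rewrite /GRing.scale /=; field.
    by apply: deriv_inZ; exact: deriv_in_expR.
  have rr : t0 <= r <= tf by apply/andP; split; lra.
  exists (dA r *m f r + A r *m (A r *m f r)).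
    apply: (@deriv_in_sub _ _ t0 tf); [lra|lra|].
    by apply: deriv_in_mulmx; [exact: C1_deriv_in A_C1 rr|exact: df].
  rewrite (le_trans (nrmD hX _ _))// /D.
  have fr : normX (f r) <= expR (MA * (r - s)) * normX q.
    by apply: (flow_bound hX t0f A_C1 MA0 A_le dA_le F) => //; lra.
  have -> : - (MA * s) + MA * r = MA * (r - s) by ring.
  have -> : (MdA + MA ^+ 2) * normX q * expR (MA * (r - s)) =
    MdA * (expR (MA * (r - s)) * normX q) +
    MA * (MA * (expR (MA * (r - s)) * normX q)) by ring.
  apply: lerD.
    by rewrite (le_trans (dA_bound hX dA_le _ rr))// ler_wpM2l.
  rewrite (le_trans (A_bound hX A_le _ rr))// ler_wpM2l ?(ltW MA0)//.
  by rewrite (le_trans (A_bound hX A_le _ rr))// ler_wpM2l ?(ltW MA0).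
pose G r := f (s + l * r) - l *: f (s + 1 * r).
pose rho r := (l * D / MA ^+ 2) *: (expR (0 + MA * r) : R^o) +
  (- (D / MA ^+ 2)) *: (expR (0 + (MA * l) * r) : R^o).
pose drho r := l * (D / MA * (expR (MA * r) - expR (MA * (l * r)))).
have lr r : 0 <= r -> l * r <= r by move=> r0; rewrite ler_piMl.
have H := @deriv_norm_mean_value R _ normX C 0 h G rho drho hX C0 hC h0.
have GE : G h - G 0 = f (s + l * h) - (1 - l) *: q - l *: f (s + h).
  rewrite /G !mulr0 addr0 mul1r fs scalerBl scale1r.
  by rewrite addrAC.
rewrite -/(f _) -/(f _) -GE (le_trans (H _ _))//.
- move=> r _; have -> : drho r = (l * D / MA ^+ 2) *: (MA * expR (0 + MA * r) : R^o) +
    (- (D / MA ^+ 2)) *: ((MA * l) * expR (0 + (MA * l) * r) : R^o).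
    rewrite /drho /GRing.scale /= !add0r [MA * (l * r)]mulrA.
    by field.
  by apply: deriv_inD; apply: deriv_inZ; exact: deriv_in_expR.
- move=> r /andP[r0 rh]; have lr0 : 0 <= l * r by rewrite mulr_ge0.
  have lrr := lr r r0.
  have in1 : t0 <= s + l * r <= tf by apply/andP; split; lra.
  have in2 : t0 <= s + 1 * r <= tf by apply/andP; split; lra.
  exists (l *: (A (s + l * r) *m f (s + l * r)) - l *: (1 *: (A (s + 1 * r) *m f (s + 1 * r)))).
    apply: deriv_inB.
      apply: (@deriv_in_affine _ _ _ _ _ _ _ _ _ t0 tf); last exact: df.
      move=> y /andP[y0 yh]; have : 0 <= l * y by rewrite mulr_ge0.
      by have := lr y y0; move=> *; apply/andP; split; lra.
    apply: deriv_inZ; apply: (@deriv_in_affine _ _ _ _ _ _ _ _ _ t0 tf); last exact: df.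
    by move=> y /andP[y0 yh]; apply/andP; split; lra.
  rewrite scale1r -scalerBr (nrmZp hX)// /drho ler_wpM2l// nrmBC//.
  rewrite (le_trans (step1 _ _ _ _ _))//; [lra|lra|lra|].
  have -> : - (MA * s) + MA * (s + 1 * r) = MA * r by ring.
  by have -> : - (MA * s) + MA * (s + l * r) = MA * (l * r) by ring.
rewrite /rho /GRing.scale /= !mulr0 !addr0 !add0r expR0 /gamma /rfun.
have -> : l * ((expR (h * MA) - 1 - h * MA) * (1 + MdA / MA ^+ 2) * normX q) =
   l * (D / MA ^+ 2) * (expR (MA * h) - 1 - h * MA).
  by rewrite /D [h * MA]mulrC; field.
have e1 : 1 + MA * l * h <= expR (MA * l * h) by exact: expR_ge1Dx.
have DM : 0 <= D / MA ^+ 2.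
  apply: divr_ge0; last exact/exprn_ge0/ltW.
  by apply: mulr_ge0; [apply: addr_ge0 => //; exact/exprn_ge0/ltW|exact: nrm_ge0].
have := ler_wpM2l DM e1; rewrite mulrDr mulr1.
move: (expR (MA * l * h)) (expR (MA * h)) => E1 E2 E3.
have -> : l * D / MA ^+ 2 = l * (D / MA ^+ 2) by rewrite -[LHS]mulrA.
move: (D / MA ^+ 2) E3 => DD E3; rewrite -subr_ge0.
have -> : l * DD * (E2 - 1 - h * MA) - (l * DD * E2 + - DD * E1 - (l * DD * 1 + - DD * 1)) =
  DD * E1 - (DD + DD * (MA * l * h)) by ring.
by rewrite subr_ge0.
Qed.

(** Extend a trajectory that reaches p by the solution for the constant control v,
    given by variation of constants.  The estimate is [local_reach] for the control
    set {v}. *)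
Lemma reach_step X0 U s t p v : t0 <= s -> s <= t -> t <= tf -> U v ->
  reach A B X0 U t0 s p ->
  exists2 y, reach A B X0 U t0 t y &
    normX (y - X t *m (Y s *m p) - (t - s) *: (B t *m v)) <=
    alpha MA MB MdB (normU v) (t - s).
Proof.
move=> ts st tt Uv [x0 [u [x [X0x mu_ uU sol ->]]]]; have [dX dY YX XY] := F.
have ss : t0 <= s <= tf by rewrite ts (le_trans st).
have lYBv : lip_in s t (fun r => Y r *m (B r *m v)).
  apply: lip_in_mulmx => //; first exact: lip_in_sub lY.
  by apply: lip_in_mulmx => //; [exact: lip_in_sub lB|exact: lip_in_cst].
have [G G0 dG] := primitive_mx st lYBv.
have lG : lip_in s t G.
  have [M M0 hM] := lip_in_bounded st lYBv; exists M => //.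
  by apply: deriv_in_lipschitz => r rst; exists (Y r *m (B r *m v)); [exact: dG|exact: hM].
pose z r := X r *m (Y s *m x s + G r).
have zs : x s = z s by rewrite /z G0 addr0 mulmxA XY// mul1mx.
have lz : lip_in s t z.
  apply: lip_in_mulmx => //; first exact: lip_in_sub lX.
  have [L L0 hL] := lG; exists L => // l r sl lr rt.
  by rewrite opprD addrACA subrr add0r hL.
have dz r : s <= r <= t -> deriv_in s t z r (A r *m z r + B r *m v).
  move=> /andP[sr rt]; have rr : t0 <= r <= tf by rewrite (le_trans ts)// (le_trans rt).
  have rst : s <= r <= t by rewrite sr rt.
  have -> : A r *m z r + B r *m v = A r *m X r *m (Y s *m x s + G r) +
      X r *m (0 + Y r *m (B r *m v)).
    by rewrite /z add0r [X r *m (Y r *m _)]mulmxA XY// mul1mx mulmxA.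
  apply: deriv_in_mulmx; first exact: deriv_in_sub (dX r rr).
  by apply: deriv_inD; [exact: deriv_in_cst|exact: dG].
pose u' r := if r <= s then u r else v.
pose x' r := if r <= s then x r else z r.
have sol' : is_solution A B t0 t t0 x0 u' x'.
  have [acx xt0 xae] := sol; apply: And3.
  - exact: ac_concat.
  - by rewrite /x' ts.
  - have wi : {ae mu, forall r, r \in `[t0, t] -> (t0 < r < t) /\ (r != s)}.
      have h1 : {ae mu, forall r, r \in `[t0, t] -> t0 < r < t} by exact: ae_interior.
      have h2 : {ae mu, forall r, r \in `[s, s] -> False}.
        by apply: ae_interior => r /andP[h3 h4]; move: (lt_trans h3 h4); rewrite ltxx.
      apply: (@filterS2 _ _ (ae_filter_ringOfSetsType mu) _ _ _ _ h1 h2).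
      move=> r h3 h4 rt; split; first exact: h3.
      by apply/negP => /eqP rs; apply: h4; rewrite rs in_itv/= lexx.
    apply: (@filterS2 _ _ (ae_filter_ringOfSetsType mu) _ _ _ _ xae wi).
    move=> r hx hr rt; have [/andP[tr rt'] rs] := hr rt.
    have [rls|srl] := ltP r s.
      have := hx; rewrite in_itv/= (ltW tr) (ltW rls) => /(_ isT).
      move/(is_derive_deriv_in t0 s) => dx.
      rewrite /x' /u' (ltW rls); apply: (@deriv_in_is_derive _ _ t0 s); first by rewrite tr rls.
      apply: deriv_in_congr dx; last by rewrite (ltW tr) ltW.
      by move=> y /andP[_ ys]; rewrite ys.
    have sr : s < r by rewrite lt_neqAle eq_sym rs.
    rewrite /x' /u' leNgt sr/=; apply: (@deriv_in_is_derive _ _ s t); first by rewrite sr rt'.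
    have rst : s <= r <= t by rewrite srl ltW.
    apply: deriv_in_congr (dz r rst) => // y /andP[sy _].
    by case: ifPn => // ys; have -> : y = s by apply/eqP; rewrite eq_le ys sy.
exists (x' t).
  exists x0, u', x'; apply: And5; [exact: X0x| | |exact: sol'|reflexivity].
    exact: lebesgue_measurable_fun_concat.
  move=> r; rewrite in_itv/= /u' => /andP[tr rt]; case: ifPn => // rs.
  by apply: uU; rewrite in_itv/= tr rs.
have [|||v' -> ] := @local_reach [set v] (normU v) t0 t s t t0 x0 u' x'
  (@compact_set1 _ v) (@convex_set1 _ _ v) _ _ (lexx t0) ts st (lexx t) tt sol'.
- by exists v.
- by move=> _ ->.
- by move=> r /andP[sr _]; rewrite /u' leNgt sr.
- by rewrite /x' lexx.
Qed.

End LocalEstimates.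

(** * Minkowski sums with balls *)

Section Sets.
Context {R : realType}.

Lemma ball_scaleP (V : lmodType R) (N : V -> R) (hN : is_norm N) c z : 0 <= c ->
  set_scale c (unit_ball N) z <-> N z <= c.
Proof.
move=> c0; split=> [[x /= x1 <-]|zc]; first by rewrite (nrmZp hN)// ler_piMr.
have [c00|cn0] := eqVneq c 0.
  have -> : z = 0 by apply: (nrm_eq0 hN); apply/eqP; rewrite eq_le nrm_ge0// andbT -c00.
  by exists 0; rewrite /unit_ball /= ?nrm0// scaler0.
have cp : 0 < c by rewrite lt_neqAle eq_sym cn0.
exists (c^-1 *: z); last by rewrite scalerA divff// scale1r.
by rewrite /unit_ball /= (nrmZp hN) ?invr_ge0// mulrC ler_pdivrMr// mul1r.
Qed.

Lemma add_ballP (V : lmodType R) (N : V -> R) (hN : is_norm N) (M : set V) c z :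
  0 <= c ->
  set_add M (set_scale c (unit_ball N)) z <-> exists2 x, M x & N (z - x) <= c.
Proof.
move=> c0; split=> [[x Mx [y /(ball_scaleP hN _ c0) yc <-]]|[x Mx zx]].
  by exists x => //; rewrite addrC addKr.
exists x => //; exists (z - x); first exact/ball_scaleP.
by rewrite addrC subrK.
Qed.

Lemma scheme_stepP n m (N : 'cV[R]_n -> R) (hN : is_norm N) (Q : 'M[R]_n)
    (K : 'M[R]_(n, m)) (M : set 'cV[R]_n) (U : set 'cV[R]_m) (h c : R) z :
  0 <= c ->
  set_add (set_add (set_mulmx Q M) (set_scale h (set_mulmx K U)))
    (set_scale c (unit_ball N)) z <->
  exists x v, [/\ M x, U v & N (z - Q *m x - h *: (K *m v)) <= c].
Proof.
move=> c0; split=> [/(add_ballP hN _ _ c0)[_ [_ [x Mx <-] [_ [_ [v Uv <-] <-] <-]]]|].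
  by exists x, v; split => //; rewrite -addrA -opprD.
move=> [x [v [Mx Uv xv]]]; apply/(add_ballP hN _ _ c0).
exists (Q *m x + h *: (K *m v)); last by rewrite opprD addrA.
exists (Q *m x); first by exists x.
by exists (h *: (K *m v)) => //; exists (K *m v) => //; exists v.
Qed.

Lemma scheme_step_convex n m (N : 'cV[R]_n -> R) (hN : is_norm N) (Q : 'M[R]_n)
    (K : 'M[R]_(n, m)) (M : set 'cV[R]_n) (U : set 'cV[R]_m) (h c : R) :
  0 <= c -> @convex_set R _ M -> @convex_set R _ U ->
  @convex_set R _ (set_add (set_add (set_mulmx Q M) (set_scale h (set_mulmx K U)))
    (set_scale c (unit_ball N))).
Proof.
move=> c0 /convex_setP cM /convex_setP cU; apply/convex_setP => x y l l01.
move=> /(scheme_stepP hN _ _ _ _ _ _ c0)[x1 [v1 [M1 U1 h1]]].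
move=> /(scheme_stepP hN _ _ _ _ _ _ c0)[x2 [v2 [M2 U2 h2]]].
apply/(scheme_stepP hN _ _ _ _ _ _ c0).
exists (l *: x1 + (1 - l) *: x2), (l *: v1 + (1 - l) *: v2).
split; [exact: cM|exact: cU|]; have /andP[l0 l1] := l01.
have -> : l *: x + (1 - l) *: y - Q *m (l *: x1 + (1 - l) *: x2) -
    h *: (K *m (l *: v1 + (1 - l) *: v2)) =
  l *: (x - Q *m x1 - h *: (K *m v1)) + (1 - l) *: (y - Q *m x2 - h *: (K *m v2)).
  rewrite !mulmxDr -!scalemxAr.
  move: (Q *m x1) (Q *m x2) (K *m v1) (K *m v2) => q1 q2 k1 k2.
  by apply/matrixP => i j; rewrite !mxE; ring.
have l1' : 0 <= 1 - l by rewrite subr_ge0.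
rewrite (le_trans (nrmD hN _ _))// !(nrmZp hN)//.
have -> : c = l * c + (1 - l) * c by ring.
by rewrite lerD// ler_wpM2l.
Qed.

Lemma add_ball_convex (V : lmodType R) (N : V -> R) (hN : is_norm N) (M : set V) c :
  0 <= c -> @convex_set R _ M ->
  @convex_set R _ [set z | exists2 x, M x & N (z - x) <= c].
Proof.
move=> c0 /convex_setP cM; apply/convex_setP => x y l l01 [x1 M1 h1] [x2 M2 h2].
have /andP[l0 l1] := l01; have l1' : 0 <= 1 - l by rewrite subr_ge0.
exists (l *: x1 + (1 - l) *: x2); first exact: cM.
have -> : l *: x + (1 - l) *: y - (l *: x1 + (1 - l) *: x2) =
  l *: (x - x1) + (1 - l) *: (y - x2) by rewrite !scalerBr opprD addrACA.
rewrite (le_trans (nrmD hN _ _))// !(nrmZp hN)//.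
have -> : c = l * c + (1 - l) * c by ring.
by rewrite lerD// ler_wpM2l.
Qed.

End Sets.

(** * The second order remainder of the exponential *)

Section Exponential.
Context {R : realType}.
Implicit Types x l : R.

Lemma expR_sub1_le x : expR x - 1 <= x * expR x.
Proof.
have := ler_wpM2l (expR_ge0 x) (expR_ge1Dx (- x)).
by rewrite expRN mulfV ?gt_eqF ?expR_gt0// => ?; lra.
Qed.

(** Combine e^x >= e^(l x) (1 + x - l x) and 1 >= e^(l x) (1 - l x) with weights l
    and 1 - l. *)
Lemma expR_convex01 x l : 0 <= l <= 1 -> expR (l * x) <= 1 - l + l * expR x.
Proof.
move=> /andP[l0 l1].
have h1 := ler_wpM2l (expR_ge0 (l * x)) (expR_ge1Dx (x - l * x)).
have h2 := ler_wpM2l (expR_ge0 (l * x)) (expR_ge1Dx (- (l * x))).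
move: h1 h2; rewrite -!expRD (_ : l * x + (x - l * x) = x); last by ring.
rewrite subrr expR0 => h1 h2.
have l1' : 0 <= 1 - l by rewrite subr_ge0.
have h3 := lerD (ler_wpM2l l0 h1) (ler_wpM2l l1' h2).
apply: le_trans (le_trans h3 _); last by rewrite mulr1 addrC.
rewrite le_eqVlt; apply/orP; left; apply/eqP; ring.
Qed.

Lemma rfun_ge0 (M s : R) : 0 <= rfun M s.
Proof. by have := expR_ge1Dx (s * M); rewrite /rfun => ?; lra. Qed.

Lemma rfun_scale (M s l : R) : 0 <= l <= 1 -> rfun M (l * s) <= l * rfun M s.
Proof.
move=> l01; have := expR_convex01 (s * M) l01; rewrite /rfun -[l * s * M]mulrA.
by rewrite !mulrBr mulr1 => ?; lra.
Qed.

(** With x = s M, e^x - 1 - x <= x (e^x - 1) <= x^2 e^x. *)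
Lemma rfun_quadratic (M s T : R) : 0 <= M -> 0 <= s -> s <= T ->
  rfun M s <= M ^+ 2 * expR (M * T) * s ^+ 2.
Proof.
move=> M0 s0 sT; have sM0 : 0 <= s * M by rewrite mulr_ge0.
have h1 := expR_sub1_le (s * M).
have h2 := ler_wpM2l sM0 h1.
have h3 : expR (s * M) <= expR (M * T).
  by rewrite ler_expR mulrC ler_wpM2l.
have h4 : 0 <= (s * M) ^+ 2 by rewrite exprn_ge0.
have := ler_wpM2l h4 h3; rewrite /rfun => h5.
have -> : M ^+ 2 * expR (M * T) * s ^+ 2 = (s * M) ^+ 2 * expR (M * T) by ring.
have h6 : (s * M) ^+ 2 * expR (s * M) = s * M * (s * M * expR (s * M)) by ring.
by move: h2; rewrite mulrBr mulr1 -h6 => h2; lra.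
Qed.

End Exponential.

(** * The numerical scheme *)

Section Scheme.
Context {R : realType} {n m : nat}.
Context {normX : 'cV[R]_n -> R} {normU : 'cV[R]_m -> R}
  (hX : is_norm normX) (hU : is_norm normU).
Context {t0 tf : R} (t0f : t0 < tf).
Context {X0 : set 'cV[R]_n} {U : set 'cV[R]_m}
  (X0_neq0 : X0 !=set0) (X0_convex : @convex_set R _ X0)
  (U_neq0 : U !=set0) (U_convex : @convex_set R _ U).
Context {MA MdA MB MdB nU nX : R} (MA0 : 0 < MA) (MdA0 : 0 <= MdA)
  (MB0 : 0 <= MB) (MdB0 : 0 <= MdB).
Context (U_le : forall v, U v -> normU v <= nU)
  (X0_le : forall x, X0 x -> normX x <= nX).
(** The scheme interacts with the control system only through these estimates on a
    family Phi of matrices and a family Rch of sets. *)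
Context {Phi : R -> R -> 'M[R]_n} {B : R -> 'M[R]_(n, m)}
  {Rch : R -> set 'cV[R]_n}.
Context
  (Rch0 : Rch t0 = X0)
  (Phi_le : forall s t q, t0 <= s -> s <= t -> t <= tf ->
    normX (Phi t s *m q) <= expR (MA * (t - s)) * normX q)
  (Phi_sub1_le : forall s t q, t0 <= s -> s <= t -> t <= tf ->
    normX (Phi t s *m q - q) <= (expR (MA * (t - s)) - 1) * normX q)
  (Phi_second : forall s h l q, t0 <= s -> 0 <= h -> s + h <= tf -> 0 <= l <= 1 ->
    normX (Phi (s + l * h) s *m q - (1 - l) *: q - l *: (Phi (s + h) s *m q)) <=
    l * (gamma MA MdA h * normX q))
  (B_le : forall t v, t0 <= t <= tf -> normX (B t *m v) <= MB * normU v)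
  (B_lip : forall s t v, t0 <= s -> s <= t -> t <= tf ->
    normX (B t *m v - B s *m v) <= MdB * normU v * (t - s))
  (Rch_back : forall s t y, t0 <= s -> s <= t -> t <= tf -> Rch t y ->
    exists p v, [/\ Rch s p, U v &
      normX (y - Phi t s *m p - (t - s) *: (B t *m v)) <= alpha MA MB MdB nU (t - s)])
  (Rch_fwd : forall s t p v, t0 <= s -> s <= t -> t <= tf -> Rch s p -> U v ->
    exists2 y, Rch t y &
      normX (y - Phi t s *m p - (t - s) *: (B t *m v)) <= alpha MA MB MdB nU (t - s)).
Context {phi' : R -> R -> 'M[R]_n} {theta : R -> R}
  (theta0 : forall s, 0 <= s -> 0 <= theta s)
  (phi'_le : forall t s q, t0 <= s -> s <= t -> t <= tf ->
    normX (Phi t s *m q - phi' t s *m q) <= theta (t - s) * normX q).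

Let alph := alpha MA MB MdB nU.

Lemma nU_ge0 : 0 <= nU.
Proof. by have [v Uv] := U_neq0; rewrite (le_trans _ (U_le Uv))// nrm_ge0. Qed.

Lemma nX_ge0 : 0 <= nX.
Proof. by have [x Xx] := X0_neq0; rewrite (le_trans _ (X0_le Xx))// nrm_ge0. Qed.

Lemma alpha_coef_ge0 : 0 <= nU * ((MdB + MA * MB) / MA ^+ 2).
Proof.
apply: mulr_ge0; first exact: nU_ge0.
apply: divr_ge0; last exact/exprn_ge0/ltW.
by apply: addr_ge0 => //; apply: mulr_ge0 => //; exact: ltW.
Qed.

Lemma alpha_ge0 h : 0 <= alph h.
Proof. by rewrite /alph /alpha -mulrA mulr_ge0 ?rfun_ge0 ?alpha_coef_ge0. Qed.

Lemma alpha_scale h l : 0 <= l <= 1 -> alph (l * h) <= l * alph h.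
Proof.
move=> l01; rewrite /alph /alpha -!mulrA [leRHS]mulrA.
by rewrite ler_wpM2r ?alpha_coef_ge0// rfun_scale.
Qed.

Lemma gamma_coef_ge0 : 0 <= 1 + MdA / MA ^+ 2.
Proof. by apply: addr_ge0 => //; apply: divr_ge0 => //; exact/exprn_ge0/ltW. Qed.

Lemma gamma_ge0 h : 0 <= gamma MA MdA h.
Proof. by rewrite mulr_ge0 ?rfun_ge0 ?gamma_coef_ge0. Qed.

Lemma beta_ge0 h : 0 <= beta MdB nU h.
Proof. by rewrite /beta mulr_ge0 ?nU_ge0// mulr_ge0 ?sqr_ge0. Qed.

Section FixedN.
Context {N : nat} (N0 : (0 < N)%N) {Omega Gamma : nat -> set 'cV[R]_n}.
Let h := step t0 tf N.
Let t_ := node t0 tf N.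
Context (Omega0 : Omega 0%N = X0)
  (OmegaS : forall i, (i < N)%N -> Omega i.+1 =
    set_add (set_add (set_mulmx (phi' (t_ i.+1) (t_ i)) (Omega i))
        (set_scale h (set_mulmx (B (t_ i.+1)) U)))
      (set_scale (alph h + theta h * set_norm normX (Omega i)) (unit_ball normX)))
  (GammaE : forall i, (i < N)%N -> Gamma i.+1 =
    conv_hull (Omega i `|` set_add (Omega i.+1)
      (set_scale (beta MdB nU h + gamma MA MdA h * set_norm normX (Omega i))
        (unit_ball normX)))).

Let b_ i := set_norm normX (Omega i).

Lemma step_gt0 : 0 < h.
Proof. by rewrite /h /step divr_gt0 ?subr_gt0// ltr0n. Qed.
Let h0 := ltW step_gt0.

Lemma nodeS i : t_ i.+1 = t_ i + h.
Proof. by rewrite /t_ /node -/h -natr1; ring. Qed.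

Lemma node0 : t_ 0%N = t0.
Proof. by rewrite /t_ /node mul0r addr0. Qed.

Lemma node_ge i : t0 <= t_ i.
Proof. by rewrite /t_ /node lerDl mulr_ge0. Qed.

Lemma node_le i : (i <= N)%N -> t_ i <= tf.
Proof.
move=> iN; rewrite /t_ /node -/h -lerBrDl.
have -> : tf - t0 = N%:R * h.
  by rewrite /h /step mulrC divfK// pnatr_eq0 -lt0n.
by rewrite ler_wpM2r// ler_nat.
Qed.

Lemma Omega_norm_ge0 i x : (forall y, Omega i y -> normX y <= b_ i) -> Omega i x -> 0 <= b_ i.
Proof. by move=> le Ox; rewrite (le_trans _ (le x Ox))// nrm_ge0. Qed.

Lemma node_sub i : t_ i.+1 - t_ i = h.
Proof. by rewrite nodeS addrAC subrr add0r. Qed.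

Lemma node_leS i : t_ i <= t_ i.+1. Proof. by rewrite nodeS lerDl. Qed.

Lemma step_norm_le i x v z r c : (i < N)%N -> normX x <= r -> U v ->
  normX (z - phi' (t_ i.+1) (t_ i) *m x - h *: (B (t_ i.+1) *m v)) <= c ->
  normX z <= (expR (MA * h) + theta h) * r + h * (MB * nU) + c.
Proof.
move=> iN xr Uv zc.
have e1 := Phi_le x (node_ge i) (node_leS i) (node_le iN).
have e2 := phi'_le x (node_ge i) (node_leS i) (node_le iN).
rewrite node_sub in e1 e2.
have e3 : normX (phi' (t_ i.+1) (t_ i) *m x) <= (expR (MA * h) + theta h) * r.
  rewrite (le_trans (norm_le_dist hX _ (Phi (t_ i.+1) (t_ i) *m x)))//.
  rewrite mulrDl lerD//.
    by rewrite (le_trans e1)// ler_wpM2l ?expR_ge0.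
  by rewrite nrmBC// (le_trans e2)// ler_wpM2l ?theta0.
have e4 : normX (h *: (B (t_ i.+1) *m v)) <= h * (MB * nU).
  rewrite (nrmZp hX)// ler_wpM2l// (le_trans (B_le _ _))//.
    by rewrite node_ge node_le.
  by rewrite ler_wpM2l// U_le.
rewrite (le_trans (norm_le_dist hX _ (phi' (t_ i.+1) (t_ i) *m x + h *: (B (t_ i.+1) *m v))))//.
by rewrite opprD addrA lerD// (le_trans (nrmD hX _ _))// lerD.
Qed.

Lemma Omega_facts i : (i <= N)%N ->
  [/\ Omega i !=set0, @convex_set R _ (Omega i) &
      forall x, Omega i x -> normX x <= b_ i].
Proof.
elim: i => [|i IH] iN.
  by rewrite /b_ Omega0; split => // x Xx; exact: set_norm_ge X0_le Xx.
have [[x Ox] cO leO] := IH (ltnW iN).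
have b0 := Omega_norm_ge0 leO Ox.
have c0 : 0 <= alph h + theta h * b_ i.
  by apply: addr_ge0; [exact: alpha_ge0|apply: mulr_ge0 => //; exact: theta0].
have [v Uv] := U_neq0.
have OS z : Omega i.+1 z -> normX z <= (expR (MA * h) + theta h) * b_ i +
    h * (MB * nU) + (alph h + theta h * b_ i).
  rewrite OmegaS// => /(scheme_stepP hX _ _ _ _ _ _ c0)[x1 [v1 [Ox1 U1 z1]]].
  exact: step_norm_le (leO _ Ox1) U1 z1.
split.
- exists (phi' (t_ i.+1) (t_ i) *m x + h *: (B (t_ i.+1) *m v)).
  rewrite OmegaS//; apply/(scheme_stepP hX _ _ _ _ _ _ c0); exists x, v; split => //.
  by rewrite -[X in normX X]addrA -opprD subrr (nrm0 hX).
- by rewrite OmegaS//; exact: scheme_step_convex.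
- by move=> y Oy; exact: set_norm_ge OS Oy.
Qed.

Lemma radius_ge0 i : (i <= N)%N -> 0 <= b_ i.
Proof. by move=> /Omega_facts[[x Ox] _ le]; exact: Omega_norm_ge0 Ox. Qed.

Lemma OmegaP i z : (i < N)%N -> Omega i.+1 z <->
  exists x v, [/\ Omega i x, U v &
    normX (z - phi' (t_ i.+1) (t_ i) *m x - h *: (B (t_ i.+1) *m v)) <=
      alph h + theta h * b_ i].
Proof.
move=> iN; rewrite OmegaS//; apply: scheme_stepP => //.
apply: addr_ge0; first exact: alpha_ge0.
by apply: mulr_ge0; [exact: theta0|exact/radius_ge0/ltnW].
Qed.

(** Replacing the transition matrix by phi' costs theta(h) times the norm of p, which
    the radius of the enlargement provides for. *)
Lemma Omega_of_Phi i z p v : (i < N)%N -> Omega i p -> U v ->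
  normX (z - Phi (t_ i.+1) (t_ i) *m p - h *: (B (t_ i.+1) *m v)) <= alph h ->
  Omega i.+1 z.
Proof.
move=> iN Op Uv zle; apply/(OmegaP _ iN); exists p, v; split => //.
have [_ _ leO] := Omega_facts (ltnW iN).
set P := Phi _ _ *m p in zle *; set Q := phi' _ _ *m p; set K := h *: _.
have -> : z - Q - K = (z - P - K) + (P - Q).
  by rewrite -addrA addrCA addrA -[in RHS]addrA; apply/matrixP => i' j'; rewrite !mxE; ring.
rewrite (le_trans (nrmD hX _ _))// lerD//.
have := phi'_le p (node_ge i) (node_leS i) (node_le iN).
by rewrite node_sub => /le_trans; apply; rewrite ler_wpM2l ?theta0// leO.
Qed.

Lemma reach_Omega i : (i <= N)%N -> Rch (t_ i) `<=` Omega i.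
Proof.
elim: i => [_|i IH iN]; first by rewrite node0 Rch0 Omega0.
move=> y /(Rch_back (node_ge i) (node_leS i) (node_le iN))[p [v [Rp Uv]]].
rewrite node_sub => yle; apply: Omega_of_Phi yle => //.
exact: IH (ltnW iN) p Rp.
Qed.

(** Let y be reached at time s = t_i + l h from p at t_i.  Then
    y = (1 - l) p + l (q1 + q2), where q1 is phi(t_{i+1},t_i) p + h B(t_{i+1}) v plus
    the residual of y divided by l: since alpha(l h) <= l alpha(h), it lies in
    Omega_{i+1}.  The term q2 collects the deviation of the flow from its chord and
    the variation of B; it is bounded by means of gamma and beta. *)
Lemma tube_Gamma i : (i < N)%N ->
  \bigcup_(s in `[t_ i, t_ i.+1]) Rch s `<=` Gamma i.+1.
Proof.
move=> iN y [s /=]; rewrite in_itv/= => /andP[si sS] Ry.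
have [_ cO leO] := Omega_facts (ltnW iN).
have stf : s <= tf by rewrite (le_trans sS)// node_le.
have [p [v [Rp Uv yle]]] := Rch_back (node_ge i) si stf Ry.
have Op : Omega i p by exact: reach_Omega (ltnW iN) p Rp.
rewrite GammaE//; set G := (_ `|` _).
have GH : G `<=` conv_hull G by exact: sub_gen_smallest.
have GC : @convex_set R _ (conv_hull G).
  apply/convex_setP => x1 x2 l l01 G1 G2 D [/[dup] cD /convex_setP cD' GD].
  by apply: cD' => //; [exact: G1|exact: G2].
pose l := (s - t_ i) / h.
have l0 : 0 <= l by rewrite divr_ge0 ?subr_ge0.
have l1 : l <= 1 by rewrite ler_pdivrMr ?step_gt0// mul1r lerBlDr addrC -nodeS.
have lh : s - t_ i = l * h by rewrite /l divfK// gt_eqF// step_gt0.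
have sl : s = t_ i + l * h by rewrite -lh addrC subrK.
(* q1 and q2 below involve a division by l *)
have [l00|ln0] := eqVneq l 0.
  have -> : y = p; last by apply: GH; left.
  apply/eqP; rewrite -subr_eq0; apply/eqP/(nrm_eq0 hX)/eqP.
  rewrite eq_le nrm_ge0// andbT; have := yle.
  have ph := Phi_sub1_le p (node_ge i) (lexx _) (node_le (ltnW iN)).
  rewrite subrr mulr0 expR0 subrr mul0r in ph.
  have {}ph : Phi (t_ i) (t_ i) *m p = p.
    apply/eqP; rewrite -subr_eq0; apply/eqP/(nrm_eq0 hX)/eqP.
    by rewrite eq_le nrm_ge0// andbT.
  have -> : s = t_ i by rewrite sl l00 mul0r addr0.
  rewrite ph subrr scale0r subr0 => /le_trans; apply.
  by rewrite /alpha /rfun mul0r expR0 subrr subr0 !mul0r.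
have lp : 0 < l by rewrite lt_neqAle eq_sym ln0.
pose Ps := Phi s (t_ i) *m p; pose P1 := Phi (t_ i.+1) (t_ i) *m p.
pose Ks := B s *m v; pose K1 := B (t_ i.+1) *m v.
pose err := y - Ps - (l * h) *: Ks.
have errle : normX err <= l * alph h.
  by rewrite /err /Ps /Ks -lh (le_trans yle)// lh alpha_scale// l0 l1.
pose q1 := P1 + h *: K1 + l^-1 *: err.
pose q2 := l^-1 *: (Ps - (1 - l) *: p - l *: P1) + h *: (Ks - K1).
have Oq1 : Omega i.+1 q1.
  apply: (Omega_of_Phi iN Op Uv); rewrite -/P1 -/K1.
  have -> : q1 - P1 - h *: K1 = l^-1 *: err.
    by rewrite /q1; apply/matrixP => i' j'; rewrite !mxE; ring.
  by rewrite (nrmZp hX) ?invr_ge0// ler_pdivrMl// mulrC.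
have q2le : normX q2 <= beta MdB nU h + gamma MA MdA h * b_ i.
  rewrite addrC (le_trans (nrmD hX _ _))// lerD//.
    rewrite (nrmZp hX) ?invr_ge0// ler_pdivrMl//.
    have := Phi_second p (node_ge i) h0 _ _ => /(_ l).
    rewrite -nodeS -sl node_le// l0 l1 => /(_ isT isT) /le_trans; apply.
    by rewrite ler_wpM2l// ler_wpM2l ?gamma_ge0// leO.
  rewrite (nrmZp hX)// nrmBC//.
  have e1 := B_lip v (le_trans (node_ge i) si) sS (node_le iN).
  have e2 : MdB * normU v * (t_ i.+1 - s) <= MdB * nU * h.
    apply: ler_pM; rewrite ?subr_ge0// ?mulr_ge0 ?nrm_ge0//.
      by rewrite ler_wpM2l// U_le.
    by rewrite lerBlDr nodeS [h + _]addrC lerD2r.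
  have := ler_wpM2l h0 (le_trans e1 e2); rewrite /beta => /le_trans; apply.
  by rewrite le_eqVlt; apply/orP; left; apply/eqP; ring.
have -> : y = (1 - l) *: p + (1 - (1 - l)) *: (q1 + q2).
  have -> : 1 - (1 - l) = l by ring.
  rewrite /q1 /q2 /err.
  by apply/matrixP => i' j'; rewrite !mxE; field.
move/convex_setP: GC; apply.
- by apply/andP; split; lra.
- by apply: GH; left.
- apply: GH; right; apply/(add_ballP hX).
    by rewrite addr_ge0 ?beta_ge0// mulr_ge0 ?gamma_ge0 ?radius_ge0// ltnW.
  by exists q1 => //; rewrite addrC addKr.
Qed.

Section Rate.
(** K dominates the error terms of one step, each with its order in h. *)
Context {K : R} (K0 : 0 <= K) (h1 : h <= 1) (alpha_K : alph h <= K * h ^+ 2)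
  (theta_K : theta h <= K * h ^+ 2) (gamma_K : gamma MA MdA h <= K * h ^+ 2)
  (beta_K : beta MdB nU h <= K * h ^+ 2) (exp_K : expR (MA * h) <= 1 + K * h)
  (MBnU_K : MB * nU <= K).

Let T := tf - t0.
Let Bd := expR (3 * K * T) * (nX + 1).

Lemma node_time i : (i <= N)%N -> 0 <= i%:R * h <= T.
Proof.
move=> iN; rewrite mulr_ge0//= /T lerBrDl; exact: node_le iN.
Qed.

Lemma quad_le_lin : K * h ^+ 2 <= K * h.
Proof. by rewrite ler_wpM2l// expr2 ler_piMl. Qed.

(** One step multiplies the radius by at most 1 + 3 K h and adds 2 K h.  After
    adding 1 to the radius, the factor absorbs the additive term. *)
Lemma radius_growth i : (i <= N)%N ->
  b_ i + 1 <= expR (3 * K * (i%:R * h)) * (nX + 1).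
Proof.
elim: i => [_|i IH iN].
  rewrite mul0r mulr0 expR0 mul1r lerD2r /b_ Omega0.
  by apply: set_norm_le => // x; exact: X0_le.
have [Sne _ _] := Omega_facts iN.
have [_ _ leO] := Omega_facts (ltnW iN).
have b0 := radius_ge0 (ltnW iN).
have Kh := quad_le_lin.
have Kh0 : 0 <= K * h by rewrite mulr_ge0.
have tb : theta h * b_ i <= K * h * b_ i.
  by rewrite ler_wpM2r// (le_trans theta_K).
have eb : expR (MA * h) * b_ i <= (1 + K * h) * b_ i by rewrite ler_wpM2r.
have mb : h * (MB * nU) <= K * h by rewrite mulrC ler_wpM2r.
have bS : b_ i.+1 <= (1 + 3 * (K * h)) * b_ i + 2 * (K * h).
  apply: set_norm_le => // z /(OmegaP _ iN)[x [v [Ox Uv zle]]].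
  rewrite (le_trans (step_norm_le iN (leO _ Ox) Uv zle))//.
  have al : alph h <= K * h by exact: le_trans alpha_K Kh.
  by lra.
have g : (1 + 3 * (K * h)) * (b_ i + 1) <= expR (3 * K * (i.+1%:R * h)) * (nX + 1).
  have -> : 3 * K * (i.+1%:R * h) = 3 * (K * h) + 3 * K * (i%:R * h).
    by rewrite -natr1; ring.
  rewrite expRD -mulrA; apply: ler_pM => //; last exact: IH (ltnW iN).
  - by rewrite addr_ge0// mulr_ge0.
  - by rewrite addr_ge0.
  - exact: expR_ge1Dx.
by rewrite (le_trans _ g)//; lra.
Qed.

Lemma Bd_ge0 : 0 <= Bd.
Proof. by rewrite mulr_ge0 ?expR_ge0// addr_ge0 ?nX_ge0. Qed.

Lemma radius_le i : (i <= N)%N -> b_ i <= Bd.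
Proof.
move=> iN; have := radius_growth iN; have /andP[_ iT] := node_time iN.
have : expR (3 * K * (i%:R * h)) * (nX + 1) <= Bd.
  rewrite /Bd ler_wpM2r ?addr_ge0 ?nX_ge0// ler_expR ler_wpM2l//.
  by rewrite mulr_ge0.
by lra.
Qed.

Lemma theta_radius i : (i <= N)%N -> theta h * b_ i <= K * h ^+ 2 * Bd.
Proof.
move=> iN; apply: ler_pM; [exact: theta0|exact: radius_ge0|by []|exact: radius_le].
Qed.

(** One step maps an error e to at most (1 + K h) e + 2 K h^2 (1 + Bd).  The bound in
    the statement is the resulting geometric sum, with (1 + K h)^i replaced by
    e^(K i h). *)
Lemma Omega_reach i w : (i <= N)%N -> Omega i w ->
  exists2 p, Rch (t_ i) p &
    normX (w - p) <= 2 * h * (1 + Bd) * (expR (K * (i%:R * h)) - 1).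
Proof.
elim: i w => [w _|i IH w iN].
  rewrite Omega0 => Xw; exists w; first by rewrite node0 Rch0.
  by rewrite subrr (nrm0 hX) mul0r mulr0 expR0 subrr mulr0.
move=> /(OmegaP _ iN)[x [v [Ox Uv wle]]].
have [p Rp xp] := IH x (ltnW iN) Ox.
have [y Ry yle] := Rch_fwd (node_ge i) (node_leS i) (node_le iN) Rp Uv.
exists y => //; rewrite node_sub in yle.
have [_ _ leO] := Omega_facts (ltnW iN).
have e1 := Phi_le (x - p) (node_ge i) (node_leS i) (node_le iN).
have e2 := phi'_le x (node_ge i) (node_leS i) (node_le iN).
rewrite node_sub in e1 e2.
have e3 : theta h * normX x <= theta h * b_ i by rewrite ler_wpM2l ?theta0 ?leO.
have tb := theta_radius (ltnW iN).
set P := Phi (t_ i.+1) (t_ i) in yle e1 e2; set Q := phi' _ _ in wle e2.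
set Kv := h *: _ in wle yle.
have -> : w - y = (w - Q *m x - Kv) - (y - P *m p - Kv) - (P *m x - Q *m x) + P *m (x - p).
  rewrite mulmxBr; move: (Q *m x) (P *m x) (P *m p) => q1 q2 q3.
  by apply/matrixP => i' j'; rewrite !mxE; ring.
have e4 : normX ((w - Q *m x - Kv) - (y - P *m p - Kv) - (P *m x - Q *m x) + P *m (x - p))
    <= normX (w - Q *m x - Kv) + normX (y - P *m p - Kv) + normX (P *m x - Q *m x)
      + normX (P *m (x - p)).
  by rewrite (le_trans (nrmD hX _ _))// lerD2r (le_trans (nrmB hX _ _))// lerD2r nrmB.
set d := 2 * h * (1 + Bd) in xp *; set E := expR (K * (i%:R * h)) in xp *.
have d0 : 0 <= d.
  by apply: mulr_ge0; [exact: mulr_ge0|apply: addr_ge0 => //; exact: Bd_ge0].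
have Kh0 : 0 <= K * h by rewrite mulr_ge0.
have e5 : normX (P *m (x - p)) <= (1 + K * h) * (d * (E - 1)).
  rewrite (le_trans e1)//; apply: ler_pM; rewrite ?expR_ge0 ?nrm_ge0//.
have e6 : d * ((1 + K * h) * E) <= d * expR (K * (i.+1%:R * h)).
  apply: ler_wpM2l => //.
  have -> : K * (i.+1%:R * h) = K * h + K * (i%:R * h) by rewrite -natr1; ring.
  by rewrite expRD ler_wpM2r ?expR_ge0// expR_ge1Dx.
have e7 : (1 + K * h) * (d * (E - 1)) = d * ((1 + K * h) * E) - d - d * (K * h) by ring.
have e8 : d * (K * h) = 2 * (K * h ^+ 2) + 2 * (K * h ^+ 2 * Bd) by rewrite /d; ring.
have al := alpha_K; rewrite /alph in al wle.
rewrite e7 e8 in e5; rewrite mulrBr mulr1.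
by rewrite (le_trans e4)//; lra.
Qed.

Let L := 2 * (1 + Bd) * expR (K * T) + K * (2 + 3 * Bd) + K * (1 + Bd).

(** Omega_i enlarged by a ball of radius O(h) is convex.  It contains Omega_i and the
    enlarged Omega_{i+1}, because phi' is within O(h) of the identity; so it contains
    their hull.  By [Omega_reach] its points are close to points reachable at t_i. *)
Lemma Gamma_reach i z : (i < N)%N -> Gamma i.+1 z ->
  exists2 p, Rch (t_ i) p & normX (z - p) <= L * h.
Proof.
move=> iN; have [_ cO leO] := Omega_facts (ltnW iN).
have b0 := radius_ge0 (ltnW iN).
have tb := theta_radius (ltnW iN).
have bB := radius_le (ltnW iN).
have Kh := quad_le_lin.
have Kh0 : 0 <= K * h by rewrite mulr_ge0.
have Bd0 := Bd_ge0.
have KhB : K * h ^+ 2 * Bd <= K * h * Bd by rewrite ler_wpM2r.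
have KhB0 : 0 <= K * h * Bd by rewrite mulr_ge0.
pose c := K * (2 + 3 * Bd) * h + K * (1 + Bd) * h.
have c0 : 0 <= c.
  by apply: addr_ge0; apply: mulr_ge0 => //; apply: mulr_ge0 => //;
    apply: addr_ge0 => //; exact: mulr_ge0.
have gb : gamma MA MdA h * b_ i <= K * h ^+ 2 * Bd.
  by apply: ler_pM => //; exact: gamma_ge0.
have infl0 : 0 <= beta MdB nU h + gamma MA MdA h * b_ i.
  by rewrite addr_ge0 ?beta_ge0// mulr_ge0 ?gamma_ge0.
have sub : Gamma i.+1 `<=` [set z | exists2 x, Omega i x & normX (z - x) <= c].
  rewrite GammaE//; apply: smallest_sub.
    exact: add_ball_convex.
  move=> y [Oy|/(add_ballP hX _ _ infl0)[x Ox yx]].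
    by exists y => //; rewrite subrr nrm0.
  have /(OmegaP _ iN)[w [v [Ow Uv xle]]] := Ox.
  exists w => //.
  have e1 := Phi_sub1_le w (node_ge i) (node_leS i) (node_le iN).
  have e2 := phi'_le w (node_ge i) (node_leS i) (node_le iN).
  rewrite node_sub in e1 e2.
  have wB : normX w <= Bd by rewrite (le_trans (leO _ Ow)).
  have e3 : theta h * normX w <= theta h * b_ i by rewrite ler_wpM2l ?theta0 ?leO.
  have e4 : (expR (MA * h) - 1) * normX w <= K * h * Bd.
    apply: (@le_trans _ _ (K * h * normX w)); last by rewrite ler_wpM2l.
    by rewrite ler_wpM2r ?nrm_ge0// lerBlDl.
  have e5 : normX (h *: (B (t_ i.+1) *m v)) <= K * h.
    rewrite (nrmZp hX)// mulrC ler_wpM2r//.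
    rewrite (le_trans (B_le _ _)) ?node_ge ?node_le//.
    by rewrite (le_trans _ MBnU_K)// ler_wpM2l// U_le.
  set P := Phi (t_ i.+1) (t_ i) in e1 e2; set Q := phi' _ _ in xle e2.
  set Kv := h *: _ in xle e5.
  have e6 : normX (y - w) <= normX (y - x) + normX (x - Q *m w - Kv) +
      normX (P *m w - Q *m w) + normX (P *m w - w) + normX Kv.
    have -> : y - w = (y - x) + (x - Q *m w - Kv) - (P *m w - Q *m w) + (P *m w - w) + Kv.
      by apply/matrixP => i' j'; rewrite !mxE; ring.
    rewrite (le_trans (nrmD hX _ _))// lerD2r (le_trans (nrmD hX _ _))// lerD2r.
    by rewrite (le_trans (nrmB hX _ _))// lerD2r nrmD.
  have cE : c = 3 * (K * h) + 4 * (K * h * Bd) by rewrite /c; ring.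
  have al := alpha_K; have be := beta_K.
  rewrite cE (le_trans e6)//.
  have s1 := le_trans yx (lerD (le_trans be Kh) (le_trans gb KhB)).
  have s2 := le_trans xle (lerD (le_trans al Kh) (le_trans tb KhB)).
  have s3 := le_trans e2 (le_trans e3 (le_trans tb KhB)).
  have s4 := le_trans e1 e4.
  by lra.
move=> /sub[x Ox zx]; have [p Rp xp] := Omega_reach (ltnW iN) Ox.
exists p => //; rewrite (le_trans (norm_dist_triangle hX x _ _))//.
have -> : L * h = c + 2 * h * (1 + Bd) * expR (K * T) by rewrite /L /c; ring.
apply: lerD => //; rewrite (le_trans xp)// ler_wpM2l//.
  by apply: mulr_ge0; [exact: mulr_ge0|exact: addr_ge0].
have /andP[_ iT] := node_time (ltnW iN).
have : expR (K * (i%:R * h)) <= expR (K * T) by rewrite ler_expR ler_wpM2l.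
by lra.
Qed.

End Rate.

End FixedN.

End Scheme.

(** * Convergence of the scheme for the control system *)

Section Final.
Context {R : realType}.

Lemma compact_norm_bounded n (N : 'cV[R]_n -> R) (hN : is_norm N) (M : set 'cV[R]_n) :
  M !=set0 -> compact M -> forall x, M x -> N x <= set_norm N M.
Proof.
move=> M0 Mc x Mx.
have cN : {within M, continuous N} by exact/continuous_subspaceT/nrm_continuous.
have [c _ cmax] := compact_EVT_max M0 Mc cN.
by apply: (@set_norm_ge _ _ _ _ (N c)) => // y My; apply: cmax; rewrite inE.
Qed.

Lemma reach_init n m (A : R -> 'M[R]_n) (B : R -> 'M[R]_(n, m)) X0 U t0 :
  U !=set0 -> reach A B X0 U t0 t0 = X0.
Proof.
move=> [v Uv]; apply/seteqP; split=> [y [x0 [u [x [Xx _ _ [_ xt _] ->]]]]|x Xx].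
  by rewrite xt.
exists x, (fun=> v), (fun=> x); apply: And5 => //.
split; [|by []|].
  apply: (@lipschitz_ac _ _ _ _ _ 0) => l r _ _ _.
  by rewrite subrr normr0 mul0r.
by apply: ae_interior => r /andP[/lt_trans h /h]; rewrite ltxx.
Qed.

Lemma bigO_square_near0 (theta : R -> R) : theta =O_ (0^'+) (fun h => h ^+ 2) ->
  exists k d, [/\ 0 < k, 0 < d & forall h, 0 < h -> h < d -> theta h <= k * h ^+ 2].
Proof.
move=> /eqO_exP[k k0 [d /= d0 hd]]; exists k, d; split => // h h0 hlt.
have := hd h; rewrite /ball_ /= sub0r normrN gtr0_norm// => /(_ hlt h0).
by rewrite [`|h ^+ 2|]ger0_norm ?sqr_ge0//; apply: le_trans; exact: ler_norm.
Qed.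

End Final.

Theorem mainTheorem1 (R : realType) (n m : nat) (n_gt0 : (0 < n)%N)
  (m_gt0 : (0 < m)%N)
  (normX : 'cV[R]_n -> R) (normU : 'cV[R]_m -> R)
  (normX_norm : is_norm normX) (normU_norm : is_norm normU)
  (t0 tf : R) (t0_lt_tf : t0 < tf)
  (X0 : set 'cV[R]_n) (U : set 'cV[R]_m)
  (X0_neq0 : X0 !=set0) (X0_compact : compact X0) (X0_convex : convex_set X0)
  (U_neq0 : U !=set0) (U_compact : compact U) (U_convex : convex_set U)
  (A dA : R -> 'M[R]_n) (B dB : R -> 'M[R]_(n, m))
  (A_C1 : C1_on t0 tf A dA) (B_C1 : C1_on t0 tf B dB)
  (MA MdA MB MdB : R) (MA_gt0 : 0 < MA)
  (A_le : forall t, t \in `[t0, tf] -> op_norm normX normX (A t) <= MA)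
  (dA_le : forall t, t \in `[t0, tf] -> op_norm normX normX (dA t) <= MdA)
  (B_le : forall t, t \in `[t0, tf] -> op_norm normU normX (B t) <= MB)
  (dB_le : forall t, t \in `[t0, tf] -> op_norm normU normX (dB t) <= MdB)
  (phi' : R -> R -> 'M[R]_n) (theta : R -> R)
  (theta_ge0 : forall s, 0 <= s -> 0 <= theta s)
  (theta_mono : forall s s', 0 <= s -> s <= s' -> theta s <= theta s')
  (phi'_approx : forall t s, t \in `[t0, tf] -> s \in `[t0, tf] -> s <= t ->
    op_norm normX normX (transition A B t0 tf t s - phi' t s) <= theta (t - s))
  (theta_O : theta =O_ (0^'+) (fun h => h ^+ 2))
  (Omega Gamma : nat -> nat -> set 'cV[R]_n)
  (Omega0 : forall N, (0 < N)%N -> Omega N 0%N = X0)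
  (OmegaS : forall N i, (0 < N)%N -> (1 <= i <= N)%N ->
    let h := step t0 tf N in
    Omega N i =
      set_add
        (set_add
          (set_mulmx (phi' (node t0 tf N i) (node t0 tf N i.-1)) (Omega N i.-1))
          (set_scale h (set_mulmx (B (node t0 tf N i)) U)))
        (set_scale (alpha MA MB MdB (set_norm normU U) h
                    + theta h * set_norm normX (Omega N i.-1))
          (unit_ball normX)))
  (GammaE : forall N i, (0 < N)%N -> (1 <= i <= N)%N ->
    let h := step t0 tf N in
    Gamma N i =
      conv_hull
        (Omega N i.-1 `|`
         set_add (Omega N i)
           (set_scale (beta MdB (set_norm normU U) h
                       + gamma MA MdA h * set_norm normX (Omega N i.-1))
             (unit_ball normX)))) :
  (forall N i, (0 < N)%N -> (1 <= i <= N)%N ->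
     reach_tube A B X0 U t0 (node t0 tf N i.-1) (node t0 tf N i)
       `<=` Gamma N i) /\
  (exists C : R, 0 <= C /\ exists N0 : nat, (0 < N0)%N /\
     forall N i, (N0 <= N)%N -> (1 <= i <= N)%N ->
       (hausdorff_dist normX
          (reach_tube A B X0 U t0 (node t0 tf N i.-1) (node t0 tf N i))
          (Gamma N i) <= (C / N%:R)%:E)%E).
Proof.
have inI t : t0 <= t <= tf -> t \in `[t0, tf] by rewrite in_itv.
have A_le' t (tt : t0 <= t <= tf) := A_le t (inI t tt).
have dA_le' t (tt : t0 <= t <= tf) := dA_le t (inI t tt).
have B_le' t (tt : t0 <= t <= tf) := B_le t (inI t tt).
have dB_le' t (tt : t0 <= t <= tf) := dB_le t (inI t tt).
have t00 : t0 <= t0 <= tf by rewrite lexx ltW.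
have MdA0 : 0 <= MdA := le_trans (op_norm_ge0 normX_norm normX_norm _ n_gt0) (dA_le' _ t00).
have MB0 : 0 <= MB := le_trans (op_norm_ge0 normU_norm normX_norm _ m_gt0) (B_le' _ t00).
have MdB0 : 0 <= MdB := le_trans (op_norm_ge0 normU_norm normX_norm _ m_gt0) (dB_le' _ t00).
have lA := C1_lip_in normX_norm normX_norm A_C1 dA_le'.
have [X [Y F]] := fundamental_exists (ltW t0_lt_tf) lA.
set nU := set_norm normU U; set nX := set_norm normX X0.
have U_le : forall v, U v -> normU v <= nU := compact_norm_bounded normU_norm U_neq0 U_compact.
have X0_le : forall x, X0 x -> normX x <= nX := compact_norm_bounded normX_norm X0_neq0 X0_compact.
pose Phi t s := X t *m Y s.
pose Rch := reach A B X0 U t0.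
have Rch0 : Rch t0 = X0 by exact: reach_init.
have Phi_le s t q : t0 <= s -> s <= t -> t <= tf ->
    normX (Phi t s *m q) <= expR (MA * (t - s)) * normX q.
  by move=> ts st tt; rewrite /Phi -mulmxA;
    apply: (flow_bound normX_norm t0_lt_tf A_C1 MA_gt0 A_le' dA_le' F).
have Phi_sub1_le s t q : t0 <= s -> s <= t -> t <= tf ->
    normX (Phi t s *m q - q) <= (expR (MA * (t - s)) - 1) * normX q.
  by move=> ts st tt; rewrite /Phi -mulmxA;
    apply: (flow_sub1_bound normX_norm t0_lt_tf A_C1 MA_gt0 A_le' dA_le' F).
have Phi_second s h l q : t0 <= s -> 0 <= h -> s + h <= tf -> 0 <= l <= 1 ->
    normX (Phi (s + l * h) s *m q - (1 - l) *: q - l *: (Phi (s + h) s *m q)) <=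
    l * (gamma MA MdA h * normX q).
  by move=> ts h0 sh l01; rewrite /Phi -!mulmxA;
    apply: (second_difference normX_norm t0_lt_tf A_C1 MA_gt0 MdA0 A_le' dA_le' F).
have Bn_le t v : t0 <= t <= tf -> normX (B t *m v) <= MB * normU v.
  by move=> tt; apply: (B_bound normX_norm normU_norm B_le').
have B_lip s t v : t0 <= s -> s <= t -> t <= tf ->
    normX (B t *m v - B s *m v) <= MdB * normU v * (t - s).
  by move=> ts st tt; apply: (B_lip_norm normX_norm normU_norm B_C1 dB_le').
have Rch_back s t y : t0 <= s -> s <= t -> t <= tf -> Rch t y ->
    exists p v, [/\ Rch s p, U v &
      normX (y - Phi t s *m p - (t - s) *: (B t *m v)) <= alpha MA MB MdB nU (t - s)].
  move=> ts st tt [x0 [u [x [Xx mu_ uU sol ->]]]].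
  have [|v Uv vle] := local_reach normX_norm normU_norm t0_lt_tf A_C1 B_C1 MA_gt0 MB0 MdB0
    A_le' dA_le' B_le' dB_le' F U_compact U_convex U_neq0 U_le (lexx t0) ts st (lexx t) tt sol.
    by move=> r /andP[sr rt]; apply: uU; rewrite in_itv/= rt (le_trans ts)// ltW.
  exists (x s), v; split => //; last by rewrite /Phi -mulmxA.
  exact: reach_restrict st Xx mu_ uU sol.
have alpha_mono c h : 0 <= c -> c <= nU -> alpha MA MB MdB c h <= alpha MA MB MdB nU h.
  move=> c0 cU; rewrite /alpha; apply: ler_wpM2r.
    apply: divr_ge0; last exact/exprn_ge0/ltW.
    by apply: addr_ge0 => //; apply: mulr_ge0 => //; exact: ltW.
  by apply: ler_wpM2l => //; exact: rfun_ge0.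
have Rch_fwd s t p v : t0 <= s -> s <= t -> t <= tf -> Rch s p -> U v ->
    exists2 y, Rch t y &
      normX (y - Phi t s *m p - (t - s) *: (B t *m v)) <= alpha MA MB MdB nU (t - s).
  move=> ts st tt Rp Uv.
  have [y Ry yle] := reach_step normX_norm normU_norm t0_lt_tf A_C1 B_C1 MA_gt0 MB0 MdB0
    A_le' dA_le' B_le' dB_le' F ts st tt Uv Rp.
  exists y => //; rewrite /Phi -mulmxA (le_trans yle)// alpha_mono ?U_le//.
  exact: nrm_ge0.
have phi'_le t s q : t0 <= s -> s <= t -> t <= tf ->
    normX (Phi t s *m q - phi' t s *m q) <= theta (t - s) * normX q.
  move=> ts st tt; rewrite -mulmxBl (le_trans (op_norm_le normX_norm normX_norm _ _))//.
  rewrite ler_wpM2r ?nrm_ge0// /Phi.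
  rewrite -(transition_eq (B := B) normX_norm t0_lt_tf A_C1 dA_le' F ts st tt).
  apply: phi'_approx => //; apply: inI; first by rewrite tt (le_trans ts).
  by rewrite ts (le_trans st).
have OmegaS' N : (0 < N)%N -> forall i, (i < N)%N -> _ := fun N0 i iN => OmegaS N i.+1 N0 iN.
have GammaE' N : (0 < N)%N -> forall i, (i < N)%N -> _ := fun N0 i iN => GammaE N i.+1 N0 iN.
split.
  move=> N [//|i] N0 iN.
  exact: (tube_Gamma normX_norm normU_norm t0_lt_tf X0_neq0 X0_convex U_neq0 U_convex
    MA_gt0 MdA0 MB0 MdB0 U_le X0_le Rch0 Phi_le Phi_sub1_le Phi_second Bn_le B_lip
    Rch_back theta_ge0 phi'_le N0 (Omega0 N N0) (OmegaS' N N0) (GammaE' N N0) iN).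
have [k [d [k0 d0 theta_k]]] := bigO_square_near0 theta_O.
pose T := tf - t0; have T0 : 0 < T by rewrite subr_gt0.
pose E := expR (MA * T); have E0 : 0 <= E by exact: expR_ge0.
have nU0 : 0 <= nU := nU_ge0 normU_norm U_neq0 U_le.
pose ca := nU * ((MdB + MA * MB) / MA ^+ 2).
have ca0 : 0 <= ca := alpha_coef_ge0 normU_norm U_neq0 MA_gt0 MB0 MdB0 U_le.
pose cg := 1 + MdA / MA ^+ 2.
have cg0 : 0 <= cg := gamma_coef_ge0 MA_gt0 MdA0.
have ME0 : 0 <= MA ^+ 2 * E by rewrite mulr_ge0// sqr_ge0.
have MAE0 : 0 <= MA * E by rewrite mulr_ge0// ltW.
have MdBnU0 : 0 <= MdB * nU by rewrite mulr_ge0.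
have MBnU0 : 0 <= MB * nU by rewrite mulr_ge0.
have MEca0 : 0 <= MA ^+ 2 * E * ca by rewrite mulr_ge0.
have MEcg0 : 0 <= MA ^+ 2 * E * cg by rewrite mulr_ge0.
pose K := k + MA ^+ 2 * E * ca + MA ^+ 2 * E * cg + MdB * nU + MA * E + MB * nU.
have k0' := ltW k0.
have K0 : 0 <= K by rewrite /K !addr_ge0.
pose L := 2 * (1 + expR (3 * K * T) * (nX + 1)) * expR (K * T) +
  K * (2 + 3 * (expR (3 * K * T) * (nX + 1))) + K * (1 + expR (3 * K * T) * (nX + 1)).
have nX0 : 0 <= nX := nX_ge0 normX_norm X0_neq0 X0_le.
have L0 : 0 <= L.
  have B0 : 0 <= expR (3 * K * T) * (nX + 1) by rewrite mulr_ge0 ?expR_ge0 ?addr_ge0.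
  rewrite /L; move: (expR (3 * K * T) * (nX + 1)) B0 => B1 B10.
  have B2 : 0 <= 1 + B1 by exact: addr_ge0.
  have B3 : 0 <= 2 + 3 * B1 by apply: addr_ge0 => //; exact: mulr_ge0.
  apply: addr_ge0; last exact: mulr_ge0.
  apply: addr_ge0; last exact: mulr_ge0.
  by apply: mulr_ge0; [exact: mulr_ge0|exact: expR_ge0].
pose d1 := Num.min 1 d; have d10 : 0 < d1 by rewrite lt_min ltr01.
exists (L * T + 1); split; first by rewrite addr_ge0// mulr_ge0// ltW.
(* beyond this index, h < 1 and theta(h) <= k h^2 *)
exists (Num.bound (T / d1)).+1; split => // N i NN /andP[i1 iN].
have N0 : (0 < N)%N by exact: leq_trans NN.
have Np : 0 < N%:R :> R by rewrite ltr0n.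
set h := step t0 tf N.
have hE : h = T / N%:R by [].
have h0 : 0 < h by rewrite hE divr_gt0.
have hd1 : h < d1.
  rewrite hE ltr_pdivrMr// -ltr_pdivrMl// mulrC.
  have : T / d1 < (Num.bound (T / d1))%:R.
    by apply: archi_boundP; rewrite divr_ge0// ltW.
  by move=> /lt_trans; apply; rewrite ltr_nat.
have [h1 hd] : h < 1 /\ h < d by move: hd1; rewrite lt_min => /andP[].
have h1' := ltW h1.
have hT : h <= T by rewrite hE ler_pdivrMr// ler_peMr ?(ltW T0) // ler1n.
have h2 : 0 <= h ^+ 2 by rewrite sqr_ge0.
have rq : rfun MA h <= MA ^+ 2 * E * h ^+ 2.
  by apply: rfun_quadratic => //; exact: ltW.
have Kpart c : 0 <= c -> c <= K -> c * h ^+ 2 <= K * h ^+ 2 by move=> _; exact: ler_wpM2r.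
have alpha_K : alpha MA MB MdB nU h <= K * h ^+ 2.
  rewrite /alpha -mulrA -/ca; apply: (@le_trans _ _ (MA ^+ 2 * E * ca * h ^+ 2)).
    by rewrite [leRHS]mulrAC ler_wpM2r.
  by apply: Kpart => //; rewrite /K; lra.
have theta_K : theta h <= K * h ^+ 2.
  by rewrite (le_trans (theta_k h h0 hd))//; apply: Kpart => //; rewrite /K; lra.
have gamma_K : gamma MA MdA h <= K * h ^+ 2.
  rewrite /gamma -/cg; apply: (@le_trans _ _ (MA ^+ 2 * E * cg * h ^+ 2)).
    by rewrite [leRHS]mulrAC ler_wpM2r.
  by apply: Kpart => //; rewrite /K; lra.
have beta_K : beta MdB nU h <= K * h ^+ 2.
  rewrite /beta -mulrA mulrC; apply: Kpart => //; rewrite /K; lra.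
have exp_K : expR (MA * h) <= 1 + K * h.
  have e1 := expR_sub1_le (MA * h).
  have e2 : MA * h * expR (MA * h) <= MA * E * h.
    rewrite [leRHS]mulrAC; apply: ler_wpM2l; first by rewrite mulr_ge0 ?ltW.
    by rewrite /E ler_expR ler_wpM2l ?(ltW MA_gt0).
  have e3 : MA * E * h <= K * h by rewrite ler_wpM2r ?(ltW h0)// /K; lra.
  by lra.
have MBnU_K : MB * nU <= K by rewrite /K; lra.
case: i i1 iN => [//|i] _ iN.
have C0 : 0 < (L * T + 1) / N%:R.
  by rewrite divr_gt0// ltr_wpDl// mulr_ge0// ltW.
apply: ereal_inf_lbound; exists ((L * T + 1) / N%:R) => //; split => //.
  move=> y Ry; apply/(add_ballP normX_norm _ _ (ltW C0)).
  exists y; last by rewrite subrr (nrm0 normX_norm) ltW.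
  exact: (tube_Gamma normX_norm normU_norm t0_lt_tf X0_neq0 X0_convex U_neq0 U_convex
    MA_gt0 MdA0 MB0 MdB0 U_le X0_le Rch0 Phi_le Phi_sub1_le Phi_second Bn_le B_lip
    Rch_back theta_ge0 phi'_le N0 (Omega0 N N0) (OmegaS' N N0) (GammaE' N N0) iN).
move=> z Gz; apply/(add_ballP normX_norm _ _ (ltW C0)).
have [p Rp zp] := Gamma_reach normX_norm normU_norm t0_lt_tf X0_neq0 X0_convex U_neq0
  U_convex MA_gt0 MdA0 MB0 MdB0 U_le X0_le Rch0 Phi_le Phi_sub1_le Bn_le Rch_fwd
  theta_ge0 phi'_le N0 (Omega0 N N0) (OmegaS' N N0) (GammaE' N N0) K0 h1' alpha_K
  theta_K gamma_K beta_K exp_K MBnU_K iN Gz.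
exists p.
  exists (node t0 tf N i) => //; rewrite /= in_itv/= lexx/=.
  by rewrite /node lerD2l ler_wpM2r ?ler_nat// ltW.
rewrite (le_trans zp)// -/T -/L -/h hE mulrA ler_wpM2r ?invr_ge0 ?(ltW Np)//.
by rewrite lerDl.
Qed.
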